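(* Let $\tau\in L^{1}_{loc}(\mathbb{R})$ be boundedly decreasing, vanish on $(-\infty,0)$, and have convergent (improper) Laplace transform $\mathcal{L}\{\tau;s\}=\int_0^\infty\tau(x)e^{-sx}\,\mathrm{d}x$ for $\Re e\, s>0$. Suppose that, for some constants $a,b_n,c_n\in\mathbb{C}$, real numbers $\beta_n<1$ and $k_n\in\mathbb{Z}_{+}$ ($n=0,\dots,N$), the function $$\mathcal{L}\{\tau;s\}-\frac{a}{s^2}-\sum_{n=0}^{N}\frac{b_n+c_n\log^{k_n}(1/s)}{s^{\beta_n+1}}$$ has pseudomeasure boundary behavior at $s=0$. Then, as $x\to\infty$, $$\tau(x)=ax+\sum_{n=0}^{N}x^{\beta_n}\left(\frac{b_n}{\Gamma(\beta_n+1)}+c_n\sum_{j=0}^{k_n}\binom{k_n}{j}D_j(\beta_n+1)\log^{k_n-j}x\right)+O(1).$$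
   Context: A real-valued function $\tau$ is boundedly decreasing if there is $\delta>0$ with $\liminf_{x\to\infty}\inf_{h\in[0,\delta]}(\tau(x+h)-\tau(x))>-\infty$ (for complex-valued functions: real and imaginary parts are). $D_j(\omega)=\frac{d^j}{dy^j}\left(\frac{1}{\Gamma(y)}\right)\big|_{y=\omega}$. $\log$ is the principal branch. The Fourier transform is $\hat\varphi(t)=\int e^{-itx}\varphi(x)\,\mathrm{d}x$. A tempered distribution $f$ is a pseudomeasure if $\hat f\in L^\infty(\mathbb{R})$. An analytic function $F$ on $\Re e\, s>0$ has pseudomeasure boundary behavior at $s=0$ if there is an open interval $U\ni0$ such that $F(\sigma+it)$ converges in $\mathcal{D}'(U)$ as $\sigma\to0^+$ to a distribution that coincides, near each point of $U$, with a pseudomeasure. *)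

(* Defs.v *)
From mathcomp Require Import all_boot all_order all_algebra.
From mathcomp Require Import all_classical all_reals all_analysis.
From mathcomp Require Export complex.
Import GRing.Theory Num.Theory numFieldNormedType.Exports.
Local Open Scope ring_scope.
Local Open Scope classical_set_scope.

Set Implicit Arguments. Unset Strict Implicit. Unset Printing Implicit Defensive.

Section Defs.
Context {R : realType}.
Local Notation C := R[i].

Definition cRe (z : C) : R := complex.Re z.
Definition cIm (z : C) : R := complex.Im z.
Definition cr (x : R) : C := Complex x 0.
Definition ci : C := Complex 0 1.
Definition cabs (z : C) : R := Num.sqrt (cRe z ^+ 2 + cIm z ^+ 2).

Definition cexp (z : C) : C :=
  Complex (expR (cRe z) * cos (cIm z)) (expR (cRe z) * sin (cIm z)).

(** principal argument, with values in (-pi, pi] (arg 0 := 0) *)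
Definition carg (z : C) : R :=
  let x := cRe z in let y := cIm z in
  if 0 < x then atan (y / x)
  else if x < 0 then (if 0 <= y then atan (y / x) + pi else atan (y / x) - pi)
  else if 0 < y then pi / 2 else if y < 0 then - (pi / 2) else 0.

Definition clog (z : C) : C := Complex (ln (cabs z)) (carg z).

Definition cpow (z w : C) : C := cexp (w * clog z).

Definition cintegrable (D : set R) (f : R -> C) : Prop :=
  lebesgue_measure.-integrable D (EFin \o (cRe \o f)) /\
  lebesgue_measure.-integrable D (EFin \o (cIm \o f)).

Definition cintegral (D : set R) (f : R -> C) : C :=
  Complex (Rintegral lebesgue_measure D (cRe \o f))
          (Rintegral lebesgue_measure D (cIm \o f)).

Definition L1loc (f : R -> C) : Prop :=
  forall a b : R, cintegrable `[a, b] f.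

Definition ccvg_pinfty (g : R -> C) (l : C) : Prop :=
  (cRe (g x) @[x --> +oo] --> cRe l) /\ (cIm (g x) @[x --> +oo] --> cIm l).

Definition ccvg_right0 (g : R -> C) (l : C) : Prop :=
  (cRe (g x) @[x --> 0^'+] --> cRe l) /\ (cIm (g x) @[x --> 0^'+] --> cIm l).

Definition laplace_integrand (tau : R -> C) (s : C) : R -> C :=
  fun x => tau x * cexp (- s * cr x).

Definition laplace_converges (tau : R -> C) (s : C) : Prop :=
  exists L : C, ccvg_pinfty (fun T => cintegral `[0, T] (laplace_integrand tau s)) L.

Definition laplace (tau : R -> C) (s : C) : C :=
  Complex (lim (cRe (cintegral `[0, T] (laplace_integrand tau s)) @[T --> +oo]))
          (lim (cIm (cintegral `[0, T] (laplace_integrand tau s)) @[T --> +oo])).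

(* liminf_{x->oo} inf_{h in [0,delta]} (f(x+h) - f(x)) > -oo, written out *)
Definition boundedly_decreasing_real (f : R -> R) : Prop :=
  exists delta : R, 0 < delta /\
    exists M X : R, forall x h : R, X <= x -> 0 <= h <= delta ->
      - M <= f (x + h) - f x.

Definition boundedly_decreasing (f : R -> C) : Prop :=
  boundedly_decreasing_real (cRe \o f) /\ boundedly_decreasing_real (cIm \o f).

(** ** Reciprocal Gamma function (Gauss' limit formula, valid on all of R)
    1/Gamma(x) = lim_n x(x+1)...(x+n) / (n! n^x) *)
Definition rgamma (x : R) : R :=
  lim ((\prod_(i < n.+1) (x + i%:R)) / (n`!%:R * (n%:R `^ x)) @[n --> \oo]).

Definition Dgam (j : nat) (w : R) : R := derive1n j rgamma w.

Definition smooth_real (f : R -> R) : Prop :=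
  forall (n : nat) (x : R), derivable (derive1n n f) x 1.

Definition test_fun (a b : R) (phi : R -> C) : Prop :=
  smooth_real (cRe \o phi) /\ smooth_real (cIm \o phi) /\
  exists c d : R, a < c /\ d < b /\ forall t, (t < c \/ d < t) -> phi t = 0.

Definition fourier (phi : R -> C) (xi : R) : C :=
  cintegral setT (fun x => cexp (- (ci * cr (xi * x))) * phi x).

(** the distribution g coincides on (a,b) with a pseudomeasure f, i.e. with a
    tempered distribution whose Fourier transform is some h in L^oo(R);
    for phi in D, <f, phi> = <hat f, psi> with hat psi = phi,
    psi(x) = (1/2pi) hat(phi)(-x). *)
Definition pseudomeasure_on (g : (R -> C) -> C) (a b : R) : Prop :=
  exists h : R -> C,
    measurable_fun setT (cRe \o h) /\ measurable_fun setT (cIm \o h) /\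
    (exists M : R, forall x, cabs (h x) <= M) /\
    forall phi, test_fun a b phi ->
      g phi = cr (2 * pi)^-1 * cintegral setT (fun x => h x * fourier phi (- x)).

Definition pseudomeasure_boundary_at0 (F : C -> C) : Prop :=
  exists a b : R, a < 0 < b /\
  exists g : (R -> C) -> C,
    (forall phi, test_fun a b phi ->
       ccvg_right0 (fun sigma => cintegral setT (fun t => F (Complex sigma t) * phi t))
                   (g phi)) /\
    (forall t0, a < t0 < b -> exists e : R,
       0 < e /\ a <= t0 - e /\ t0 + e <= b /\ pseudomeasure_on g (t0 - e) (t0 + e)).

End Defs.

(* Main.v *)
(* Write y = beta + 1.  Differentiating int_0^oo x^(y-1) e^(-sx) dx = Gamma(y) s^(-y) with respect
   to y and applying Leibniz' rule to 1/Gamma(y) times that integral, one finds that, for 0 < y < 2,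
   log^k(1/s) / s^y is exactly the Laplace transform of
   x^(y-1) sum_j C(k,j) D_j(y) log^(k-j) x.  The main terms with beta >= 0 (and a x) have bounded
   increments, so subtracting them from tau leaves a boundedly decreasing rho; those with beta < 0
   are bounded, and their transforms are O(|t|^(-g)) with g < 1 near s = 0, uniformly in sigma.

   Let phi be the autocorrelation of a bump function psi, so that K = hat phi = |hat psi|^2 >= 0.
   Pairing the Laplace transform of rho with phi(t) e^(iyt), the hypothesis at s = 0 bounds
   int rho(x) e^(-sigma x) K(x - y) dx as sigma -> 0+, uniformly in y.  Bounded decrease gives
   rho(x) >= -C (1 + x), and Fatou's lemma removes the factor e^(-sigma x).  If rho(y) is very large
   (very negative) it stays so on a long interval to the right (left) of y, and K centred there
   contradicts the bound, provided rho is controlled elsewhere: this holds for y nearly maximising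
   |rho(y)| / (1 + eps y), with constants independent of eps, and eps -> 0 gives rho = O(1). *)
Require Import Defs.
From mathcomp Require Import all_boot all_order all_algebra.
From mathcomp Require Import all_classical all_reals all_analysis.
From mathcomp Require Import complex measurable_realfun.
From mathcomp Require Import ring lra.
Import Order.TTheory GRing.Theory Num.Theory numFieldNormedType.Exports.
Local Open Scope ring_scope.
Local Open Scope classical_set_scope.
Set Implicit Arguments. Unset Strict Implicit. Unset Printing Implicit Defensive.

(** * Complex arithmetic and derivatives *)
Section ComplexAlgebra.
Context {R : realType}.
Implicit Types (z w : R[i]) (x y : R).

(** Complex analysis is replaced by real calculus: functions are differentiated only in a real
    parameter, and an identity in the half-plane Re s > 0 is proved by showing that a suitable
    product has zero derivative along the segment from 1 to s. [rgamma] is given by Gauss' limit,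
    whereas the transforms produce Euler's integral; the two are matched on (0, 2) by convexity
    estimates for Gamma. In the Tauberian step every unwanted contribution (linear growth, the loss
    allowed by bounded decrease, the mass of K far from its centre z) is dominated by a multiple of
    1 + (x - z)^2, so K has to be integrable against this weight; two derivatives of psi give K(v) =
    O((1 + v^2)^(-2)). The weighted supremum could a priori be infinite, because bounded decrease
    controls rho from below only. The pairing is therefore used twice: first for a crude upper bound
    of order 1 + y, then for the bound independent of eps. *)

Lemma complex_eta z : z = Complex (cRe z) (cIm z). Proof. by case: z. Qed.
Lemma complex_ext z w : cRe z = cRe w -> cIm z = cIm w -> z = w.
Proof. by case: z => a b; case: w => c d /= -> ->. Qed.
Lemma cReD z w : cRe (z + w) = cRe z + cRe w. Proof. by case: z; case: w. Qed.
Lemma cImD z w : cIm (z + w) = cIm z + cIm w. Proof. by case: z; case: w. Qed.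
Lemma cReN z : cRe (- z) = - cRe z. Proof. by case: z. Qed.
Lemma cImN z : cIm (- z) = - cIm z. Proof. by case: z. Qed.
Lemma cReB z w : cRe (z - w) = cRe z - cRe w. Proof. by rewrite cReD cReN. Qed.
Lemma cImB z w : cIm (z - w) = cIm z - cIm w. Proof. by rewrite cImD cImN. Qed.
Lemma cReM z w : cRe (z * w) = cRe z * cRe w - cIm z * cIm w.
Proof. by case: z; case: w. Qed.
Lemma cImM z w : cIm (z * w) = cRe z * cIm w + cIm z * cRe w.
Proof. by case: z; case: w. Qed.
Lemma cRe_cr x : cRe (cr x) = x. Proof. by []. Qed.
Lemma cIm_cr x : cIm (cr x) = 0. Proof. by []. Qed.
Definition cE := (cReD, cImD, cReN, cImN, cReM, cImM, cRe_cr, cIm_cr).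

Lemma crD x y : cr (x + y) = cr x + cr y.
Proof. by apply: complex_ext; rewrite !cE ?addr0. Qed.
Lemma crM x y : cr (x * y) = cr x * cr y.
Proof. by apply: complex_ext; rewrite !cE; ring. Qed.
Lemma crN x : cr (- x) = - cr x.
Proof. by apply: complex_ext; rewrite !cE ?oppr0. Qed.
Lemma cr0 : cr 0 = 0 :> R[i]. Proof. by []. Qed.
Lemma cr1 : cr 1 = 1 :> R[i]. Proof. by []. Qed.
Lemma normC_cabs z : `|z| = cr (cabs z). Proof. by case: z. Qed.
Lemma cabs_ge0 z : 0 <= cabs z. Proof. exact: sqrtr_ge0. Qed.
Lemma cabs0 : cabs (0 : R[i]) = 0.
Proof. by rewrite /cabs /= expr0n /= addr0 sqrtr0. Qed.
Lemma cabsM z w : cabs (z * w) = cabs z * cabs w.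
Proof. by have := normrM z w; rewrite !normC_cabs -crM => -[]. Qed.
Lemma cabsD z w : cabs (z + w) <= cabs z + cabs w.
Proof. by have := ler_normD z w; rewrite !normC_cabs -crD lecR. Qed.
Lemma cabsN z : cabs (- z) = cabs z.
Proof. by rewrite /cabs cReN cImN !sqrrN. Qed.
Lemma cabs_cr x : cabs (cr x) = `|x|.
Proof. by rewrite /cabs /= expr0n /= addr0 sqrtr_sqr. Qed.
Lemma cabsX z n : cabs (z ^+ n) = cabs z ^+ n.
Proof.
elim: n => [|n IH]; last by rewrite !exprS cabsM IH.
by rewrite !expr0 -cr1 cabs_cr normr1.
Qed.
Lemma cabsV z : cabs z^-1 = (cabs z)^-1.
Proof. by case: z => a b; exact: (Normc.normcV (Complex a b)). Qed.
Lemma normRe_cabs z : `|cRe z| <= cabs z.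
Proof. by rewrite -sqrtr_sqr ler_wsqrtr// lerDl sqr_ge0. Qed.
Lemma normIm_cabs z : `|cIm z| <= cabs z.
Proof. by rewrite -sqrtr_sqr ler_wsqrtr// lerDr sqr_ge0. Qed.
Lemma cabs_le_ReIm z : cabs z <= `|cRe z| + `|cIm z|.
Proof.
rewrite {1}(complex_eta z).
have -> : Complex (cRe z) (cIm z) = cr (cRe z) + ci * cr (cIm z).
  by apply: complex_ext; rewrite !cE /=; ring.
apply: (le_trans (cabsD _ _)); rewrite cabsM !cabs_cr.
suff -> : cabs (ci : R[i]) = 1 by rewrite mul1r.
by rewrite /cabs /= expr0n /= add0r expr1n sqrtr1.
Qed.
Lemma cabs_sum n (F : 'I_n -> R[i]) : cabs (\sum_i F i) <= \sum_i cabs (F i).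
Proof.
elim/big_ind2: _ => //; first by rewrite cabs0.
by move=> z a w b za wb; apply: (le_trans (cabsD _ _)); exact: lerD.
Qed.
Lemma cabs_sqr z : cabs z ^+ 2 = cRe z ^+ 2 + cIm z ^+ 2.
Proof. by rewrite sqr_sqrtr// addr_ge0// sqr_ge0. Qed.
Lemma cabs_gt0 z : 0 < cRe z -> 0 < cabs z.
Proof. by move=> z0; rewrite sqrtr_gt0 ltr_wpDr ?sqr_ge0// exprn_gt0. Qed.

Lemma cexpD z w : cexp (z + w) = cexp z * cexp w.
Proof.
apply: complex_ext; rewrite !cE /= ?cE expRD ?cosD ?sinD; ring.
Qed.
Lemma cexp0 : cexp (0 : R[i]) = 1.
Proof. by rewrite /cexp /= expR0 cos0 sin0 mulr1 mulr0. Qed.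
Lemma cabs_cexp z : cabs (cexp z) = expR (cRe z).
Proof.
rewrite /cabs /= !exprMn -mulrDr cos2Dsin2 mulr1 sqrtr_sqr.
by rewrite ger0_norm// expR_ge0.
Qed.
Lemma cexpN_mul z : cexp (- z) * cexp z = 1.
Proof. by rewrite -cexpD addNr cexp0. Qed.
Lemma cexp_neq0 z : cexp z != 0.
Proof.
apply/eqP => z0; have := cexpN_mul z.
by rewrite z0 mulr0 => /eqP; rewrite eq_sym oner_eq0.
Qed.
Lemma cexp_inv z : (cexp z)^-1 = cexp (- z).
Proof.
apply: (mulIf (cexp_neq0 z)); rewrite mulVf ?cexp_neq0//.
by rewrite cexpN_mul.
Qed.
Lemma cexp_cr x : cexp (cr x) = cr (expR x).
Proof. by rewrite /cexp /= cos0 sin0 mulr0 mulr1. Qed.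
End ComplexAlgebra.

Section ComplexDerivative.
Context {R : realType}.
Implicit Types (f g : R -> R[i]).

(** Differentiation in a real parameter, one component at a time. Dependence on [s] is later handled
    by moving along a real segment. *)
Definition cderive f (x : R) (l : R[i]) :=
  is_derive x 1 (fun t => cRe (f t)) (cRe l) /\
  is_derive x 1 (fun t => cIm (f t)) (cIm l).

Lemma cderive_eq f x l l' : cderive f x l -> l = l' -> cderive f x l'.
Proof. by move=> h <-. Qed.

Lemma is_derive_ext (f g : R -> R) (x l : R) : f =1 g -> is_derive x 1 f l -> is_derive x 1 g l.
Proof. by move=> /funext ->. Qed.

Lemma is_derive_mul (f g : R -> R) (x a b : R) : is_derive x 1 f a -> is_derive x 1 g b ->
  is_derive x 1 (fun t => f t * g t) (a * g x + f x * b).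
Proof.
move=> fa gb; apply: (@is_derive_ext (f * g)) => //.
by apply: is_derive_eq; rewrite /GRing.scale /=; ring.
Qed.

Lemma is_derive_add (f g : R -> R) (x a b : R) : is_derive x 1 f a -> is_derive x 1 g b ->
  is_derive x 1 (fun t => f t + g t) (a + b).
Proof. by move=> fa gb; apply: (@is_derive_ext (f + g)). Qed.

Lemma is_derive_sub (f g : R -> R) (x a b : R) : is_derive x 1 f a -> is_derive x 1 g b ->
  is_derive x 1 (fun t => f t - g t) (a - b).
Proof. by move=> fa gb; apply: (@is_derive_ext (f - g)). Qed.

Lemma is_derive_val (f : R -> R) (x a b : R) : is_derive x 1 f a -> a = b -> is_derive x 1 f b.
Proof. by move=> h <-. Qed.

Lemma is_derive_compose (f g : R -> R) (x a b : R) : is_derive (g x) 1 f a -> is_derive x 1 g b ->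
  is_derive x 1 (fun t => f (g t)) (a * b).
Proof. by move=> fa gb; exact: (is_derive1_comp (f := f) (g := g)). Qed.

Lemma cderiveD f g x a b : cderive f x a -> cderive g x b ->
  cderive (fun t => f t + g t) x (a + b).
Proof.
move=> [f1 f2] [g1 g2]; split; rewrite !cE.
- apply: is_derive_ext (is_derive_add f1 g1) => t; by rewrite cReD.
- apply: is_derive_ext (is_derive_add f2 g2) => t; by rewrite cImD.
Qed.

Lemma cderiveM f g x a b : cderive f x a -> cderive g x b ->
  cderive (fun t => f t * g t) x (a * g x + f x * b).
Proof.
move=> [f1 f2] [g1 g2]; split; rewrite !cE.
- apply: is_derive_ext; last first.
    refine (is_derive_val (is_derive_sub (is_derive_mul f1 g1) (is_derive_mul f2 g2)) _).
    by ring.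
  by move=> t; rewrite cReM.
- apply: is_derive_ext; last first.
    refine (is_derive_val (is_derive_add (is_derive_mul f1 g2) (is_derive_mul f2 g1)) _).
    by ring.
  by move=> t; rewrite cImM.
Qed.

Lemma cderive_cst z x : cderive (fun=> z) x 0.
Proof. by split; exact: is_derive_cst. Qed.

Lemma cderiveZ f z x a : cderive f x a -> cderive (fun t => z * f t) x (z * a).
Proof.
move=> fa; apply: cderive_eq; first exact: (cderiveM (cderive_cst z x) fa).
by rewrite mul0r add0r.
Qed.

Lemma cderiveB f g x a b : cderive f x a -> cderive g x b ->
  cderive (fun t => f t - g t) x (a - b).
Proof.
move=> fa gb; have := cderiveD fa (cderiveZ (-1) gb).
by rewrite mulN1r; congr cderive; apply/funext => t; rewrite mulN1r.
Qed.

Lemma cderive_cr (u : R -> R) (x a : R) : is_derive x 1 u a -> cderive (fun t => cr (u t)) x (cr a).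
Proof. by move=> ua; split => //=; exact: is_derive_cst. Qed.

Lemma cderive_cexp f x a : cderive f x a -> cderive (fun t => cexp (f t)) x (a * cexp (f x)).
Proof.
move=> [f1 f2]; have e1 := is_derive_compose (is_derive_expR (cRe (f x))) f1.
split.
- refine (is_derive_val (is_derive_mul e1 (is_derive_compose (is_derive_cos (cIm (f x))) f2)) _).
  by rewrite !cE /=; ring.
- refine (is_derive_val (is_derive_mul e1 (is_derive_compose (is_derive_sin (cIm (f x))) f2)) _).
  by rewrite !cE /=; ring.
Qed.

Lemma cderive_sum n (F : 'I_n -> R -> R[i]) (F' : 'I_n -> R[i]) x :
  (forall i, cderive (F i) x (F' i)) ->
  cderive (fun t => \sum_i F i t) x (\sum_i F' i).
Proof.
move=> h; elim: n F F' h => [|n IH] F F' h.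
  rewrite big_ord0; have := cderive_cst 0 x.
  by congr cderive; apply/funext => t; rewrite big_ord0.
rewrite big_ord_recl.
rewrite (_ : (fun _ => _) = (fun t => F ord0 t + \sum_(i < n) F (lift ord0 i) t)).
  by apply: cderiveD => //; apply: IH => i.
by apply/funext => t; rewrite big_ord_recl.
Qed.

Lemma cderive_unique f x a b : cderive f x a -> cderive f x b -> a = b.
Proof.
move=> [a1 a2] [b1 b2]; apply: complex_ext.
- by have := @derive_val _ _ _ _ _ _ _ a1; rewrite (@derive_val _ _ _ _ _ _ _ b1) => ->.
- by have := @derive_val _ _ _ _ _ _ _ a2; rewrite (@derive_val _ _ _ _ _ _ _ b2) => ->.
Qed.

Lemma is_derive_near (f g : R -> R) (x l : R) : (\near x, f x = g x) ->
  is_derive x 1 f l -> is_derive x 1 g l.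
Proof.
move=> fg [df fl]; split; first by apply: near_eq_derivable df; rewrite ?oner_eq0.
by rewrite -fl; apply/esym/near_eq_derive; rewrite ?oner_eq0.
Qed.

Lemma cderive_near f g x l : (\near x, f x = g x) -> cderive f x l -> cderive g x l.
Proof.
by move=> fg [f1 f2]; split; [apply: is_derive_near f1 | apply: is_derive_near f2];
  apply: filterS fg => t ->.
Qed.

Lemma is_derive0_cst (f : R -> R) (a b : R) :
  (forall x, a < x < b -> is_derive x 1 f 0) ->
  forall x y, a < x < b -> a < y < b -> f x = f y.
Proof.
move=> h.
suff H x y : x < y -> a < x < b -> a < y < b -> f x = f y.
  move=> x y xab yab; have [xy|yx|->//] := ltgtP x y; first exact: H.
  by apply/esym/H.
move=> xy /andP[ax xb] /andP[ay yb].
have hin z : z \in `[x, y]%R -> a < z < b.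
  rewrite in_itv/= => /andP[xz zy].
  by rewrite (lt_le_trans ax xz) (le_lt_trans zy yb).
have [||c _] := @MVT _ f (cst 0) x y xy.
- by move=> z zxy; apply/h/hin; apply: subset_itv_oo_cc zxy.
- apply: derivable_within_continuous => z zxy.
  by have [] := h z (hin z zxy).
by move=> /eqP; rewrite mul0r subr_eq0 => /eqP.
Qed.

Lemma cderive0_cst f (a b : R) : (forall x, a < x < b -> cderive f x 0) ->
  forall x y, a < x < b -> a < y < b -> f x = f y.
Proof.
move=> h x y xab yab; apply: complex_ext.
- by apply: (@is_derive0_cst (fun t => cRe (f t)) a b) => // t /h[].
- by apply: (@is_derive0_cst (fun t => cIm (f t)) a b) => // t /h[].
Qed.
End ComplexDerivative.

(** * Lebesgue integration of real and complex functions *)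
Section RealIntegration.
Context {R : realType}.
Local Notation T := (measurableTypeR R).
Implicit Types (D : set T) (f g : R -> R).
Local Notation mu := (@lebesgue_measure R).

Definition rintegrable D f := mu.-integrable D (EFin \o f).

Lemma rintegrable_meas D f : rintegrable D f -> measurable_fun D f.
Proof. by move=> /measurable_int/measurable_EFinP. Qed.

Lemma rintegrable_le D f g : measurable D -> measurable_fun D f ->
  (forall x, D x -> `|f x| <= g x) -> rintegrable D g -> rintegrable D f.
Proof.
move=> mD mf fg ig; apply: le_integrable ig => //; first exact/measurable_EFinP.
by move=> x Dx /=; rewrite lee_fin (le_trans (fg x Dx))// ler_norm.
Qed.

Lemma eq_rintegrable D f g : measurable D -> (forall x, D x -> f x = g x) ->
  rintegrable D f -> rintegrable D g.
Proof.
by move=> mD fg; apply: eq_integrable => // x /set_mem Dx /=; rewrite fg.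
Qed.

Lemma eq_Rint D f g : (forall x, D x -> f x = g x) ->
  Rintegral mu D f = Rintegral mu D g.
Proof. by move=> fg; apply: eq_Rintegral => x /set_mem; exact: fg. Qed.

Lemma rintegrableD D f g : measurable D -> rintegrable D f -> rintegrable D g ->
  rintegrable D (fun x => f x + g x).
Proof. by move=> mD fi gi; exact: (integrableD mD fi gi). Qed.

Lemma rintegrableB D f g : measurable D -> rintegrable D f -> rintegrable D g ->
  rintegrable D (fun x => f x - g x).
Proof. by move=> mD fi gi; exact: (integrableB mD fi gi). Qed.

Lemma rintegrableZ D f (c : R) : measurable D -> rintegrable D f ->
  rintegrable D (fun x => c * f x).
Proof. by move=> mD fi; exact: (integrableZl mD c fi). Qed.

Lemma rintegrable_abs D f : measurable D -> rintegrable D f ->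
  rintegrable D (fun x => `|f x|).
Proof.
by move=> mD fi; exact: (integrable_abse fi).
Qed.

Lemma rintegrable_mul_bounded D f g (M : R) : measurable D -> rintegrable D f ->
  measurable_fun D g -> (forall x, D x -> `|g x| <= M) ->
  rintegrable D (fun x => f x * g x).
Proof.
move=> mD fi mg gM; apply: (@rintegrable_le _ _ (fun x => M * `|f x|)) => //.
- by apply: measurable_funM => //; exact: rintegrable_meas.
- by move=> x Dx; rewrite normrM mulrC ler_wpM2r// gM.
- exact/rintegrableZ/rintegrable_abs.
Qed.

Lemma rintegrable_sub D (D' : set T) f : measurable D -> measurable D' -> D' `<=` D ->
  rintegrable D f -> rintegrable D' f.
Proof. by move=> mD mD' DD; apply: integrableS. Qed.

Lemma rintegrable_mkcond D f : measurable D ->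
  rintegrable D f <-> rintegrable setT (f \_ D).
Proof.
move=> mD; rewrite /rintegrable integrable_mkcond//.
by rewrite -restrict_EFin.
Qed.

Lemma rintegrable_dominated (f_ : nat -> R -> R) f g D : measurable D ->
  (forall n, measurable_fun D (f_ n)) -> measurable_fun D f ->
  (forall x, D x -> f_ n x @[n --> \oo] --> f x) ->
  (forall n x, D x -> `|f_ n x| <= g x) -> rintegrable D g ->
  rintegrable D f /\
  Rintegral mu D (f_ n) @[n --> \oo] --> Rintegral mu D f.
Proof.
move=> mD mf_ mf cvf fg ig.
have [||||if_ _ cf] := @dominated_convergence _ _ _ mu D mD
   (fun n x => (f_ n x)%:E) (EFin \o f) (EFin \o g) _ _ _ ig.
- by move=> n; exact/measurable_EFinP.
- exact/measurable_EFinP.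
- by apply: aeW => x Dx; apply: cvg_EFin; [exact: nearW|exact: cvf].
- by apply: aeW => x n Dx; rewrite lee_fin; exact: fg.
split => //; rewrite /Rintegral.
apply: fine_cvg; rewrite fineK; first exact: cf.
exact: integrable_fin_num.
Qed.

(** Fatou's lemma packaged with the integrability of the limit; pointwise convergence identifies the
    lower limit with [f]. *)
Lemma rintegrable_fatou (f_ : nat -> R -> R) f (B : R) D : measurable D ->
  (forall n, rintegrable D (f_ n)) -> measurable_fun D f ->
  (forall n x, D x -> 0 <= f_ n x) ->
  (forall x, D x -> f_ n x @[n --> \oo] --> f x) ->
  (forall n, Rintegral mu D (f_ n) <= B) ->
  rintegrable D f /\ Rintegral mu D f <= B.
Proof.
move=> mD fi mf f0 cvf fB.
have f_ge0 x : D x -> 0 <= f x.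
  move=> Dx; apply: (cvgr_to_ge (cvf x Dx)).
  by apply: nearW => n; exact: f0.
have fat : (\int[mu]_(x in D) (f x)%:E <= B%:E)%E.
  have m1 n : measurable_fun D (fun x => (f_ n x)%:E).
    by apply/measurable_EFinP; exact: rintegrable_meas (fi n).
  have p1 n x : D x -> (0 <= (f_ n x)%:E)%E by move=> Dx; rewrite lee_fin f0.
  have h := fatou mu mD m1 p1; apply: (@le_trans _ _ (\int[mu]_(x in D) limn_einf (fun n => (f_ n x)%:E))%E).
    rewrite le_eqVlt; apply/orP; left; apply/eqP.
    apply: eq_integral => x /set_mem Dx.
    apply/esym/(cvg_limn_einf_sup _).1.
    by apply: cvg_EFin; [exact: nearW|exact: cvf].
  (* The lower limit is the limit of tail infima, and each of these is at most its first term, hence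
     at most [B]. *)
  apply: (le_trans h); rewrite limn_einf_lim; apply: lime_le.
    exact: is_cvg_einfs.
  apply: nearW => n; apply: (@le_trans _ _ (\int[mu]_(x in D) (f_ n x)%:E)%E).
    by apply: ereal_inf_lbound; exists n => /=.
  by rewrite -(fineK (integrable_fin_num mD (fi n))) lee_fin; exact: fB.
split.
  apply/integrableP; split; first exact/measurable_EFinP.
  rewrite (_ : (\int[mu]_(x in D) _)%E = (\int[mu]_(x in D) (f x)%:E)%E).
    by apply: (le_lt_trans fat); rewrite ltry.
  by apply: eq_integral => x /set_mem Dx /=; rewrite ger0_norm// f_ge0.
rewrite /Rintegral -lee_fin fineK//.
rewrite ge0_fin_numE.
  by apply: (le_lt_trans fat); rewrite ltry.
by apply: integral_ge0 => x Dx; rewrite lee_fin f_ge0.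
Qed.

Lemma le_Rint D f g : measurable D -> rintegrable D f -> rintegrable D g ->
  (forall x, D x -> f x <= g x) -> Rintegral mu D f <= Rintegral mu D g.
Proof. exact: le_Rintegral. Qed.

Lemma abs_Rint_le D f g : measurable D -> rintegrable D f -> rintegrable D g ->
  (forall x, D x -> `|f x| <= g x) -> `|Rintegral mu D f| <= Rintegral mu D g.
Proof.
move=> mD fi gi fg; apply: le_trans (le_normr_Rintegral mD fi) _.
by apply: le_Rint => //; exact: rintegrable_abs.
Qed.

(** Monotone convergence along the exhausting intervals: each partial integral is
    [F (b n) - F (a n)], hence at most [B + B]. *)
Lemma rintegrable_antiderivative (a b : nat -> R) f (F : R -> R) (B : R) D :
  (forall n, a n < b n) ->
  (forall m n, (m <= n)%N -> a n <= a m /\ b m <= b n) ->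
  D = \bigcup_n `[a n, b n]%classic ->
  (forall x, D x -> is_derive x 1 F (f x)) ->
  (forall x, D x -> {for x, continuous f}) ->
  (forall x, D x -> 0 <= f x) ->
  (forall x, D x -> `|F x| <= B) ->
  rintegrable D f.
Proof.
move=> ab abm DE dF cf f0 FB.
have DI n x : x \in `[a n, b n]%R -> D x.
  by move=> xab; rewrite DE; exists n.
have mD : measurable D by rewrite DE; apply: bigcup_measurable => n _.
have mfn n : measurable_fun `[a n, b n]%classic f.
  apply: subspace_continuous_measurable_fun => //.
  apply: continuous_in_subspaceT => x /set_mem /= xab.
  by apply: cf; exact: DI xab.
have mf : measurable_fun D f.
  rewrite DE; apply/measurable_fun_bigcup => n //; exact: mfn.
apply/integrableP; split; first exact/measurable_EFinP.
rewrite (_ : (\int[mu]_(x in D) _)%E = (\int[mu]_(x in D) (f x)%:E)%E); last first.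
  by apply: eq_integral => x /set_mem Dx /=; rewrite ger0_norm// f0.
apply: (@le_lt_trans _ _ (B + B)%:E); last by rewrite ltry.
have mon : nondecreasing_seq (fun n => `[a n, b n]%classic).
  move=> m n mn; have [h1 h2] := abm m n mn.
  rewrite subsetEset => x /=; rewrite !in_itv/= => /andP[h3 h4].
  by rewrite (le_trans h1 h3) (le_trans h4 h2).
have m1 n : measurable_fun `[a n, b n]%classic (EFin \o f) by exact/measurable_EFinP.
have p1 n x : `[a n, b n]%classic x -> (0 <= (EFin \o f) x)%E.
  by move=> xab; rewrite lee_fin; apply: f0; exact: DI xab.
have := @ge0_nondecreasing_set_cvg_integral _ T _ (fun n => `[a n, b n]%classic)
  (EFin \o f) mu mon (fun n => measurable_itv _) m1 p1.
rewrite -DE => cv; rewrite -(cvg_lim _ cv)//.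
apply: lime_le; first by apply/cvg_ex; eexists; exact: cv.
apply: nearW => n.
rewrite (@continuous_FTC2 _ f F)//.
- rewrite -EFinB lee_fin; have h x : x \in `[a n, b n]%R -> `|F x| <= B.
    by move=> h; apply: FB; exact: DI h.
  have := h (a n); have := h (b n); rewrite !in_itv/= !lexx (ltW (ab n)) => /(_ isT) + /(_ isT).
  by rewrite !ler_norml; lra.
- apply: continuous_in_subspaceT => x /set_mem /= xab.
  by apply: cf; exact: DI xab.
- have dI x : x \in `[a n, b n]%R -> derivable F x 1.
    by move=> xab; have [] := dF x (DI n x xab).
  split.
  + by move=> x xab; apply: dI; exact: subset_itv_oo_cc xab.
  + apply: cvg_at_right_filter; apply: differentiable_continuous.
    by apply/derivable1_diffP/dI; rewrite in_itv/= lexx (ltW (ab n)).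
  + apply: cvg_at_left_filter; apply: differentiable_continuous.
    by apply/derivable1_diffP/dI; rewrite in_itv/= lexx (ltW (ab n)).
- move=> x xab; rewrite derive1E.
  by have [_ ->] := dF x (DI n x (subset_itv_oo_cc xab)).
Qed.
End RealIntegration.

Section MeasurePreserving.
Context {R : realType}.
Local Notation mu := (@lebesgue_measure R).
Local Notation T := (measurableTypeR R).

(** The pushforward of Lebesgue measure by [p] agrees with Lebesgue measure on half-open intervals,
    which determine it. Translation and reflection are the two uses. *)
Lemma rintegrable_measure_preserving (p : T -> T) (f : R -> R) : measurable_fun setT p ->
  (forall a b : R, mu (p @^-1` `]a, b]) = mu `]a, b]) -> rintegrable setT f ->
  rintegrable setT (fun x => f (p x)) /\ Rintegral mu setT (fun x => f (p x)) = Rintegral mu setT f.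
Proof.
move=> ms Hp fi; have mf := rintegrable_meas fi.
have mfs : measurable_fun [set: T] (fun x : T => f (p x)) by apply: (measurableT_comp mf).
pose nu : {measure set T -> \bar R} :=
  @measure_function_pushforward__canonical__measure_function_Measure _ _ T T R mu _ ms.
have nuE (A : set T) : measurable A -> pushforward mu p A = mu A.
  move=> mA; apply/esym; apply: (@lebesgue_measure_unique R nu) => //= X [[a b] _ <-] /=.
  by rewrite -Hp.
have E (g : T -> \bar R) : (\int[pushforward mu p]_x g x = \int[mu]_x g x)%E.
  by apply: (@eq_measure_integral _ _ _ _ mu nu) => A mA _; exact: nuE.
have ifs : rintegrable setT (fun x => f (p x)).
  apply/integrableP; split; first exact/measurable_EFinP.
  have /integrableP[_] := fi; rewrite -E (ge0_integral_pushforward ms)//.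
  by apply: measurableT_comp => //; exact/measurable_EFinP.
split=> //; rewrite /Rintegral; congr fine.
rewrite -[RHS]E (integral_pushforward ms)//.
exact/measurable_EFinP.
Qed.

Lemma rintegrable_shift (f : R -> R) (c : R) : rintegrable setT f ->
  rintegrable setT (fun x => f (x + c)) /\
  Rintegral mu setT (fun x => f (x + c)) = Rintegral mu setT f.
Proof.
apply: (rintegrable_measure_preserving (p := fun x : T => x + c : T)).
  by have : measurable_fun setT (fun x : R => x + c) by exact: measurable_funD.
move=> a b; rewrite (_ : _ @^-1` _ = `](a - c), (b - c)]%classic); last first.
  apply/seteqP; split => x /=; rewrite !in_itv/=; lra.
rewrite !lebesgue_measure_itv /= !lte_fin.
by rewrite ltrD2r; case: ifPn => // _; rewrite -!EFinB; congr EFin; lra.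
Qed.

Lemma rintegrable_reflect (f : R -> R) : rintegrable setT f ->
  rintegrable setT (fun x => f (- x)) /\
  Rintegral mu setT (fun x => f (- x)) = Rintegral mu setT f.
Proof.
apply: (rintegrable_measure_preserving (p := fun x : T => - x : T)).
  by have : measurable_fun setT (fun x : R => - x) by exact: measurable_funN.
move=> a b; rewrite (_ : _ @^-1` _ = `[(- b), (- a)[%classic); last first.
  apply/seteqP; split => x /=; rewrite !in_itv/=; lra.
rewrite !lebesgue_measure_itv /= !lte_fin.
by rewrite ltrN2; case: ifPn => // _; rewrite -!EFinB; congr EFin; lra.
Qed.
End MeasurePreserving.

Section ComplexIntegration.
Context {R : realType}.
Local Notation mu := (@lebesgue_measure R).
Local Notation T := (measurableTypeR R).
Implicit Types (D : set T) (f g : R -> R[i]).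

Definition cmeasurable d (X : measurableType d) (D : set X) (f : X -> R[i]) :=
  measurable_fun D (fun x => cRe (f x)) /\ measurable_fun D (fun x => cIm (f x)).

Section Measurability.
Context d (X : measurableType d).
Implicit Types (E : set X) (u v : X -> R[i]).

Lemma cmeasurableD E u v : cmeasurable E u -> cmeasurable E v ->
  cmeasurable E (fun x => u x + v x).
Proof.
move=> [u1 u2] [v1 v2]; split.
- by under eq_fun do rewrite cReD; exact: measurable_funD.
- by under eq_fun do rewrite cImD; exact: measurable_funD.
Qed.

Lemma cmeasurableM E u v : cmeasurable E u -> cmeasurable E v ->
  cmeasurable E (fun x => u x * v x).
Proof.
move=> [u1 u2] [v1 v2]; split.
- by under eq_fun do rewrite cReM; apply: measurable_funB; exact: measurable_funM.
- by under eq_fun do rewrite cImM; apply: measurable_funD; exact: measurable_funM.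
Qed.

Lemma eq_cmeasurable E u v : (forall x, E x -> u x = v x) -> cmeasurable E u -> cmeasurable E v.
Proof.
move=> uv [u1 u2]; split.
- by apply: eq_measurable_fun u1 => x /set_mem Ex; rewrite uv.
- by apply: eq_measurable_fun u2 => x /set_mem Ex; rewrite uv.
Qed.

Lemma cmeasurable_cst E z : cmeasurable E (fun=> z).
Proof. by split; exact: measurable_cst. Qed.

Lemma cmeasurable_cr E (w : X -> R) : measurable_fun E w -> cmeasurable E (fun x => cr (w x)).
Proof. by move=> mw; split => //; exact: measurable_cst. Qed.

Lemma cmeasurable_cexp E u : cmeasurable E u -> cmeasurable E (fun x => cexp (u x)).
Proof.
have mcos : measurable_fun setT (@cos R) by apply: continuous_measurable_fun; exact: continuous_cos.
have msin : measurable_fun setT (@sin R) by apply: continuous_measurable_fun; exact: continuous_sin.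
move=> [u1 u2]; split => /=; apply: measurable_funM; apply: measurableT_comp => //.
Qed.

Lemma cmeasurableX E u n : cmeasurable E u -> cmeasurable E (fun x => u x ^+ n).
Proof.
move=> mu_; elim: n => [|n IH]; first exact: cmeasurable_cst.
by under eq_fun do rewrite exprS; exact: cmeasurableM.
Qed.

Lemma measurable_cabs E u : cmeasurable E u -> measurable_fun E (fun x => cabs (u x)).
Proof.
move=> [u1 u2]; apply: measurableT_comp.
  by apply: continuous_measurable_fun; exact: sqrt_continuous.
by apply: measurable_funD; exact: measurable_funX.
Qed.
End Measurability.

Lemma cintegrable_meas D f : cintegrable D f -> cmeasurable D f.
Proof. by move=> [f1 f2]; split; exact: rintegrable_meas. Qed.

Lemma cintegrable_le D f (g : R -> R) : measurable D -> cmeasurable D f ->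
  (forall x, D x -> cabs (f x) <= g x) -> rintegrable D g -> cintegrable D f.
Proof.
move=> mD [m1 m2] fg ig; split.
- by apply: rintegrable_le ig => // x Dx; apply: le_trans (fg x Dx); exact: normRe_cabs.
- by apply: rintegrable_le ig => // x Dx; apply: le_trans (fg x Dx); exact: normIm_cabs.
Qed.

Lemma eq_cintegrable D f g : measurable D -> (forall x, D x -> f x = g x) ->
  cintegrable D f -> cintegrable D g.
Proof.
by move=> mD fg [f1 f2]; split; [apply: eq_rintegrable f1 | apply: eq_rintegrable f2] => // x Dx /=; rewrite fg.
Qed.

Lemma eq_cintegral D f g : (forall x, D x -> f x = g x) -> cintegral D f = cintegral D g.
Proof. by move=> fg; congr Complex; apply: eq_Rint => x Dx /=; rewrite fg. Qed.

Lemma cintegrable_cabs D f : measurable D -> cintegrable D f -> rintegrable D (fun x => cabs (f x)).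
Proof.
move=> mD fi; have [f1 f2] := fi.
apply: (@rintegrable_le _ _ _ (fun x => `|cRe (f x)| + `|cIm (f x)|)) => //.
- by apply: measurable_cabs; exact: cintegrable_meas.
- by move=> x Dx; rewrite ger0_norm ?cabs_ge0// cabs_le_ReIm.
- by apply: rintegrableD => //; exact: rintegrable_abs.
Qed.

Lemma cintegrableD D f g : measurable D -> cintegrable D f -> cintegrable D g ->
  cintegrable D (fun x => f x + g x).
Proof.
move=> mD [f1 f2] [g1 g2]; split.
- by apply: eq_rintegrable (rintegrableD mD f1 g1) => // x _ /=; rewrite cReD.
- by apply: eq_rintegrable (rintegrableD mD f2 g2) => // x _ /=; rewrite cImD.
Qed.

Lemma cintegralD D f g : measurable D -> cintegrable D f -> cintegrable D g ->
  cintegral D (fun x => f x + g x) = cintegral D f + cintegral D g.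
Proof.
move=> mD [f1 f2] [g1 g2]; apply: complex_ext; rewrite cE /= -RintegralD//;
  by apply: eq_Rint => x _ /=; rewrite cE.
Qed.

Lemma cintegrableZ D f z : measurable D -> cintegrable D f ->
  cintegrable D (fun x => z * f x).
Proof.
move=> mD [f1 f2]; split.
- apply: eq_rintegrable (rintegrableB mD (rintegrableZ (cRe z) mD f1) (rintegrableZ (cIm z) mD f2)) => //.
  by move=> x _ /=; rewrite cReM.
- apply: eq_rintegrable (rintegrableD mD (rintegrableZ (cRe z) mD f2) (rintegrableZ (cIm z) mD f1)) => //.
  by move=> x _ /=; rewrite cImM.
Qed.

Lemma cintegralZ D f z : measurable D -> cintegrable D f ->
  cintegral D (fun x => z * f x) = z * cintegral D f.
Proof.
move=> mD [f1 f2]; apply: complex_ext; rewrite cE /= -!RintegralZl//.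
- rewrite -RintegralB//; [|exact: rintegrableZ..].
  by apply: eq_Rint => x _ /=; rewrite cE.
- rewrite -RintegralD//; [|exact: rintegrableZ..].
  by apply: eq_Rint => x _ /=; rewrite cE.
Qed.

Lemma cintegrableB D f g : measurable D -> cintegrable D f -> cintegrable D g ->
  cintegrable D (fun x => f x - g x).
Proof.
move=> mD fi gi; have := cintegrableD mD fi (cintegrableZ (-1) mD gi).
by apply: eq_cintegrable => // x _; rewrite mulN1r.
Qed.

Lemma cintegralB D f g : measurable D -> cintegrable D f -> cintegrable D g ->
  cintegral D (fun x => f x - g x) = cintegral D f - cintegral D g.
Proof.
move=> mD fi gi; have := cintegralD mD fi (cintegrableZ (-1) mD gi).
rewrite cintegralZ// mulN1r => <-.
by apply: eq_cintegral => x _; rewrite mulN1r.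
Qed.

Lemma cintegrable0 D : cintegrable D (fun=> 0).
Proof. by split; exact: integrable0. Qed.

Lemma cintegral0 D : cintegral D (fun=> 0) = 0.
Proof.
by apply: complex_ext => /=; rewrite /Rintegral /= integral0.
Qed.

Lemma cintegrable_sum D n (F : 'I_n -> R -> R[i]) : measurable D ->
  (forall i, cintegrable D (F i)) ->
  cintegrable D (fun x => \sum_i F i x) /\
  cintegral D (fun x => \sum_i F i x) = \sum_i cintegral D (F i).
Proof.
move=> mD; elim: n F => [|n IH] F Fi.
  have E x : 0 = \sum_i F i x :> R[i] by rewrite big_ord0.
  rewrite big_ord0 -(funext E); split; [exact: cintegrable0 | exact: cintegral0].
have [h1 h2] := IH (fun i => F (lift ord0 i)) (fun i => Fi _).
rewrite big_ord_recl -h2 -cintegralD//; split.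
  apply: eq_cintegrable (cintegrableD mD (Fi ord0) h1) => // x _.
  by rewrite big_ord_recl.
by apply: eq_cintegral => x _; rewrite big_ord_recl.
Qed.

(** Multiplying by the conjugate [zc] of the integral [z] turns the squared modulus into a real
    part, to which the real triangle inequality applies without loss of constant. *)
Lemma cabs_cintegral_le D f (g : R -> R) : measurable D -> cintegrable D f ->
  rintegrable D g -> (forall x, D x -> cabs (f x) <= g x) ->
  cabs (cintegral D f) <= Rintegral mu D g.
Proof.
move=> mD fi gi fg; set z := cintegral D f.
have g0 : 0 <= Rintegral mu D g.
  by apply: Rintegral_ge0 => x Dx; apply: le_trans (fg x Dx); exact: cabs_ge0.
have [z0|z0] := eqVneq (cabs z) 0; first by rewrite z0.
have zp : 0 < cabs z by rewrite lt_def z0 cabs_ge0.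
pose zc : R[i] := Complex (cRe z) (- cIm z).
have zcE : cabs zc = cabs z by rewrite /cabs /zc /= sqrrN.
have E : cabs z ^+ 2 = cRe (cintegral D (fun x => zc * f x)).
  rewrite cintegralZ// -/z cReM cabs_sqr.
  by rewrite (_ : cRe zc = cRe z)// (_ : cIm zc = - cIm z)//; ring.
rewrite -(ler_pM2l zp) -expr2 E.
rewrite -RintegralZl//; apply: (@le_trans _ _ `|Rintegral mu D (fun x => cRe (zc * f x))|).
  exact: ler_norm.
apply: abs_Rint_le => //.
- by have [] := cintegrableZ zc mD fi.
- exact: rintegrableZ.
- move=> x Dx; apply: (le_trans (normRe_cabs _)).
  by rewrite cabsM zcE ler_wpM2l ?cabs_ge0// fg.
Qed.

Lemma cderive_under_integral D (f f' : R -> R -> R[i]) (a u v : R) (G : R -> R) :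
  measurable D -> u < a < v ->
  (forall x, u < x < v -> cintegrable D (f x)) ->
  (forall x y, u < x < v -> D y -> cderive (fun t => f t y) x (f' x y)) ->
  (forall x y, u < x < v -> D y -> cabs (f' x y) <= G y) ->
  (forall y, 0 <= G y) -> rintegrable D G ->
  cderive (fun t => cintegral D (f t)) a (cintegral D (f' a)).
Proof.
move=> mD uav fi df f'G G0 iG.
(* One argument for both components: [p] is the real or the imaginary part, and [|p z| <= |z|]
   transfers the domination to it. *)
have H (p : R[i] -> R) : (forall z, `|p z| <= cabs z) ->
  (forall x, u < x < v -> rintegrable D (fun y => p (f x y))) ->
  (forall x y, u < x < v -> D y -> is_derive x 1 (fun t => p (f t y)) (p (f' x y))) ->
  is_derive a 1 (fun t => Rintegral mu D (fun y => p (f t y)))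
     (Rintegral mu D (fun y => p (f' a y))).
  move=> pc pi pd.
  have Ia : `]u, v[%classic a by rewrite /= in_itv.
  have d1E x y : u < x < v -> D y -> partial1of2 (fun t y => p (f t y)) x y = p (f' x y).
    move=> xuv Dy; rewrite /partial1of2 derive1E.
    by have [_ ->] := pd x y xuv Dy.
  have pd1 x y : `]u, v[%classic x -> D y -> derivable (fun t => p (f t y)) x 1.
    by rewrite /= in_itv/= => xuv Dy; have [] := pd x y xuv Dy.
  have pi1 x : `]u, v[%classic x -> mu.-integrable D (EFin \o (fun y => p (f x y))).
    by rewrite /= in_itv/= => xuv; exact: pi.
  have pG1 x y : `]u, v[%classic x -> D y ->
      `|partial1of2 (fun t y => p (f t y)) x y| <= G y.
    rewrite /= in_itv/= => xuv Dy; rewrite d1E//.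
    by apply: le_trans (f'G x y xuv Dy); exact: pc.
  split.
    exact: (derivable_under_integral mD Ia pi1 pd1 G0 iG pG1).
  rewrite -derive1E (differentiation_under_integral mD Ia pi1 pd1 G0 iG pG1).
  by apply: eq_Rint => y Dy; exact: d1E.
split.
- apply: (H (@cRe R)); first exact: normRe_cabs.
  + by move=> x /fi[].
  + by move=> x y xuv Dy; have [] := df x y xuv Dy.
- apply: (H (@cIm R)); first exact: normIm_cabs.
  + by move=> x /fi[].
  + by move=> x y xuv Dy; have [] := df x y xuv Dy.
Qed.

(** A bound by a product of integrable functions of one variable gives integrability on the plane by
    Tonelli; every interchange below has such a bound. *)
Lemma cFubini (f : R -> R -> R[i]) (u v : R -> R) :
  cmeasurable setT (fun p : T * T => f p.1 p.2) ->
  rintegrable setT u -> rintegrable setT v ->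
  (forall x y, cabs (f x y) <= u x * v y) ->
  [/\ cintegrable setT (fun x => cintegral setT (f x)),
      cintegrable setT (fun y => cintegral setT (f ^~ y)) &
      cintegral setT (fun x => cintegral setT (f x)) =
      cintegral setT (fun y => cintegral setT (f ^~ y))].
Proof.
move=> [m1 m2] iu iv fuv.
have H (p : R[i] -> R) : (forall z, `|p z| <= cabs z) ->
  measurable_fun setT (fun q : T * T => p (f q.1 q.2)) ->
  [/\ rintegrable setT (fun x => Rintegral mu setT (fun y => p (f x y))),
      rintegrable setT (fun y => Rintegral mu setT (fun x => p (f x y))) &
      Rintegral mu setT (fun x => Rintegral mu setT (fun y => p (f x y))) =
      Rintegral mu setT (fun y => Rintegral mu setT (fun x => p (f x y)))].
  move=> pc mp.
  have fx x : rintegrable setT (fun y => p (f x y)).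
    apply: (@rintegrable_le _ _ _ (fun y => u x * v y)) => //.
    - exact: (measurable_fun_pair2 x mp).
    - by move=> y _; apply: le_trans (pc _) _.
    - exact: rintegrableZ.
  have fy y : rintegrable setT (fun x => p (f x y)).
    apply: (@rintegrable_le _ _ _ (fun x => v y * u x)) => //.
    - exact: (measurable_fun_pair1 y mp).
    - by move=> x _; apply: le_trans (pc _) _; rewrite mulrC.
    - exact: rintegrableZ.
  have mpE : measurable_fun setT (fun q : T * T => (p (f q.1 q.2))%:E).
    exact: ((measurable_EFinP setT (fun q : T * T => p (f q.1 q.2))).2 mp).
  have ip : (mu \x mu)%E.-integrable setT (fun q : T * T => (p (f q.1 q.2))%:E).
    apply/(integrable12ltyP mu mu mpE).
    apply: (@le_lt_trans _ _ (\int[mu]_x ((`|u x| * Rintegral mu setT (fun y => `|v y|))%:E))%E).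
      apply: ge0_le_integral => //.
      - by move=> x _; apply: integral_ge0.
      - apply: (measurable_fun_fubini_tonelli_F (fun q : T * T => `|(p (f q.1 q.2))%:E|)%E) => //.
        by apply: measurableT_comp mpE.
      - apply/measurable_EFinP; apply: measurable_funM => //.
        by apply: measurableT_comp => //; exact: rintegrable_meas iu.
      - move=> x _; rewrite EFinM.
        have iav : rintegrable setT (fun y => `|v y|) by exact: rintegrable_abs.
        rewrite /Rintegral fineK; last exact: integrable_fin_num.
        have miav : measurable_fun setT (fun y : T => (`|v y|)%:E).
          by apply/measurable_EFinP; exact: rintegrable_meas iav.
        rewrite -ge0_integralZl//.
        apply: ge0_le_integral => //.
        + by apply/measurable_EFinP; apply: measurableT_comp => //; exact: rintegrable_meas (fx x).
        + apply/measurable_EFinP; apply: measurable_funM => //.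
          exact: rintegrable_meas iav.
        + move=> y _; rewrite -EFinM lee_fin; apply: le_trans (pc _) _.
          by apply: (le_trans (fuv x y)); rewrite -normrM ler_norm.
    have : rintegrable setT (fun x => Rintegral mu setT (fun y => `|v y|) * `|u x|).
      by apply: rintegrableZ => //; exact: rintegrable_abs.
    move=> /integrableP[_]; congr (_ < _)%E; apply: eq_integral => x _ /=.
    rewrite mulrC ger0_norm// mulr_ge0//.
    by apply: Rintegral_ge0.
  have EF x : (\int[mu]_y (p (f x y))%:E = (Rintegral mu setT (fun y => p (f x y)))%:E)%E.
    by rewrite /Rintegral fineK//; exact: integrable_fin_num (fx x).
  have EG y : (\int[mu]_x (p (f x y))%:E = (Rintegral mu setT (fun x => p (f x y)))%:E)%E.
    by rewrite /Rintegral fineK//; exact: integrable_fin_num (fy y).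
  split.
  - have := integrable_fubini_F ip.
    by apply: eq_integrable => // x _; rewrite /fubini_F /= EF.
  - apply/integrableP; split.
      have := measurable_fubini_G ip.
      by apply: eq_measurable_fun => y _; rewrite /fubini_G /= EG.
    have /(integrable21ltyP mu mu mpE).1 := ip.
    apply: le_lt_trans; apply: ge0_le_integral => //.
    + apply: measurableT_comp => //.
      have := measurable_fubini_G ip.
      by apply: eq_measurable_fun => y _; rewrite /fubini_G /= EG.
    + apply: (measurable_fun_fubini_tonelli_G (fun q : T * T => `|(p (f q.1 q.2))%:E|)%E) => //.
      by apply: measurableT_comp mpE.
    + move=> y _.
      rewrite [X in (X <= _)%E](_ : _ = `|\int[mu]_x (p (f x y))%:E|)%E; last by rewrite EG.
      apply: le_abse_integral => //.
      by apply/measurable_EFinP; exact: rintegrable_meas (fy y).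
  - have := Fubini ip => /=.
    under eq_integral do rewrite EF.
    under [X in _ = X -> _]eq_integral do rewrite EG.
    by rewrite /Rintegral => ->.
have [a1 a2 a3] := H (@cRe R) (@normRe_cabs R) m1.
have [b1 b2 b3] := H (@cIm R) (@normIm_cabs R) m2.
split.
- by split.
- by split.
- apply: complex_ext; [exact: a3 | exact: b3].
Qed.

Lemma cintegrable_shift f (c : R) : cintegrable setT f -> cintegrable setT (fun x => f (x + c)).
Proof.
by move=> [f1 f2]; split; [have [h _] := rintegrable_shift c f1 | have [h _] := rintegrable_shift c f2].
Qed.

Lemma cintegral_shift f (c : R) : cintegrable setT f ->
  cintegral setT (fun x => f (x + c)) = cintegral setT f.
Proof.
move=> [f1 f2]; congr Complex.
- by have [_ h] := rintegrable_shift c f1.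
- by have [_ h] := rintegrable_shift c f2.
Qed.

(** Dominated convergence with majorant [|f|]. It identifies the improper integral of the statement
    with a Lebesgue integral. *)
Lemma cintegral_pinfty f : cintegrable setT f -> (forall x, x < 0 -> f x = 0) ->
  ccvg_pinfty (fun t => cintegral `[0, t] f) (cintegral setT f).
Proof.
move=> [f1 f2] f0.
have H (g : R -> R) : rintegrable setT g -> (forall x, x < 0 -> g x = 0) ->
    Rintegral mu `[0, t] g @[t --> +oo] --> Rintegral mu setT g.
  move=> ig g0; apply/cvg_pinftyP => w /cvgryPge wy.
  have mg := rintegrable_meas ig.
  under eq_cvg do rewrite Rintegral_mkcond.
  apply: (@rintegrable_dominated _ (fun n => g \_ `[0, w n]) g (fun x => `|g x|) setT _ _ _ _ _ _).2 => //.
  - move=> n; apply/(measurable_restrictT _ _).1 => //.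
    exact: measurable_funTS.
  - move=> x _; apply: cvg_near_cst.
    have := wy x; apply: filterS => n xn.
    rewrite patchE; case: ifPn => // /negP h.
    apply/eqP; rewrite eq_sym g0//; rewrite ltNge; apply/negP => x0.
    by apply: h; rewrite inE /= in_itv/= x0.
  - by move=> n x _; rewrite patchE; case: ifPn => // _; rewrite normr0.
  - exact: rintegrable_abs.
split => /=.
- by apply: (H _ f1) => x /f0 /= ->.
- by apply: (H _ f2) => x /f0 /= ->.
Qed.
End ComplexIntegration.

Section RealDerivative.
Context {R : realType}.
Implicit Types (f : R -> R) (x a c : R).

Lemma is_derive_const c x : is_derive x 1 (fun=> c) 0.
Proof. exact: is_derive_cst. Qed.

Lemma is_derive_ident x : is_derive x 1 (fun t => t) 1.
Proof. exact: is_derive_id. Qed.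

Lemma is_derive_scale f c x a : is_derive x 1 f a -> is_derive x 1 (fun t => c * f t) (c * a).
Proof.
move=> fa; refine (is_derive_val (is_derive_mul (is_derive_const c x) fa) _).
by rewrite mul0r add0r.
Qed.

Lemma is_derive_opp f x a : is_derive x 1 f a -> is_derive x 1 (fun t => - f t) (- a).
Proof. by move=> fa; apply: (@is_derive_ext _ (- f)). Qed.

Lemma is_derive_inv f x a : f x != 0 -> is_derive x 1 f a ->
  is_derive x 1 (fun t => (f t)^-1) (- a / f x ^+ 2).
Proof.
move=> fx fa; refine (is_derive_val (is_deriveV fx fa) _).
by rewrite /GRing.scale /= mulNr mulNr mulrC.
Qed.

Lemma is_derive_continuous f x a : is_derive x 1 f a -> {for x, continuous f}.
Proof. by move=> [df _]; apply: differentiable_continuous; exact/derivable1_diffP. Qed.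
End RealDerivative.

(** * Improper integrals through antiderivatives *)

Section ImproperFTC.
Context {R : realType}.
Local Notation mu := (@lebesgue_measure R).
Local Notation T := (measurableTypeR R).

(** Integrability being assumed, dominated convergence over growing intervals equates the integral
    with the limit of [F (b n) - F (a n)]. *)
Lemma Rint_improper_FTC (a b : nat -> R) (f F : R -> R) (l : R) (D : set T) :
  (forall n, a n < b n) ->
  (forall x, D x -> \forall n \near \oo, a n <= x <= b n) ->
  (forall n x, a n <= x <= b n -> D x) ->
  (forall x, D x -> is_derive x 1 F (f x)) ->
  (forall x, D x -> {for x, continuous f}) ->
  (forall x, ~ D x -> f x = 0) ->
  rintegrable setT f ->
  F (b n) - F (a n) @[n --> \oo] --> l ->
  Rintegral mu setT f = l.
Proof.
move=> ab Dn nD dF cf f0 fi Fl.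
have mf := rintegrable_meas fi.
have FTC n : Rintegral mu setT (f \_ `[a n, b n]) = F (b n) - F (a n).
  rewrite -Rintegral_mkcond /Rintegral.
  have inD x : x \in `[a n, b n]%R -> D x by rewrite in_itv/= => /nD.
  have dI x : x \in `[a n, b n]%R -> derivable F x 1.
    by move=> xab; have [] := dF x (inD x xab).
  have lI : a n \in `[a n, b n]%R by rewrite in_itv/= lexx (ltW (ab n)).
  have rI : b n \in `[a n, b n]%R by rewrite in_itv/= lexx (ltW (ab n)).
  rewrite (@continuous_FTC2 _ f F) ?EFinB//.
  - apply: continuous_in_subspaceT => x /set_mem /= xab.
    by apply: cf; exact: inD xab.
  - split.
    + by move=> x xab; apply: dI; exact: subset_itv_oo_cc xab.
    + by apply: cvg_at_right_filter; apply: differentiable_continuous; exact/derivable1_diffP/dI.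
    + by apply: cvg_at_left_filter; apply: differentiable_continuous; exact/derivable1_diffP/dI.
  - move=> x xab; rewrite derive1E.
    by have [_ ->] := dF x (inD x (subset_itv_oo_cc xab)).
have [_ H] : rintegrable setT f /\
   Rintegral mu setT (f \_ `[a n, b n]) @[n --> \oo] --> Rintegral mu setT f.
  apply: (@rintegrable_dominated _ (fun n => f \_ `[a n, b n]) f (fun x => `|f x|) setT) => //.
  - move=> n; apply/(measurable_restrictT _ _).1 => //.
    exact: measurable_funTS.
  - move=> x _; apply: cvg_near_cst.
    have [Dx|nDx] := pselect (D x).
      apply: filterS (Dn x Dx) => n axb; rewrite patchE mem_set//.
    by apply: nearW => n; rewrite patchE; case: ifPn => // _; rewrite f0.
  - by move=> n x _; rewrite patchE; case: ifPn => // _; rewrite normr0.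
  - exact: rintegrable_abs.
have H2 : F (b n) - F (a n) @[n --> \oo] --> Rintegral mu setT f.
  by apply: cvg_trans H; apply: near_eq_cvg; apply: nearW => n; rewrite FTC.
exact: (cvg_unique _ H2 Fl).
Qed.
End ImproperFTC.

(** * Exponential inequalities and an integrable majorant *)

Section ExpBounds.
Context {R : realType}.
Implicit Types (x u c : R).

Lemma expr_le_expR c (m : nat) : 0 < c ->
  exists2 C, 0 < C & forall v : R, 0 <= v -> v ^+ m <= C * expR (c * v).
Proof.
move=> c0; have k0 : (0 : R) < m.+1%:R by rewrite ltr0n.
(* From [t <= e^t] at [t = c v / (m + 1)], raised to the power [m]. The divisor is [m + 1] so that
   [m = 0] causes no division by zero. *)
exists ((m.+1%:R / c) ^+ m); first by rewrite exprn_gt0// divr_gt0.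
move=> v v0; set k := m.+1%:R : R.
have h1 : v <= k / c * expR (c * v / k).
  have h := expR_ge1Dx (c * v / k).
  have : c * v / k <= expR (c * v / k) by apply: le_trans h; rewrite lerDr.
  rewrite ler_pdivrMr// => h2.
  rewrite -(ler_pM2l c0); apply: (le_trans h2).
  by rewrite le_eqVlt; apply/orP; left; apply/eqP; field; rewrite gt_eqF.
apply: (@le_trans _ _ ((k / c * expR (c * v / k)) ^+ m)).
  by rewrite lerXn2r ?nnegrE// mulr_ge0 ?expR_ge0// divr_ge0// ltW.
rewrite exprMn; apply: ler_wpM2l; first by rewrite exprn_ge0// divr_ge0// ltW.
rewrite -expRM_natl ler_expR.
have cv : 0 <= c * v by rewrite mulr_ge0// ltW.
rewrite mulrA ler_pdivrMr// [m%:R * _]mulrC ler_wpM2l// ler_nat.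
exact: leqnSn.
Qed.

(** The tangent line at the mean [c] lies below the graph; averaging it over [al] and [be] cancels
    the linear terms. *)
Lemma expR_convex (lam al be : R) : 0 <= lam <= 1 ->
  expR (lam * al + (1 - lam) * be) <= lam * expR al + (1 - lam) * expR be.
Proof.
move=> /andP[l0 l1]; set c := lam * al + (1 - lam) * be.
have tan t : expR c * (1 + (t - c)) <= expR t.
  have -> : expR t = expR c * expR (t - c) by rewrite -expRD; congr expR; ring.
  by rewrite ler_pM2l ?expR_gt0// expR_ge1Dx.
apply: (@le_trans _ _ (lam * (expR c * (1 + (al - c))) + (1 - lam) * (expR c * (1 + (be - c))))).
  by rewrite le_eqVlt; apply/orP; left; apply/eqP; rewrite /c; ring.
by apply: lerD; apply: ler_wpM2l => //; rewrite subr_ge0.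
Qed.
End ExpBounds.

Section Majorant.
Context {R : realType}.
Local Notation mu := (@lebesgue_measure R).
Local Notation T := (measurableTypeR R).
Implicit Types (x eta : R).

(* [majorant eta] has the bounded antiderivative [-1 / (eta (1 + x^eta))]. *)
Definition majorant (eta x : R) : R :=
  if 0 < x then expR (eta * ln x) / (x * (1 + expR (eta * ln x)) ^+ 2) else 0.

Lemma majorant_ge0 eta x : 0 <= majorant eta x.
Proof.
rewrite /majorant; case: ifPn => // x0; rewrite divr_ge0 ?expR_ge0//.
by rewrite mulr_ge0 ?(ltW x0)// sqr_ge0.
Qed.

Lemma measurable_pos_if (f : R -> R) : measurable_fun setT f ->
  measurable_fun [set: T] (fun x : T => if 0 < x then f x else 0).
Proof.
move=> mf; apply: measurable_fun_ifT => //.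
have : measurable_fun setT (fun x : R => 0 < x) by apply: measurable_fun_ltr.
by [].
Qed.

(** At these endpoints the logarithm is [-(n + 1)] and [n + 1], so boundary terms become explicit
    exponentials. *)
Lemma exp_exhaust (x : R) : 0 < x ->
  \forall n \near \oo, expR (- n.+1%:R) <= x <= expR n.+1%:R.
Proof.
move=> x0; exists (Num.bound `|ln x|) => // n /= hn.
have : `|ln x| <= n.+1%:R.
  have /ltW h := archi_boundP (normr_ge0 (ln x)); apply: (le_trans h).
  by rewrite ler_nat ltnW.
rewrite ler_norml => /andP[h1 h2].
by rewrite -[x in _ <= x <= _](@lnK R) ?posrE// !ler_expR h1 h2.
Qed.

Lemma rintegrable_majorant eta : 0 < eta -> rintegrable setT (majorant eta).
Proof.
move=> e0; have m0 : measurable [set x : T | 0 < x].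
  by have := measurable_itv (`]0, +oo[%R : interval R); congr measurable; apply/seteqP; split => x /=; rewrite in_itv/= andbT.
have H : rintegrable [set x : T | 0 < x] (majorant eta).
  have dln x : 0 < x -> is_derive x 1 (fun t => 1 + expR (eta * ln t)) (eta / x * expR (eta * ln x)).
    move=> x0; refine (is_derive_val (is_derive_add (is_derive_const 1 x) (is_derive_compose (is_derive_expR _) (is_derive_scale eta (is_derive1_ln x0)))) _).
    by ring.
  have pos x : 0 < 1 + expR (eta * ln x) by rewrite ltr_pwDl// expR_ge0.
  apply: (@rintegrable_antiderivative _ (fun n => expR (- n.+1%:R)) (fun n => expR n.+1%:R) _
    (fun x => - (eta^-1 * (1 + expR (eta * ln x))^-1)) (eta^-1)).
  - by move=> n; rewrite ltr_expR; apply: (@lt_trans _ _ 0); rewrite ?oppr_lt0 ltr0n.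
  - by move=> m n mn; rewrite !ler_expR lerN2 !ler_nat !ltnS.
  - apply/seteqP; split => x /=.
      move=> /exp_exhaust[n _ /(_ n (leqnn _))/= h].
      by exists n => //; rewrite /= in_itv.
    by move=> [n _] /=; rewrite in_itv/= => /andP[h _]; apply: lt_le_trans h; exact: expR_gt0.
  - move=> x /= x0; rewrite /majorant x0.
    have d1 := dln x x0.
    have nz : 1 + expR (eta * ln x) != 0 by rewrite gt_eqF.
    refine (is_derive_val (is_derive_opp (is_derive_scale eta^-1 (is_derive_inv (f := fun t => 1 + expR (eta * ln t)) nz d1))) _).
    by field; rewrite nz !gt_eqF.
  - move=> x /= x0.
    have cg : {for x, continuous (fun t => expR (eta * ln t))}.
      apply: continuous_comp; last exact: continuous_expR.
      by apply: continuousM; [exact: cvg_cst | exact: continuous_ln].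
    have : {for x, continuous (fun t => expR (eta * ln t) / (t * (1 + expR (eta * ln t)) ^+ 2))}.
      apply: continuousM => //; apply: continuousV.
        by rewrite mulf_neq0 ?gt_eqF// exprn_gt0.
      apply: continuousM; first exact: cvg_id.
      apply: (@continuous_comp _ _ _ (fun t => 1 + expR (eta * ln t)) (fun v => v ^+ 2)).
        exact: is_derive_continuous (dln x x0).
      exact: exprn_continuous.
    rewrite /prop_for /continuous_at /= {2}/majorant x0 => h.
    apply: cvg_trans h; apply: near_eq_cvg.
    have := lt_nbhsr x0; apply: filterS => t t0.
    by rewrite /majorant t0.
  - by move=> x _; exact: majorant_ge0.
  - move=> x /= x0; rewrite normrN normrM gtr0_norm ?invr_gt0// -[leRHS]mulr1.
    rewrite ler_pM2l ?invr_gt0// gtr0_norm ?invr_gt0//.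
    by rewrite invf_le1// lerDl expR_ge0.
have := (rintegrable_mkcond (majorant eta) m0).1 H.
apply: eq_rintegrable => // x _; rewrite patchE; case: ifPn => // /negP.
by rewrite inE /= => /negP x0; rewrite /majorant (negbTE x0).
Qed.
End Majorant.

(** * The complex logarithm and Laplace transforms of powers *)
Section ComplexLog.
Context {R : realType}.
Implicit Types (f : R -> R[i]) (z s : R[i]) (x : R).

Lemma cRe_inv z : cRe z^-1 = cRe z / (cRe z ^+ 2 + cIm z ^+ 2). Proof. by case: z. Qed.
Lemma cIm_inv z : cIm z^-1 = - (cIm z / (cRe z ^+ 2 + cIm z ^+ 2)). Proof. by case: z. Qed.
Lemma cneq0 z : 0 < cRe z -> z != 0.
Proof. by move=> z0; apply/eqP => zE; rewrite zE ltxx in z0. Qed.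
Lemma sqnorm_gt0 z : 0 < cRe z -> 0 < cRe z ^+ 2 + cIm z ^+ 2.
Proof. by move=> z0; rewrite ltr_pwDl ?sqr_ge0// exprn_gt0. Qed.

(** In the right half-plane [carg] is [atan (im / re)], and by continuity of the real part this
    persists near the point. *)
Lemma cderive_clog f x a : 0 < cRe (f x) -> cderive f x a ->
  cderive (fun t => clog (f t)) x (a / f x).
Proof.
move=> fx0 fa; have [f1 f2] := fa.
set re := fun t => cRe (f t); set im := fun t => cIm (f t).
have re0 : 0 < re x by [].
have q0 : 0 < re x ^+ 2 + im x ^+ 2 by exact: sqnorm_gt0.
have sq0 : 0 < Num.sqrt (re x ^+ 2 + im x ^+ 2) by rewrite sqrtr_gt0.
have sqK : Num.sqrt (re x ^+ 2 + im x ^+ 2) * Num.sqrt (re x ^+ 2 + im x ^+ 2) = re x ^+ 2 + im x ^+ 2.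
  by rewrite -expr2 sqr_sqrtr// ltW.
have dre : is_derive x 1 re (cRe a) by [].
have dim : is_derive x 1 im (cIm a) by [].
have dq : is_derive x 1 (fun t => re t ^+ 2 + im t ^+ 2) (2 * (re x * cRe a + im x * cIm a)).
  refine (is_derive_val (is_derive_add (is_derive_mul dre dre) (is_derive_mul dim dim)) _).
  by ring.
split; rewrite cE cRe_inv cIm_inv -/(re x) -/(im x).
- have := is_derive_compose (f := @ln R) (g := fun t => cabs (f t)) (is_derive1_ln sq0)
    (is_derive_compose (f := Num.sqrt) (g := fun t => re t ^+ 2 + im t ^+ 2) (is_derive1_sqrt q0) dq).
  move=> h; refine (is_derive_val h _).
  rewrite invfM mulrA [2^-1 * _]mulrC !mulrA -invfM sqK.
  by field; rewrite gt_eqF.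
- have dat : is_derive x 1 (fun t => atan (im t / re t))
     ((1 + (im x / re x) ^+ 2)^-1 * (cIm a * (re x)^-1 + im x * (- cRe a / re x ^+ 2))).
    refine (is_derive_compose (f := @atan R) (g := fun t => im t / re t) (is_derive1_atan _) _).
    apply: is_derive_mul => //; apply: is_derive_inv => //.
    by rewrite gt_eqF.
  have near_pos : \forall t \near x, 0 < re t.
    have cre : {for x, continuous re} by exact: is_derive_continuous dre.
    by have h := cvgr_gt (re x) cre; exact: h.
  refine (is_derive_near _ (is_derive_val dat _)).
    by apply: filterS near_pos => t t0; rewrite /= /carg -/(re t) t0.
  by field; rewrite !gt_eqF.
Qed.

(** Zero derivatives give constancy on an open parameter interval, so the segment from 1 to [s] is
    prolonged past both ends. The overshoot is chosen so that the real part stays above half of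
    [min 1 sg]. *)
Lemma segment_pos (sg th : R) : 0 < sg ->
  - (Num.min 1 sg / (2 * (1 + sg))) < th < 1 + Num.min 1 sg / (2 * (1 + sg)) ->
  Num.min 1 sg / 2 <= 1 + th * (sg - 1).
Proof.
move=> sg0; set mu_ := Num.min 1 sg; set d := mu_ / (2 * (1 + sg)) => /andP[h1 h2].
have m1 : mu_ <= 1 by rewrite ge_min lexx.
have m2 : mu_ <= sg by rewrite ge_min lexx orbT.
have m0 : 0 < mu_ by rewrite lt_min ltr01 sg0.
have dE : d * (1 + sg) = mu_ / 2.
  by rewrite /d invfM mulrA mulfVK// gt_eqF// addr_gt0.
have d0 : 0 < d by rewrite divr_gt0// mulr_gt0// addr_gt0.
have k1 : 0 <= (1 - th + d) * (1 - mu_) by rewrite mulr_ge0//; lra.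
have k2 : 0 <= (th + d) * (sg - mu_) by rewrite mulr_ge0//; lra.
have k3 : 0 <= d * mu_ by rewrite mulr_ge0// ltW.
have -> : 1 + th * (sg - 1) = mu_ + (1 - th + d) * (1 - mu_) + (th + d) * (sg - mu_) - d * (1 + sg) + d * mu_ * 2 by ring.
rewrite dE; lra.
Qed.

Lemma clog1 : clog (1 : R[i]) = 0.
Proof.
apply: complex_ext; rewrite /clog /=.
  by rewrite /cabs /= expr1n expr0n /= addr0 sqrtr1 ln1.
by rewrite /carg /= ltr01 mul0r atan0.
Qed.

(** Stands in for analytic continuation: an expression with zero derivative along the segment has at
    [s] the value it has at 1, where the transforms are real integrals. *)
Lemma segment_cst (s : R[i]) (f : R -> R[i]) : 0 < cRe s ->
  (forall th, Num.min 1 (cRe s) / 2 <= cRe (1 + cr th * (s - 1)) ->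
     - (Num.min 1 (cRe s) / (2 * (1 + cRe s))) < th < 1 + Num.min 1 (cRe s) / (2 * (1 + cRe s)) ->
     cderive f th 0) -> f 0 = f 1.
Proof.
move=> s0 h; set d := Num.min 1 (cRe s) / (2 * (1 + cRe s)).
have d0 : 0 < d by rewrite divr_gt0// ?lt_min ?ltr01// mulr_gt0// addr_gt0.
apply: (@cderive0_cst _ f (- d) (1 + d)).
- move=> th hth; apply: h => //.
  have := segment_pos s0 hth; rewrite !cE /=; congr (_ <= _); ring.
- by rewrite oppr_lt0 d0 addr_gt0.
- by rewrite ltrDl d0 (lt_trans _ ltr01)// oppr_lt0.
Qed.

Lemma cderive_segment s th : cderive (fun t => 1 + cr t * (s - 1)) th (s - 1).
Proof.
apply: cderive_eq.
  apply: cderiveD; first exact: cderive_cst.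
  apply: cderiveM; last exact: cderive_cst.
  apply: cderive_cr; exact: is_derive_ident.
by rewrite cr1 mul1r mulr0 addr0 add0r.
Qed.

Lemma min_half_gt0 (sg : R) : 0 < sg -> 0 < Num.min 1 sg / 2.
Proof. by move=> s0; rewrite divr_gt0// lt_min ltr01. Qed.

(** The product of [cexp (- clog z)] and [z] has zero derivative along the segment and equals 1 at
    [z = 1]. *)
Lemma cexp_clog s : 0 < cRe s -> cexp (clog s) = s.
Proof.
move=> s0; pose z t := 1 + cr t * (s - 1).
have z1 : z 1 = s by rewrite /z cr1 mul1r addrC subrK.
have z0 : z 0 = 1 by rewrite /z cr0 mul0r addr0.
have : (fun t => cexp (- clog (z t)) * z t) 0 = (fun t => cexp (- clog (z t)) * z t) 1.
  apply: (@segment_cst s (fun t => cexp (- clog (z t)) * z t) s0) => th hth _.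
  have zp : 0 < cRe (z th) by apply: lt_le_trans hth; exact: min_half_gt0.
  have dz := cderive_segment s th.
  have dl := cderive_clog zp dz.
  apply: cderive_eq.
    apply: cderiveM; last exact: dz.
    apply: cderive_cexp.
    have := cderiveZ (-1) dl.
    rewrite (_ : (fun t => -1 * clog (1 + cr t * (s - 1))) = (fun t => - clog (z t))).
      by move=> h; exact: h.
    by apply/funext => t; rewrite mulN1r.
  rewrite -/(z th); have zn := cneq0 zp.
  by field.
rewrite /= z0 z1 clog1 oppr0 cexp0 mul1r => h.
by rewrite -[LHS]mulr1 h mulrA -cexpD subrr cexp0 mul1r.
Qed.
End ComplexLog.

Section ComplexImproperFTC.
Context {R : realType}.
Local Notation mu := (@lebesgue_measure R).
Local Notation T := (measurableTypeR R).

Lemma squeeze0 (w v : nat -> R) : (forall n, 0 <= w n) -> (forall n, w n <= v n) ->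
  v n @[n --> \oo] --> (0 : R) -> w n @[n --> \oo] --> (0 : R).
Proof.
move=> w0 wv v0; apply: (@squeeze_cvgr _ _ _ _ (fun=> 0) v) => //.
- by apply: nearW => n; rewrite w0 wv.
- exact: cvg_cst.
Qed.

Lemma cintegral_improper_FTC0 (a b : nat -> R) (g G : R -> R[i]) (D : set T) :
  (forall n, a n < b n) ->
  (forall x, D x -> \forall n \near \oo, a n <= x <= b n) ->
  (forall n x, a n <= x <= b n -> D x) ->
  (forall x, D x -> cderive G x (g x)) ->
  (forall x, D x -> exists l, cderive g x l) ->
  (forall x, ~ D x -> g x = 0) ->
  cintegrable setT g ->
  cabs (G (a n)) @[n --> \oo] --> (0 : R) ->
  cabs (G (b n)) @[n --> \oo] --> (0 : R) ->
  cintegral setT g = 0.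
Proof.
move=> ab Dn nD dG cg g0 ig Ga Gb.
have key (p : R[i] -> R) : (forall z, `|p z| <= cabs z) -> {morph p : z w / z - w} ->
    (forall f x l, cderive f x l -> is_derive x 1 (fun t => p (f t)) (p l)) ->
    rintegrable setT (fun x => p (g x)) -> p 0 = 0 ->
    Rintegral mu setT (fun x => p (g x)) = 0.
  move=> pc pB pd pi p00.
  apply: (@Rint_improper_FTC _ a b (fun x => p (g x)) (fun x => p (G x)) 0 D) => //.
  - by move=> x Dx; apply: pd; exact: dG.
  - by move=> x Dx; have [l gl] := cg x Dx; exact: is_derive_continuous (pd _ _ _ gl).
  - by move=> x nDx; rewrite g0.
  - apply/norm_cvg0P; apply: (@squeeze0 _ (fun n => cabs (G (b n)) + cabs (G (a n)))) => //.
      by move=> n; rewrite -pB; apply: (le_trans (pc _)); apply: (le_trans (cabsD _ _)); rewrite cabsN.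
    by rewrite -[X in _ --> X](addr0 0); apply: cvgD.
apply: complex_ext => /=.
- apply: (key (@cRe R)) => //; first exact: normRe_cabs.
  + by move=> z w; rewrite cReB.
  + by move=> f x l [].
  + by have [] := ig.
- apply: (key (@cIm R)) => //; first exact: normIm_cabs.
  + by move=> z w; rewrite cImB.
  + by move=> f x l [].
  + by have [] := ig.
Qed.
End ComplexImproperFTC.

(** * Laplace transforms of x^(y-1) log^m x *)

Section PowerLaplace.
Context {R : realType}.
Local Notation mu := (@lebesgue_measure R).
Local Notation T := (measurableTypeR R).
Implicit Types (x y sg : R) (s : R[i]) (m : nat).

(** Mellin normalisation [x^(y-1) log^m x]: differentiating in [y] raises [m] by one, multiplying by
    [x] raises [y] by one. *)
Definition powlog y m x : R := if 0 < x then expR ((y - 1) * ln x) * ln x ^+ m else 0.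

Definition plaplace y m s := cintegral setT (fun x => cr (powlog y m x) * cexp (- s * cr x)).

(** One majorant for all [y] in [[eps, A]] and all [sg' >= sg], as differentiation under the
    integral in [y] and in [s] requires. [majorant (eps / 2)] behaves like [x^(eps/2 - 1)] at 0 and
    like [x^(-eps/2 - 1)] at infinity. *)
Lemma powlog_bound (eps A sg : R) m : 0 < eps -> 0 < sg ->
  exists2 C, 0 <= C & forall y x sg', eps <= y <= A -> sg <= sg' ->
    `|powlog y m x| * expR (- sg' * x) <= C * majorant (eps / 2) x.
Proof.
move=> e0 sg0; set eta := eps / 2; have eta0 : 0 < eta by rewrite divr_gt0.
have epsE : eps = eta + eta by rewrite /eta; field.
have [C1 C10 H1] := expr_le_expR m eta0.
pose N := Num.bound `|A + 2 * eta|.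
have [C2 C20 H2] := expr_le_expR N sg0.
exists (4 * C1 * (1 + C2)).
  by rewrite !mulr_ge0// ?addr_ge0 ?ltW.
move=> y x sg' /andP[ey yA] sgs; rewrite /powlog /majorant.
case: ifPn => x0; last by rewrite normr0 mul0r mulr0.
set u := ln x; have xE : x = expR u by rewrite lnK.
set w := expR (eta * u); have w0 : 0 < w by exact: expR_gt0.
rewrite normrM ger0_norm ?expR_ge0// normrX mulrA.
rewrite ler_pdivlMr; last by rewrite mulr_gt0// exprn_gt0// addr_gt0.
have -> : expR ((y - 1) * u) * `|u| ^+ m * expR (- sg' * x) * (x * (1 + w) ^+ 2) =
   expR (y * u) * `|u| ^+ m * expR (- sg' * x) * (1 + w) ^+ 2.
  have -> : expR (y * u) = expR ((y - 1) * u) * x by rewrite [X in _ = _ * X]xE -expRD; congr expR; ring.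
  ring.
have E0 : 0 <= expR (- sg' * x) by exact: expR_ge0.
have E1 : expR (- sg' * x) <= 1.
  by rewrite -expR0 ler_expR mulNr oppr_le0 mulr_ge0 ?ltW// (lt_le_trans sg0).
have M0 : 0 <= `|u| ^+ m by rewrite exprn_ge0.
(* For [x >= 1] the logarithm costs a factor [w = x^eta], and the powers of [x] are absorbed by the
   exponential. For [x < 1] one has [x^y <= w^2], and one factor [w] pays for the logarithm. *)
have [u0|u0] := leP 0 u.
- have w1 : 1 <= w by rewrite -expR0 ler_expR mulr_ge0// ltW.
  have M1 : `|u| ^+ m <= C1 * w by rewrite ger0_norm// H1.
  have h3 : expR (y * u) * w * w * expR (- sg' * x) <= C2.
    have h4 : expR (y * u) * w * w <= x ^+ N.
      rewrite xE -expRM_natl -!expRD ler_expR.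
      rewrite (_ : y * u + eta * u + eta * u = (y + 2 * eta) * u); last by ring.
      rewrite ler_wpM2r//.
      have : A + 2 * eta <= N%:R.
        by apply: (le_trans (ler_norm _)); exact/ltW/archi_boundP/normr_ge0.
      by apply: le_trans; rewrite lerD2r.
    have h5 := H2 x (ltW x0).
    have h6 : expR (sg * x) * expR (- sg' * x) <= 1.
      rewrite -expRD -expR0 ler_expR -mulrDl; apply: mulr_le0_ge0; [lra|exact: ltW].
    apply: (@le_trans _ _ (C2 * expR (sg * x) * expR (- sg' * x))).
      by rewrite ler_wpM2r// (le_trans h4).
    by rewrite -mulrA -[leRHS]mulr1 ler_wpM2l// ltW.
  have W : (1 + w) ^+ 2 <= 4 * (w * w) by rewrite -expr2; nra.
  apply: (@le_trans _ _ (expR (y * u) * (C1 * w) * expR (- sg' * x) * (4 * (w * w)))).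
    apply: ler_pM => //; rewrite ?sqr_ge0 ?mulr_ge0 ?expR_ge0//.
    by rewrite ler_wpM2r// ler_wpM2l ?expR_ge0.
  rewrite (_ : _ * (4 * (w * w)) = 4 * C1 * w * (expR (y * u) * w * w * expR (- sg' * x))); last by ring.
  rewrite (_ : 4 * C1 * (1 + C2) * w = 4 * C1 * w * (1 + C2)); last by ring.
  apply: ler_wpM2l; first by apply: mulr_ge0; [apply: mulr_ge0 => //; exact: ltW | exact: ltW].
  by apply: (le_trans h3); rewrite lerDr.
- have w1 : w <= 1 by rewrite -expR0 ler_expR mulr_ge0_le0// ltW.
  have M1 : `|u| ^+ m * w <= C1.
    rewrite ltr0_norm//; have := H1 (- u); rewrite oppr_ge0 (ltW u0) => /(_ isT) h.
    apply: (@le_trans _ _ (C1 * expR (eta * - u) * w)); first by rewrite ler_wpM2r// ltW.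
    by rewrite -mulrA -expRD mulrN addNr expR0 mulr1.
  have h3 : expR (y * u) <= w * w.
    rewrite -expRD ler_expR -mulrDl -epsE ler_wnM2r//; exact: ltW.
  have W : (1 + w) ^+ 2 <= 4 by nra.
  apply: (@le_trans _ _ (w * w * `|u| ^+ m * 1 * 4)).
    apply: ler_pM => //; rewrite ?sqr_ge0 ?mulr_ge0 ?expR_ge0//.
    apply: ler_pM => //; rewrite ?mulr_ge0 ?expR_ge0//.
    by rewrite ler_wpM2r.
  rewrite (_ : _ * 1 * 4 = 4 * w * (`|u| ^+ m * w)); last by ring.
  rewrite (_ : 4 * C1 * (1 + C2) * w = 4 * w * (C1 * (1 + C2))); last by ring.
  apply: ler_wpM2l; first by apply: mulr_ge0 => //; exact: ltW.
  by apply: (le_trans M1); rewrite mulrDr mulr1 lerDl; apply: mulr_ge0; exact: ltW.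
Qed.

Lemma measurable_powlog y m : measurable_fun [set: T] (powlog y m : T -> R).
Proof.
have h : measurable_fun [set: R] (fun x => expR ((y - 1) * ln x) * ln x ^+ m).
  apply: measurable_funM.
    apply: (measurableT_comp (@measurable_expR R)).
    by apply: measurable_funM => //; exact: measurable_ln.
  by apply: measurable_funX; exact: measurable_ln.
exact: (measurable_pos_if h).
Qed.

Lemma measurable_ident : measurable_fun [set: T] (fun x : T => x : R).
Proof. by have : measurable_fun [set: R] (@idfun R) by exact: measurable_id. Qed.

Lemma cmeasurable_cexp_lin s : cmeasurable [set: T] (fun x : T => cexp (- s * cr x)).
Proof.
apply: cmeasurable_cexp; apply: cmeasurableM; first exact: cmeasurable_cst.
by apply: cmeasurable_cr; exact: measurable_ident.
Qed.

Lemma cabs_laplace_kernel s x : cabs (cexp (- s * cr x)) = expR (- cRe s * x).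
Proof. by rewrite cabs_cexp !cE; congr expR; ring. Qed.

Lemma cintegrable_powlog y m s : 0 < y -> 0 < cRe s ->
  cintegrable setT (fun x => cr (powlog y m x) * cexp (- s * cr x)).
Proof.
move=> y0 s0; have [C C0 H] := powlog_bound y m y0 s0.
apply: (@cintegrable_le _ _ _ (fun x => C * majorant (y / 2) x)) => //.
- apply: cmeasurableM; last exact: cmeasurable_cexp_lin.
  by apply: cmeasurable_cr; exact: measurable_powlog.
- move=> x _; rewrite cabsM cabs_cr cabs_laplace_kernel.
  by apply: H; rewrite ?lexx.
- by apply: rintegrableZ => //; apply: rintegrable_majorant; rewrite divr_gt0.
Qed.

Lemma is_derive_powlog y m x : is_derive y 1 (fun t => powlog t m x) (powlog y m.+1 x).
Proof.
rewrite /powlog; case: ifPn => x0; last exact: is_derive_const.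
refine (is_derive_val (is_derive_mul (is_derive_compose (f := @expR R) (g := fun t => (t - 1) * ln x)
  (is_derive_expR _) (is_derive_mul (is_derive_sub (is_derive_ident y) (is_derive_const 1 y)) (is_derive_const _ _))) (is_derive_const _ _)) _).
by rewrite exprS; ring.
Qed.

Lemma cderive_plaplace y m s : 0 < y -> 0 < cRe s ->
  cderive (fun t => plaplace t m s) y (plaplace y m.+1 s).
Proof.
move=> y0 s0; have e0 : 0 < y / 2 by rewrite divr_gt0.
(* The parameter ranges over [(y/2, y + 1)], away from 0, so that one majorant serves the whole
   neighbourhood. *)
have [C C0 H] := powlog_bound (y + 1) m.+1 e0 s0.
apply: (@cderive_under_integral _ setT
  (fun t x => cr (powlog t m x) * cexp (- s * cr x))
  (fun t x => cr (powlog t m.+1 x) * cexp (- s * cr x)) y (y / 2) (y + 1)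
  (fun x => C * majorant (y / 2 / 2) x)) => //.
- by lra.
- by move=> t /andP[ht _]; apply: cintegrable_powlog => //; exact: lt_trans ht.
- move=> t x _ _; apply: cderive_eq.
    apply: cderiveM; last exact: cderive_cst.
    by apply: cderive_cr; exact: is_derive_powlog.
  by rewrite mulr0 addr0.
- move=> t x /andP[t1 t2] _; rewrite cabsM cabs_cr cabs_laplace_kernel.
  by apply: H; rewrite ?lexx// !ltW.
- by move=> x; rewrite mulr_ge0// majorant_ge0.
- by apply: rintegrableZ => //; apply: rintegrable_majorant; rewrite divr_gt0.
Qed.

Lemma powlogS y x : powlog (y + 1) 0 x = x * powlog y 0 x.
Proof.
rewrite /powlog; case: ifPn => x0; last by rewrite mulr0.
rewrite !expr0 !mulr1 -{2}(@lnK R x)// -expRD; congr expR; ring.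
Qed.

(** Moving along the segment multiplies the kernel by [-x (s - 1)]; the factor [x] is absorbed by
    passing from [y] to [y + 1]. *)
Lemma cderive_plaplace_segment y s th : 0 < y -> 0 < cRe s ->
  Num.min 1 (cRe s) / 2 <= cRe (1 + cr th * (s - 1)) ->
  - (Num.min 1 (cRe s) / (2 * (1 + cRe s))) < th < 1 + Num.min 1 (cRe s) / (2 * (1 + cRe s)) ->
  cderive (fun t => plaplace y 0 (1 + cr t * (s - 1))) th
    (- (s - 1) * plaplace (y + 1) 0 (1 + cr th * (s - 1))).
Proof.
move=> y0 s0 hth th_in; set sg := Num.min 1 (cRe s) / 2.
have sg0 : 0 < sg by exact: min_half_gt0.
have y10 : 0 < y + 1 by rewrite addr_gt0.
have [C C0 H] := powlog_bound (y + 1) 0 y10 sg0.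
set d := Num.min 1 (cRe s) / (2 * (1 + cRe s)).
have seg t : - d < t < 1 + d -> sg <= cRe (1 + cr t * (s - 1)).
  by move=> ht; have := segment_pos s0 ht; rewrite !cE /=; congr (_ <= _); ring.
rewrite -cintegralZ//; last first.
  by apply: cintegrable_powlog => //; exact: lt_le_trans hth.
apply: (@cderive_under_integral _ setT
  (fun t x => cr (powlog y 0 x) * cexp (- (1 + cr t * (s - 1)) * cr x))
  (fun t x => - (s - 1) * (cr (powlog (y + 1) 0 x) * cexp (- (1 + cr t * (s - 1)) * cr x)))
  th (- d) (1 + d)
  (fun x => cabs (s - 1) * (C * majorant ((y + 1) / 2) x))) => //.
- move=> t ht; apply: cintegrable_powlog => //.
  by apply: lt_le_trans (seg t ht).
- move=> t x ht _; apply: cderive_eq.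
    apply: cderiveM; first exact: cderive_cst.
    apply: cderive_cexp.
    have := cderiveZ (- cr x) (cderive_segment s t).
    rewrite (_ : (fun t => - cr x * (1 + cr t * (s - 1))) = (fun t => - (1 + cr t * (s - 1)) * cr x)).
      by move=> h; exact: h.
    by apply/funext => v; ring.
  by rewrite powlogS crM; ring.
- move=> t x ht _; rewrite cabsM cabsN ler_wpM2l ?cabs_ge0//.
  rewrite cabsM cabs_cr cabs_laplace_kernel; apply: H; rewrite ?lexx//.
  exact: seg.
- by move=> x; rewrite !mulr_ge0// ?cabs_ge0 ?majorant_ge0.
- by do 2 apply: rintegrableZ => //; apply: rintegrable_majorant; rewrite divr_gt0.
Qed.

(** Integration by parts, in the form that the derivative of [G x = x^y e^(-s x)] has integral zero.
    For [s = 1] it is the functional equation of Gamma. *)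
Lemma plaplace_ibp y s : 0 < y -> 0 < cRe s ->
  cr y * plaplace y 0 s = s * plaplace (y + 1) 0 s.
Proof.
move=> y0 s0; have y10 : 0 < y + 1 by rewrite addr_gt0.
have i1 := cintegrable_powlog 0 y0 s0.
have i2 := cintegrable_powlog 0 y10 s0.
pose g x := cr y * (cr (powlog y 0 x) * cexp (- s * cr x)) -
  s * (cr (powlog (y + 1) 0 x) * cexp (- s * cr x)).
pose G x := cexp (cr (y * ln x) - s * cr x).
have ig : cintegrable setT g.
  by apply: cintegrableB => //; exact: cintegrableZ.
have lG x : 0 < x -> cderive (fun x => cr (y * ln x) - s * cr x) x (cr (y / x) - s).
  move=> x0; have := cderiveD (cderive_cr (is_derive_scale y (is_derive1_ln x0)))
    (cderiveZ (- s) (cderive_cr (is_derive_ident x))).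
  rewrite cr1 mulr1; congr cderive; apply/funext => t; ring.
have dG x : 0 < x -> cderive G x ((cr (y / x) - s) * G x).
  by move=> x0; apply: cderive_cexp; exact: lG.
have gE x : 0 < x -> g x = (cr (y / x) - s) * G x.
  move=> x0; rewrite /g /G powlogS crM cexpD -[cr (y * ln x)]/(_ : R[i]) cexp_cr.
  have -> : powlog y 0 x = expR (y * ln x) / x.
    rewrite /powlog x0 expr0 mulr1 -{3}(@lnK R x)// -expRN -expRD; congr expR; ring.
  rewrite mulNr; set E := cexp _; rewrite !crM.
  have xn : cr x * cr x^-1 = 1 :> R[i] by rewrite -crM divff// gt_eqF.
  rewrite (_ : cr x * (cr (expR (y * ln x)) * cr x^-1) = cr (expR (y * ln x)) * (cr x * cr x^-1)); last by ring.
  by rewrite xn; ring.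
have cg x : 0 < x -> exists l, cderive g x l.
  move=> x0; eexists.
  apply: (@cderive_near _ (fun t => (cr (y * t^-1) - s) * G t)).
    by apply: filterS (lt_nbhsr x0) => t t0; rewrite gE.
  apply: cderiveM; last exact: dG.
  apply: cderiveD; last exact: cderive_cst.
  apply: cderive_cr; apply: is_derive_scale.
  by apply: (is_derive_inv (f := fun t => t)) (is_derive_ident x); rewrite gt_eqF.
(* Since [N >= y + 1], [x^y] is at most [x^N / x] at [x = e^(n+1)]; the spare factor [1 / x] makes
   the upper boundary term vanish in the limit. *)
pose N := Num.bound `|y + 1|.
have [C2 C20 H2] := expr_le_expR N s0.
have Gabs x : cabs (G x) = expR (y * ln x) * expR (- cRe s * x).
  by rewrite /G cabs_cexp !cE -expRD; congr expR; ring.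
have G1 n : cabs (G (expR (- n.+1%:R))) <= expR (- (y * n.+1%:R)).
  rewrite Gabs expRK mulrN -[leRHS]mulr1 ler_wpM2l ?expR_ge0//.
  by rewrite -expR0 ler_expR mulNr oppr_le0 mulr_ge0 ?expR_ge0// ltW.
have G2 n : cabs (G (expR n.+1%:R)) <= C2 * expR (- n.+1%:R).
  rewrite Gabs expRK; have := H2 (expR n.+1%:R) (expR_ge0 _).
  rewrite -expRM_natl => h.
  have h1 : expR (y * n.+1%:R) <= expR (N%:R * n.+1%:R) * expR (- n.+1%:R).
    rewrite -expRD ler_expR -[X in _ <= _ - X]mul1r -mulrBl ler_wpM2r//.
    rewrite lerBrDr.
    by apply: (le_trans (ler_norm _)); exact/ltW/archi_boundP/normr_ge0.
  apply: (@le_trans _ _ (C2 * expR (cRe s * expR n.+1%:R) * expR (- n.+1%:R) * expR (- cRe s * expR n.+1%:R))).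
    rewrite ler_wpM2r ?expR_ge0//; apply: (le_trans h1).
    by rewrite ler_wpM2r ?expR_ge0.
  rewrite (_ : _ * _ * _ * _ = C2 * expR (- n.+1%:R) * (expR (cRe s * expR n.+1%:R) * expR (- cRe s * expR n.+1%:R))); last by ring.
  by rewrite -expRD mulNr subrr expR0 mulr1.
have en : expR (- n.+1%:R) @[n --> \oo] --> (0 : R).
  by have := @cvgn_expR R; rewrite -(cvg_shiftS (fun n => expR (- n%:R))).
have eyn : expR (- (y * n.+1%:R)) @[n --> \oo] --> (0 : R).
  have : (expR (- y)) ^+ n @[n --> \oo] --> (0 : R).
    apply: cvg_expr; rewrite ger0_norm ?expR_ge0// -expR0 ltr_expR; lra.
  rewrite -(cvg_shiftS (fun n => expR (- y) ^+ n)); apply: cvg_trans.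
  apply: near_eq_cvg; apply: nearW => n; rewrite /= -expRM_natl; congr expR; ring.
have : cintegral setT g = 0.
  apply: (@cintegral_improper_FTC0 _ (fun n => expR (- n.+1%:R)) (fun n => expR n.+1%:R) g G [set x | 0 < x]) => //.
  - by move=> n; rewrite ltr_expR; apply: (@lt_trans _ _ 0); rewrite ?oppr_lt0 ltr0n.
  - by move=> x x0; exact: exp_exhaust.
  - by move=> n x /andP[h _] /=; apply: lt_le_trans h; exact: expR_gt0.
  - by move=> x x0; rewrite gE//; exact: dG.
  - move=> x /= /negP; rewrite -leNgt => x0.
    by rewrite /g /powlog ltNge x0 /= cr0 !mul0r !mulr0 subr0.
  - by apply: (squeeze0 _ G1 eyn) => n; exact: cabs_ge0.
  - apply: (squeeze0 _ G2) => [n|]; first exact: cabs_ge0.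
    by rewrite -[X in _ --> X](mulr0 C2); apply: cvgM => //; exact: cvg_cst.
rewrite /g (cintegralB measurableT (cintegrableZ (cr y) measurableT i1) (cintegrableZ s measurableT i2)).
rewrite (cintegralZ (cr y) measurableT i1) (cintegralZ s measurableT i2) => /eqP.
by rewrite subr_eq0 => /eqP.
Qed.

Lemma cexp_neg_real x : cexp (- 1 * cr x) = cr (expR (- x)) :> R[i].
Proof. by rewrite mulN1r -crN cexp_cr. Qed.

Lemma plaplace1 y m : plaplace y m 1 =
  cr (Rintegral mu setT (fun x => powlog y m x * expR (- x))).
Proof.
apply: complex_ext; rewrite /plaplace cE.
- by apply: eq_Rint => x _; rewrite /comp cexp_neg_real cE mul0r subr0.
- transitivity (cIm (cintegral setT (fun _ : R => 0 : R[i]))); last by rewrite cintegral0.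
  by apply: eq_Rint => x _; rewrite /comp cexp_neg_real cE mulr0 mul0r addr0.
Qed.

End PowerLaplace.

(** * The Gamma function and Gauss' limit formula *)
Section GammaFunction.
Context {R : realType}.
Local Notation mu := (@lebesgue_measure R).
Local Notation T := (measurableTypeR R).
Implicit Types (x y : R) (s : R[i]) (m n : nat).

(** The [m]-th derivative of Gamma through Euler's integral, [m] counting the logarithms under the
    integral. *)
Definition gammad m y : R := Rintegral mu setT (fun x => powlog y m x * expR (- x)).

Lemma rintegrable_gamma y m : 0 < y -> rintegrable setT (fun x => powlog y m x * expR (- x)).
Proof.
move=> y0; have [h _] := @cintegrable_powlog R y m 1 y0 ltr01.
by apply: eq_rintegrable h => // x _; rewrite /comp cexp_neg_real cE mul0r subr0.
Qed.

Lemma is_derive_gammad m y : 0 < y -> is_derive y 1 (gammad m) (gammad m.+1 y).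
Proof.
move=> y0; have [h _] := @cderive_plaplace R y m 1 y0 ltr01.
rewrite plaplace1 cRe_cr in h.
by apply: is_derive_ext h => t; rewrite plaplace1 cRe_cr.
Qed.

Lemma gammaS y : 0 < y -> gammad 0 (y + 1) = y * gammad 0 y.
Proof.
move=> y0; have := @plaplace_ibp R y 1 y0 ltr01.
by rewrite !plaplace1 mul1r -crM => -[].
Qed.

Lemma gamma1 : gammad 0 1 = 1.
Proof.
have en : expR (- n.+1%:R) @[n --> \oo] --> (0 : R).
  by have := @cvgn_expR R; rewrite -(cvg_shiftS (fun n => expR (- n%:R))).
apply: (@Rint_improper_FTC _ (fun n => expR (- n.+1%:R)) (fun n => expR n.+1%:R)
     (fun x => powlog 1 0 x * expR (- x)) (fun x => - expR (- x)) 1 [set x | 0 < x]) => //.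
- by move=> n; rewrite ltr_expR; apply: (@lt_trans _ _ 0); rewrite ?oppr_lt0 ltr0n.
- by move=> x x0; exact: exp_exhaust.
- by move=> n x /andP[h _] /=; apply: lt_le_trans h; exact: expR_gt0.
- move=> x /= x0; rewrite /powlog x0 subrr mul0r expR0 expr0 !mul1r.
  refine (is_derive_val (is_derive_opp (is_derive_compose (f := @expR R) (g := fun t => - t) (is_derive_expR _) (is_derive_opp (is_derive_ident x)))) _).
  by rewrite mulrN1 opprK.
- move=> x /= x0.
  have c : {for x, continuous (fun t => expR (- t))}.
    exact: is_derive_continuous (is_derive_compose (f := @expR R) (g := fun t => - t) (is_derive_expR _) (is_derive_opp (is_derive_ident x))).
  rewrite /prop_for /continuous_at /= {2}/powlog x0 subrr mul0r expR0 expr0 !mul1r.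
  apply: cvg_trans c; apply: near_eq_cvg.
  apply: filterS (lt_nbhsr x0) => t t0.
  by rewrite /powlog t0 subrr mul0r expR0 expr0 !mul1r.
- by move=> x /= /negP x0; rewrite /powlog (negbTE x0) mul0r.
- exact: rintegrable_gamma.
- have h1 : expR (- expR (- n.+1%:R)) @[n --> \oo] --> (1 : R).
    have := continuous_cvg _ (@continuous_expR R (- 0)) (cvgN en).
    rewrite oppr0 expR0 => h; exact: h.
  have h2 : expR (- expR n.+1%:R) @[n --> \oo] --> (0 : R).
    apply: (@squeeze_cvgr _ _ _ _ (fun=> 0) (fun n => expR (- n.+1%:R))) => //.
      apply: nearW => n; rewrite expR_ge0 ler_expR lerN2.
      by have := expR_ge1Dx (n.+1%:R : R); lra.
    exact: cvg_cst.
  rewrite -[X in _ --> X](subr0 1); apply: cvg_trans (cvgB h1 h2).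
  by apply: near_eq_cvg; apply: nearW => n /=; rewrite opprK addrC.
Qed.

Lemma gamma_fact n : gammad 0 n.+1%:R = n`!%:R.
Proof.
elim: n => [|n IH]; first by rewrite gamma1.
by rewrite -[n.+2%:R]natr1 gammaS ?ltr0n// IH -natrM factS.
Qed.

(** By [plaplace_ibp] the product of the transform with [s^y] has zero derivative along the segment;
    at 1 it is Gamma(y). *)
Lemma plaplace_gamma y s : 0 < y -> 0 < cRe s ->
  plaplace y 0 s = cr (gammad 0 y) * cexp (- (cr y * clog s)).
Proof.
move=> y0 s0; pose z t := 1 + cr t * (s - 1).
have z1 : z 1 = s by rewrite /z cr1 mul1r addrC subrK.
have z0 : z 0 = 1 by rewrite /z cr0 mul0r addr0.
pose f t := plaplace y 0 (z t) * cexp (cr y * clog (z t)).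
have : f 0 = f 1.
  apply: (@segment_cst R s f s0) => th hth th_in.
  have zp : 0 < cRe (z th) by apply: lt_le_trans hth; exact: min_half_gt0.
  have dz := cderive_segment s th.
  have dl := cderive_clog zp dz.
  apply: cderive_eq.
    apply: cderiveM; first exact: (cderive_plaplace_segment y0 s0 hth th_in).
    apply: cderive_cexp; apply: cderiveZ; exact: dl.
  rewrite -/(z th); have zn := cneq0 zp.
  have ibp := plaplace_ibp y0 zp.
  have -> : plaplace (y + 1) 0 (z th) = cr y * plaplace y 0 (z th) / z th.
    by rewrite ibp mulrC mulKf.
  by field.
rewrite /f z0 z1 clog1 mulr0 cexp0 mulr1 plaplace1 => h.
by rewrite h -mulrA -cexpD subrr cexp0 mulr1.
Qed.

(* Both bounds are pointwise weighted AM-GM inequalities for [u = x / t]: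
   [z u <= u^z + z - 1] and [u^z <= (2 - z) u + (z - 1) u^2]. *)
Lemma gamma_ratio_bounds (w z t v : R) : 0 < w -> 1 <= z <= 2 -> 0 < t ->
  v * expR (z * ln t) = gammad 0 (w + z) ->
  gammad 0 w + z * (gammad 0 (w + 1) / t - gammad 0 w) <= v
  <= (2 - z) * (gammad 0 (w + 1) / t) + (z - 1) * (gammad 0 (w + 1 + 1) / t ^+ 2).
Proof.
move=> w0 /andP[z1 z2] t0 vE.
have -> : v = gammad 0 (w + z) / expR (z * ln t) by rewrite -vE mulfK// gt_eqF// expR_gt0.
have i0 := rintegrable_gamma 0 w0.
have w10 : 0 < w + 1 by rewrite addr_gt0.
have w20 : 0 < w + 1 + 1 by rewrite addr_gt0.
have i1 := rintegrable_gamma 0 w10.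
have i2 := rintegrable_gamma 0 w20.
have wz0 : 0 < w + z by rewrite addr_gt0// (lt_le_trans ltr01).
have iz := rintegrable_gamma 0 wz0.
set c := (expR (z * ln t))^-1.
have c0 : 0 < c by rewrite invr_gt0 expR_gt0.
have pE x : 0 < x -> [/\ powlog (w + 1) 0 x / t = powlog w 0 x * (x / t),
    powlog (w + 1 + 1) 0 x / t ^+ 2 = powlog w 0 x * (x / t) ^+ 2 &
    powlog (w + z) 0 x * c = powlog w 0 x * expR (z * ln (x / t))].
  move=> x0; rewrite !powlogS; split.
  - by rewrite mulrAC mulrC.
  - by rewrite expr_div_n; ring.
  - rewrite /c -expRN /powlog x0 !expr0 !mulr1 -!expRD; congr expR.
    by rewrite ln_div ?posrE//; ring.
(* Convexity with weight [1 / z] between [z ln u] and 0; the upper bound [ub] uses weight [2 - z]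
   between [ln u] and [2 ln u]. *)
have lb u : 0 < u -> 1 + z * (u - 1) <= expR (z * ln u).
  move=> u0; have zp : 0 < z by exact: lt_le_trans z1.
  have := @expR_convex R z^-1 (z * ln u) 0.
  rewrite invr_ge0 (ltW zp) invf_le1// z1 => /(_ isT).
  rewrite mulKf ?gt_eqF// mulr0 addr0 lnK ?posrE// expR0 mulr1.
  rewrite -(ler_pM2l zp) mulrDr mulrA divff ?gt_eqF// mul1r mulrBr mulr1 divff ?gt_eqF//.
  lra.
have ub u : 0 < u -> expR (z * ln u) <= (2 - z) * u + (z - 1) * u ^+ 2.
  move=> u0; have := @expR_convex R (2 - z) (ln u) (2 * ln u).
  have -> : 0 <= 2 - z <= 1 by apply/andP; split; lra.
  move=> /(_ isT); rewrite expRM_natl lnK ?posrE//.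
  have -> : (2 - z) * ln u + (1 - (2 - z)) * (2 * ln u) = z * ln u by ring.
  by have -> : 1 - (2 - z) = z - 1 by ring.
have pw0 x : 0 <= powlog w 0 x.
  by rewrite /powlog; case: ifPn => // _; rewrite expr0 mulr1 expR_ge0.
have cZ : c * gammad 0 (w + z) = Rintegral mu setT (fun x => c * (powlog (w + z) 0 x * expR (- x))).
  by rewrite RintegralZl.
apply/andP; split.
- have -> : gammad 0 w + z * (gammad 0 (w + 1) / t - gammad 0 w) =
     Rintegral mu setT (fun x => (1 - z) * (powlog w 0 x * expR (- x)) + (z / t) * (powlog (w + 1) 0 x * expR (- x))).
    rewrite (RintegralD measurableT (rintegrableZ (1 - z) measurableT i0) (rintegrableZ (z / t) measurableT i1)).
    rewrite (RintegralZl (1 - z) measurableT i0) (RintegralZl (z / t) measurableT i1).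
    rewrite -/(gammad 0 w) -/(gammad 0 (w + 1)).
    by move: (gammad 0 w) (gammad 0 (w + 1)) => A B; ring.
  rewrite [gammad 0 (w + z) * c]mulrC cZ; apply: le_Rint => //.
  - by apply: rintegrableD => //; exact: rintegrableZ.
  - exact: rintegrableZ.
  - move=> x _; have [x0|x0] := ltP 0 x; last first.
      by rewrite /powlog ltNge x0 /= !mul0r !mulr0 addr0.
    have [e1 e2 e3] := pE x x0.
    have -> : c * (powlog (w + z) 0 x * expR (- x)) = powlog (w + z) 0 x * c * expR (- x) by ring.
    rewrite e3.
    have -> : (1 - z) * (powlog w 0 x * expR (- x)) + z / t * (powlog (w + 1) 0 x * expR (- x)) =
      (1 - z) * (powlog w 0 x * expR (- x)) + z * (powlog (w + 1) 0 x / t) * expR (- x) by ring.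
    rewrite e1.
    rewrite (_ : _ + _ = powlog w 0 x * (1 + z * (x / t - 1)) * expR (- x)); last by ring.
    by rewrite ler_wpM2r ?expR_ge0// ler_wpM2l// lb// divr_gt0.
- have -> : (2 - z) * (gammad 0 (w + 1) / t) + (z - 1) * (gammad 0 (w + 1 + 1) / t ^+ 2) =
     Rintegral mu setT (fun x => ((2 - z) / t) * (powlog (w + 1) 0 x * expR (- x)) + ((z - 1) / t ^+ 2) * (powlog (w + 1 + 1) 0 x * expR (- x))).
    rewrite (RintegralD measurableT (rintegrableZ ((2 - z) / t) measurableT i1) (rintegrableZ ((z - 1) / t ^+ 2) measurableT i2)).
    rewrite (RintegralZl ((2 - z) / t) measurableT i1) (RintegralZl ((z - 1) / t ^+ 2) measurableT i2).
    rewrite -/(gammad 0 (w + 1)) -/(gammad 0 (w + 1 + 1)).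
    by move: (gammad 0 (w + 1)) (gammad 0 (w + 1 + 1)) => A B; ring.
  rewrite [gammad 0 (w + z) * c]mulrC cZ; apply: le_Rint => //.
  - exact: rintegrableZ.
  - by apply: rintegrableD => //; exact: rintegrableZ.
  - move=> x _; have [x0|x0] := ltP 0 x; last first.
      by rewrite /powlog ltNge x0 /= !mul0r !mulr0 addr0.
    have [e1 e2 e3] := pE x x0.
    have -> : c * (powlog (w + z) 0 x * expR (- x)) = powlog (w + z) 0 x * c * expR (- x) by ring.
    rewrite e3.
    have -> : (2 - z) / t * (powlog (w + 1) 0 x * expR (- x)) + (z - 1) / t ^+ 2 * (powlog (w + 1 + 1) 0 x * expR (- x)) =
      (2 - z) * (powlog (w + 1) 0 x / t) * expR (- x) + (z - 1) * (powlog (w + 1 + 1) 0 x / t ^+ 2) * expR (- x) by ring.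
    rewrite e1 e2.
    rewrite (_ : _ + _ = powlog w 0 x * ((2 - z) * (x / t) + (z - 1) * (x / t) ^+ 2) * expR (- x)); last by ring.
    by rewrite ler_wpM2r ?expR_ge0// ler_wpM2l// ub// divr_gt0.
Qed.

Lemma prod_gamma y n : 0 < y -> (\prod_(i < n.+1) (y + i%:R)) * gammad 0 y = gammad 0 (n%:R + 1 + y).
Proof.
move=> y0; elim: n => [|n IH].
  by rewrite big_ord_recr big_ord0 /= mul1r addr0 add0r addrC gammaS.
rewrite big_ord_recr /= mulrAC IH -natr1 mulrC.
rewrite [in RHS](_ : n%:R + 1 + 1 + y = n%:R + 1 + y + 1); last by ring.
rewrite [RHS]gammaS; last by rewrite addr_gt0// addr_gt0// ?ltr0n.
by congr (_ * _); ring.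
Qed.

Lemma cvg_invn : (n.+1%:R : R)^-1 @[n --> \oo] --> (0 : R).
Proof. exact: cvg_harmonic. Qed.

(* Without this, comparing two values of [gammad] unfolds the integrals. *)
#[local] Opaque gammad.

(** With [gauss_upper2], this brings the upper estimates of the cases [1 <= y] and [y < 1] below the
    common bound [(1 + r) (1 + 2 r)], [r] being the reciprocal of the index. *)
Lemma gauss_upper1 (y r : R) : y <= 2 -> 0 <= r -> 2 - y + (y - 1) * (1 + 2 * r) <= 1 + 2 * r.
Proof.
move=> y2 r0; rewrite -subr_ge0 (_ : _ - _ = (2 - y) * (2 * r)); last by ring.
by rewrite !mulr_ge0// subr_ge0.
Qed.

Lemma gauss_upper2 (y r : R) : y <= 1 -> 0 <= r -> 1 + y * r <= (1 + r) * (1 + 2 * r).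
Proof.
move=> y1 r0; rewrite -subr_ge0 (_ : _ - _ = (1 - y) * r + 2 * r + 2 * (r * r)); last by ring.
by rewrite !addr_ge0// !mulr_ge0// subr_ge0.
Qed.

Lemma gauss_ratio_aux (G F t E : R) : F != 0 -> t != 0 -> E != 0 ->
  F * t^-1 * (G / F / E) * (E * t) = G.
Proof. by move=> F0 t0 E0; field; rewrite F0 t0 E0. Qed.

(** By [prod_gamma] the claim reads Gamma(n + 1 + y) / (n! n^y) -> 1, and [gamma_ratio_bounds]
    squeezes this quotient between 1 and a sequence tending to 1. *)
Lemma gauss_ratio y : 0 < y < 2 ->
  (\prod_(i < n.+1) (y + i%:R)) / (n`!%:R * (n%:R `^ y)) * gammad 0 y @[n --> \oo] --> (1 : R).
Proof.
move=> /andP[y0 y2].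
have yb1 : y < 1 -> 1 <= y + 1 <= 2 by move=> y1; apply/andP; split; lra.
(* The index is shifted to start at 1: the base of the power is then positive and [powR] is an
   exponential of [ln]. *)
rewrite -(cvg_shiftS (fun n => (\prod_(i < n.+1) (y + i%:R)) / (n`!%:R * (n%:R `^ y)) * gammad 0 y)).
have E n : (\prod_(i < n.+2) (y + i%:R)) / ((n.+1)`!%:R * (n.+1%:R `^ y)) * gammad 0 y =
   gammad 0 (n.+1%:R + 1 + y) / (n.+1)`!%:R / expR (y * ln n.+1%:R).
  rewrite mulrAC prod_gamma// invfM mulrA; congr (_ / _).
  by rewrite /powR gt_eqF ?ltr0n.
apply: (@squeeze_cvgr _ _ _ _
  (fun=> 1 : R)
  (fun n => (1 + (n.+1%:R)^-1) * (1 + 2 * (n.+1%:R)^-1))).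
- apply: nearW => n; rewrite [X in _ <= X <= _](E n); set t := n.+1%:R.
  have t0 : 0 < t by rewrite ltr0n.
  have g1 : gammad 0 (t + 1) = (n.+1)`!%:R by rewrite /t natr1 gamma_fact.
  have fn : (0 : R) < (n.+1)`!%:R by rewrite ltr0n fact_gt0.
  move: fn g1; clearbody t; move: ((n.+1)`!%:R : R) => F F0 g1.
  have tn : t != 0 by rewrite gt_eqF.
  have fn : F != 0 by rewrite gt_eqF.
  have E0 : expR (y * ln t) != 0 by rewrite gt_eqF// expR_gt0.
  set Q := _ / F / _; have QE : Q = gammad 0 (t + 1 + y) / F / expR (y * ln t) by [].
  clearbody Q.
  set r := t^-1; have r0 : 0 < r by rewrite invr_gt0.
  (* The exponent in [gamma_ratio_bounds] must lie in [[1, 2]]: it is [y] with base point [t + 1] if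
     [y >= 1], and [y + 1] with base point [t] otherwise. *)
  have [y1|y1] := leP 1 y.
    have w0 : 0 < t + 1 by rewrite addr_gt0.
    have yb : 1 <= y <= 2 by rewrite y1 ltW.
    have g2 : gammad 0 (t + 1 + 1) = (t + 1) * F by rewrite gammaS// g1.
    have g3 : gammad 0 (t + 1 + 1 + 1) = (t + 1 + 1) * ((t + 1) * F).
      by rewrite gammaS ?g2// addr_gt0.
    have vE : F * Q * expR (y * ln t) = gammad 0 (t + 1 + y).
      by rewrite QE mulrA mulrCA divff// mulr1 divfK.
    have := gamma_ratio_bounds w0 yb t0 vE; rewrite g1 g2 g3.
    have -> : F + y * ((t + 1) * F / t - F) = F * (1 + y * r).
      by rewrite /r; field.
    have -> : (2 - y) * ((t + 1) * F / t) + (y - 1) * ((t + 1 + 1) * ((t + 1) * F) / t ^+ 2) =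
      F * ((1 + r) * ((2 - y) + (y - 1) * (1 + 2 * r))) by rewrite /r; field.
    rewrite !ler_pM2l// => /andP[h1 h2]; apply/andP; split.
      by apply: le_trans h1; rewrite lerDl mulr_ge0// ltW.
    by apply: (le_trans h2); rewrite ler_pM2l ?addr_gt0// gauss_upper1// ltW.
  have yb := yb1 y1.
  have g0 : gammad 0 t = F * r by rewrite -g1 gammaS// mulrC mulKf.
  have g2 : gammad 0 (t + 1 + 1) = (t + 1) * F by rewrite gammaS// ?g1// addr_gt0.
  have vE : F * r * Q * expR ((y + 1) * ln t) = gammad 0 (t + (y + 1)).
    rewrite mulrDl mul1r expRD lnK ?posrE// QE addrA [t + y + 1]addrAC.
    exact: gauss_ratio_aux.
  have := gamma_ratio_bounds t0 yb t0 vE; rewrite g0 g1 g2.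
  have -> : F * r + (y + 1) * (F / t - F * r) = F * r * 1 by rewrite /r; ring.
  have -> : (2 - (y + 1)) * (F / t) + (y + 1 - 1) * ((t + 1) * F / t ^+ 2) = F * r * (1 + y * r).
    by rewrite /r; field.
  rewrite !ler_pM2l ?mulr_gt0// => /andP[-> h2] /=.
  by apply: (le_trans h2); rewrite gauss_upper2// ltW.
- exact: cvg_cst.
- rewrite [X in _ --> X](_ : 1 = (1 + 0) * (1 + 2 * 0) :> R); last by rewrite mulr0 addr0 mulr1.
  apply: cvgM; (apply: cvgD; first exact: cvg_cst).
    exact: cvg_invn.
  apply: cvgM; first exact: cvg_cst.
  exact: cvg_invn.
Qed.

(** A zero of Gamma would make the sequence in [gauss_ratio] vanish identically, although it tends
    to 1. *)
Lemma gamma_neq0 y : 0 < y < 2 -> gammad 0 y != 0.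
Proof.
move=> hy; apply/eqP => g0; have h := gauss_ratio hy.
have E : (fun n => (\prod_(i < n.+1) (y + i%:R)) / (n`!%:R * (n%:R `^ y)) * gammad 0 y) = (fun=> 0 : R).
  by apply/funext => n; rewrite g0 mulr0.
rewrite E in h; have h0 : (fun=> 0 : R) n @[n --> \oo] --> (0 : R) by exact: cvg_cst.
have /eqP : (1 : R) = 0 by exact: (cvg_unique _ h h0).
by rewrite oner_eq0.
Qed.

(** The link between the limit in the statement and Euler's integral. The range suffices, since the
    subtracted log-power terms have [beta + 1] in [[1, 2)]. *)
Lemma rgammaE y : 0 < y < 2 -> rgamma y = (gammad 0 y)^-1.
Proof.
move=> hy; apply/cvg_lim => //.
have g0 := gamma_neq0 hy.
rewrite -[X in _ --> X](mul1r (gammad 0 y)^-1).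
apply: cvg_trans (cvgM (gauss_ratio hy) (cvg_cst (gammad 0 y)^-1)); apply: near_eq_cvg; apply: nearW => n /=.
by rewrite mulfK.
Qed.
End GammaFunction.

(** * Smoothness of 1/Gamma and the log-power transforms *)

Section Smoothness.
Context {R : realType}.
Implicit Types (f g : R -> R) (I : set R) (n : nat).

(** Recursion on the total derivative. For open [I] only values on [I] matter, so a derivative may
    be replaced by a formula valid on [I]. *)
Fixpoint smooth_on I n f : Prop :=
  if n is n'.+1 then (forall x, I x -> derivable f x 1) /\ smooth_on I n' f^`() else True.

Lemma derive1_val f (x l : R) : is_derive x 1 f l -> f^`() x = l.
Proof. by move=> [_ fl]; rewrite derive1E. Qed.

Lemma derivable_is_derive1 f (x : R) : derivable f x 1 -> is_derive x 1 f (f^`() x).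
Proof. by move=> df; split => //; rewrite derive1E. Qed.

Lemma smooth_on_ext I n f g : open I -> (forall x, I x -> f x = g x) ->
  smooth_on I n f -> smooth_on I n g.
Proof.
move=> oI; elim: n f g => // n IH f g fg [df sf].
have nfg x : I x -> \near x, f x = g x.
  by move=> Ix; apply: filterS (open_nbhs_nbhs (conj oI Ix)) => t; exact: fg.
have dg x : I x -> is_derive x 1 g (f^`() x).
  by move=> Ix; apply: is_derive_near (nfg x Ix) (derivable_is_derive1 (df x Ix)).
split; first by move=> x /dg[].
by apply: IH sf => x /dg /derive1_val ->.
Qed.

Lemma smooth_onS I n f f' : open I -> (forall x, I x -> is_derive x 1 f (f' x)) ->
  smooth_on I n f' -> smooth_on I n.+1 f.
Proof.
move=> oI h sf'; split; first by move=> x /h[].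
by apply: smooth_on_ext oI _ sf' => x /h /derive1_val ->.
Qed.

Lemma smooth_onW I n f : smooth_on I n.+1 f -> smooth_on I n f.
Proof. by elim: n f => // n IH f [df sf]; split => //; exact: IH. Qed.

Lemma smooth_on_cst I n (c : R) : open I -> smooth_on I n (fun=> c).
Proof.
move=> oI; elim: n c => // n IH c.
by apply: smooth_onS (IH 0) => // x _; exact: is_derive_const.
Qed.

Lemma smooth_on_add I n f g : open I -> smooth_on I n f -> smooth_on I n g ->
  smooth_on I n (fun x => f x + g x).
Proof.
move=> oI; elim: n f g => // n IH f g [df sf] [dg sg].
apply: smooth_onS (IH _ _ sf sg) => // x Ix.
by apply: is_derive_add; apply: derivable_is_derive1; [exact: df | exact: dg].
Qed.

Lemma smooth_on_mul I n f g : open I -> smooth_on I n f -> smooth_on I n g ->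
  smooth_on I n (fun x => f x * g x).
Proof.
move=> oI; elim: n f g => // n IH f g sf sg.
have [df sf'] := sf; have [dg sg'] := sg.
apply: (smooth_onS (f := fun x => f x * g x) (f' := fun x => derive1 f x * g x + f x * derive1 g x) oI).
  by move=> x Ix; apply: is_derive_mul; apply: derivable_is_derive1; [exact: df | exact: dg].
by apply: smooth_on_add => //; apply: IH => //; exact: smooth_onW.
Qed.

Lemma smooth_on_derive1n I f : (forall n, smooth_on I n f) ->
  forall j x, I x -> is_derive x 1 (derive1n j f) (derive1n j.+1 f x).
Proof.
move=> sf j; suff : forall n, smooth_on I n (derive1n j f).
  by move=> /(_ 1%N)[h _] x Ix; exact: derivable_is_derive1 (h x Ix).
elim: j => // j IH n; by have [] := IH n.+1.
Qed.
End Smoothness.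

Section ReciprocalGamma.
Context {R : realType}.
Local Notation mu := (@lebesgue_measure R).
Implicit Types (x y : R) (s : R[i]) (m n k : nat).

Let I : set R := `]0, 2[%classic.
Let oI : open I. Proof. exact: interval_open. Qed.
Let IP y : I y -> 0 < y < 2. Proof. by rewrite /I /= in_itv. Qed.

Lemma smooth_gammad n m : smooth_on I n (gammad m).
Proof.
elim: n m => // n IH m; apply: smooth_onS (IH m.+1) => // y /IP /andP[y0 _].
exact: is_derive_gammad.
Qed.

(** The derivative is expressed through [rgamma] itself, so that smoothness of every order follows
    by induction from the product rule. *)
Lemma is_derive_rgamma y : 0 < y < 2 ->
  is_derive y 1 rgamma (- 1 * gammad 1 y * (rgamma y * rgamma y)).
Proof.
move=> hy; have y0 : 0 < y by case/andP: hy.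
have Iy : I y by rewrite /I /= in_itv.
apply: (@is_derive_near _ (fun t => (gammad 0 t)^-1)).
  apply: filterS (open_nbhs_nbhs (conj oI Iy)) => t /IP ht.
  by rewrite rgammaE.
refine (is_derive_val (is_derive_inv (gamma_neq0 hy) (is_derive_gammad 0 y0)) _).
by rewrite rgammaE// mulN1r -invfM -expr2.
Qed.

Lemma smooth_rgamma n : smooth_on I n (@rgamma R).
Proof.
elim: n => // n IH.
apply: (@smooth_onS _ _ _ _ (fun y => - 1 * gammad 1 y * (rgamma y * rgamma y))) => //.
  by move=> y /IP; exact: is_derive_rgamma.
apply: smooth_on_mul => //; apply: smooth_on_mul => //; first exact: smooth_on_cst.
exact: smooth_gammad.
Qed.

Lemma is_derive_Dgam j y : 0 < y < 2 -> is_derive y 1 (Dgam j) (Dgam j.+1 y).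
Proof.
move=> hy; apply: (smooth_on_derive1n (I := I)); first exact: smooth_rgamma.
by rewrite /I /= in_itv.
Qed.

(** Pascal's rule: the left side is the term-by-term derivative of the Leibniz sum of order [k], the
    right side the sum of order [k + 1]. *)
Lemma leibniz_sum (A : pzSemiRingType) (a b : nat -> A) k :
  \sum_(j < k.+1) (a j.+1 * b (k - j)%N + a j * b (k.+1 - j)%N) *+ 'C(k, j) =
  \sum_(j < k.+2) (a j * b (k.+1 - j)%N) *+ 'C(k.+1, j).
Proof.
under eq_bigr do rewrite mulrnDl.
rewrite big_split /= [RHS]big_ord_recl /= bin0.
under [in RHS]eq_bigr do rewrite /bump /= add1n subSS binS mulrnDr.
rewrite [in RHS]big_split /= [in RHS]addrA [LHS]addrC; congr (_ + _).
rewrite big_ord_recl /= bin0 subn0; congr (_ + _).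
rewrite [RHS]big_ord_recr /= bin_small// mulr0n addr0.
by apply: eq_bigr => i _.
Qed.

(** Induction on [k], starting from the fact that [rgamma y] inverts Gamma(y). In the step both
    sides are differentiated in [y], where the right side merely gains a factor [- clog s], and
    [cderive_unique] equates the results. *)
Lemma plaplace_Dgam k y s : 0 < y < 2 -> 0 < cRe s ->
  \sum_(j < k.+1) cr ('C(k, j)%:R * Dgam j y) * plaplace y (k - j) s =
  (- clog s) ^+ k * cexp (- (cr y * clog s)).
Proof.
move=> hy s0; elim: k y hy => [|k IH] y hy.
  have y0 : 0 < y by case/andP: hy.
  rewrite big_ord_recr big_ord0 /= add0r bin0 mul1r expr0 mul1r.
  rewrite plaplace_gamma// mulrA -crM /Dgam /= rgammaE//.
  by rewrite mulVf ?gamma_neq0// cr1 mul1r.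
have y0 : 0 < y by case/andP: hy.
pose F t := \sum_(j < k.+1) cr ('C(k, j)%:R * Dgam j t) * plaplace t (k - j) s.
have d1 : cderive F y (\sum_(j < k.+1) (cr ('C(k, j)%:R * Dgam j.+1 y) * plaplace y (k - j) s
     + cr ('C(k, j)%:R * Dgam j y) * plaplace y (k - j).+1 s)).
  apply: (@cderive_sum _ _ (fun (j : 'I_k.+1) t => cr ('C(k, j)%:R * Dgam j t) * plaplace t (k - j) s)) => j.
  apply: cderiveM; last exact: cderive_plaplace.
  by apply: cderive_cr; apply: is_derive_scale; exact: is_derive_Dgam.
have d2 : cderive F y ((- clog s) ^+ k.+1 * cexp (- (cr y * clog s))).
  have Iy : I y by rewrite /I /= in_itv.
  apply: (@cderive_near _ (fun t => (- clog s) ^+ k * cexp (- (cr t * clog s)))).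
    by apply: filterS (open_nbhs_nbhs (conj oI Iy)) => t /IP ht; rewrite /F IH.
  apply: cderive_eq.
    apply: cderiveZ; apply: cderive_cexp.
    have := cderiveZ (- clog s) (cderive_cr (is_derive_ident y)).
    rewrite (_ : (fun t => - clog s * cr t) = (fun t => - (cr t * clog s))).
      by move=> h; exact: h.
    by apply/funext => t; ring.
  by rewrite cr1 exprS; ring.
rewrite -(cderive_unique d1 d2).
have := @leibniz_sum _ (fun j => cr (Dgam j y)) (fun j => plaplace y j s) k.
have E (i : nat) z : cr (i%:R) * z = z *+ i.
  by elim: i => [|i IHi]; rewrite ?cr0 ?mul0r// -natr1 crD cr1 mulrDl IHi mul1r mulrSr.
under eq_bigr do rewrite -E mulrDr !mulrA -!crM.
under [X in _ = X -> _]eq_bigr do rewrite -E !mulrA -!crM.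
move=> <-; apply: eq_bigr => j _.
by rewrite -subSn// -ltnS.
Qed.

Lemma clog_inv s : 0 < cRe s -> clog s^-1 = - clog s.
Proof.
move=> s0; have q0 := sqnorm_gt0 s0.
apply: complex_ext; rewrite cE /clog /=.
  by rewrite cabsV lnV// posrE cabs_gt0.
rewrite /carg s0 cRe_inv cIm_inv divr_gt0//.
rewrite -atanN; congr atan; field.
by rewrite !gt_eqF.
Qed.

Lemma powlog_laplace k y s : 0 < y < 2 -> 0 < cRe s ->
  \sum_(j < k.+1) cr ('C(k, j)%:R * Dgam j y) * plaplace y (k - j) s =
  clog s^-1 ^+ k / cpow s (cr y).
Proof.
move=> hy s0; rewrite plaplace_Dgam// clog_inv// /cpow cexp_inv.
by [].
Qed.
End ReciprocalGamma.

(** * A test function with nonnegative Fourier transform *)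
Section Bump.
Context {R : realType}.
Local Notation mu := (@lebesgue_measure R).
Local Notation T := (measurableTypeR R).
Implicit Types (x t u v eta : R) (f : R -> R) (m n : nat).

(** [x^(-m) e^(-1/x)] extended by 0. The index makes the span of the family closed under
    differentiation, so smoothness at 0 is a plain induction. *)
Definition flat_exp m x : R := if 0 < x then x^-1 ^+ m * expR (- x^-1) else 0.

Lemma is_derive0_quadratic f (C : R) : f 0 = 0 -> (forall x, `|f x| <= C * x ^+ 2) ->
  is_derive (0 : R) 1 f 0.
Proof.
move=> f0 fC.
have C0 : 0 <= C by have := fC 1; rewrite expr1n mulr1; apply: le_trans.
have h : (fun h : R => h^-1 *: ((f \o shift 0) (h *: (1 : R)) - f 0)) @ 0^' --> (0 : R).
  apply/cvgr0Pnorm_le => e e0.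
  have : \forall h \near (0 : R)^', `|h| <= e / (C + 1).
    by apply: dnbhs0_le; rewrite divr_gt0// ltr_wpDl.
  have : \forall h \near (0 : R)^', h != 0 by exact: nbhs_dnbhs_neq.
  apply: filterS2 => h h0 he; rewrite f0 subr0 /= addr0 /GRing.scale /= mulr1.
  rewrite normrM normfV ler_pdivrMl ?normr_gt0//.
  apply: (le_trans (fC h)); rewrite -[h ^+ 2]ger0_norm ?sqr_ge0// normrX expr2 mulrCA ler_wpM2l//.
  apply: (@le_trans _ _ (C * (e / (C + 1)))); first by rewrite ler_wpM2l.
  by rewrite mulrCA ler_piMr ?(ltW e0)// ler_pdivrMr ?ltr_wpDl// mul1r lerDl.
split; first by apply/cvg_ex; exists 0; exact: h.
exact/cvg_lim.
Qed.

(** [expr_le_expR] at [v = 1 / x] with exponent [m + 2]. A quadratic bound is what forces the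
    derivative at 0 to vanish. *)
Lemma flat_exp_quadratic m : exists C, forall x, `|flat_exp m x| <= C * x ^+ 2.
Proof.
have [C C0 H] := @expr_le_expR R 1 m.+2 ltr01; exists C => x.
rewrite /flat_exp; case: ifPn => x0; last by rewrite normr0 mulr_ge0 ?sqr_ge0// ltW.
have v0 : 0 < x^-1 by rewrite invr_gt0.
rewrite ger0_norm; last by rewrite mulr_ge0 ?expR_ge0// exprn_ge0// ltW.
have := H x^-1 (ltW v0); rewrite mul1r -addn2 exprD => h.
rewrite -(ler_pM2r (expR_gt0 x^-1)) -mulrA -expRD addNr expR0 mulr1.
rewrite -(ler_pM2r (exprn_gt0 2 v0)); apply: (le_trans h).
rewrite mulrAC -[C * x ^+ 2 * _]mulrA -exprMn divff ?gt_eqF//.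
by rewrite expr1n mulr1.
Qed.

Lemma is_derive_flat_exp m x :
  is_derive x 1 (flat_exp m) (- m%:R * flat_exp m.+1 x + flat_exp m.+2 x).
Proof.
have [x0|x0|<-] := ltgtP 0 x.
- have xn : x != 0 by rewrite gt_eqF.
  have di := is_derive_inv (f := fun t => t) xn (is_derive_ident x).
  apply: (@is_derive_near _ (fun t => t^-1 ^+ m * expR (- t^-1))).
    by apply: filterS (lt_nbhsr x0) => t t0; rewrite /flat_exp t0.
  have dX : is_derive x 1 (fun t => t^-1 ^+ m) (m%:R * x^-1 ^+ m.-1 * (- 1 / x ^+ 2)).
    apply: (is_derive_compose (f := fun v => v ^+ m) (g := fun t => t^-1)) di.
    have h := @is_deriveX R R (fun t => t) m x^-1 1 1 (is_derive_ident _).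
    apply: (@is_derive_ext _ ((fun t : R => t) ^+ m)); first by move=> t; rewrite exprfctE.
    by refine (is_derive_val h _); rewrite /GRing.scale /= mulr1.
  refine (is_derive_val (is_derive_mul dX (is_derive_compose (f := @expR R) (g := fun t => - t^-1) (is_derive_expR _) (is_derive_opp di))) _).
  rewrite /flat_exp x0.
  have -> : m%:R * x^-1 ^+ m.-1 * (-1 / x ^+ 2) = - (m%:R * x^-1 ^+ m.+1) :> R.
    case: (m) => [|k] /=; first by rewrite !mul0r oppr0.
    by rewrite -exprVn mulN1r mulrN -mulrA -exprD addn2.
  rewrite -[m.+2]addn2 exprD mulN1r mulNr opprK -exprVn; ring.
- have -> : - m%:R * flat_exp m.+1 x + flat_exp m.+2 x = 0.
    by rewrite /flat_exp ltNge (ltW x0) /= mulr0 addr0.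
  refine (is_derive_near _ (is_derive_const 0 x)).
  by apply: filterS (lt_nbhsl x0) => t t0; rewrite /flat_exp ltNge (ltW t0).
- have -> : - m%:R * flat_exp m.+1 0 + flat_exp m.+2 0 = 0.
    by rewrite /flat_exp ltxx mulr0 addr0.
  have [C HC] := flat_exp_quadratic m.
  by apply: is_derive0_quadratic HC; rewrite /flat_exp ltxx.
Qed.

Lemma smooth_flat_exp n m : smooth_on setT n (flat_exp m).
Proof.
elim: n m => // n IH m.
apply: (@smooth_onS _ setT n _ (fun x => - m%:R * flat_exp m.+1 x + flat_exp m.+2 x)).
- exact: openT.
- by move=> x _; exact: is_derive_flat_exp.
- apply: smooth_on_add; [exact: openT| |exact: IH].
  by apply: smooth_on_mul; [exact: openT|apply: smooth_on_cst; exact: openT|exact: IH].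
Qed.

Lemma smooth_on_affine f (a c : R) n : (forall n, smooth_on setT n f) ->
  smooth_on setT n (fun t => f (a + c * t)).
Proof.
elim: n f => // n IH f sf.
apply: (smooth_onS (f := fun t => f (a + c * t)) (f' := fun x => derive1 f (a + c * x) * c) (@openT R)).
- move=> x _; apply: (is_derive_compose (f := f) (g := fun t => a + c * t)).
    by apply: derivable_is_derive1; have [h _] := sf 1%N; exact: h.
  refine (is_derive_val (is_derive_add (is_derive_const a x) (is_derive_scale c (is_derive_ident x))) _).
  by rewrite add0r mulr1.
- apply: smooth_on_mul; [exact: openT| |apply: smooth_on_cst; exact: openT].
  apply: IH => k; by have [] := sf k.+1.
Qed.

Lemma smooth_on_cos_sin y n : smooth_on setT n (fun t : R => cos (y * t)) /\
  smooth_on setT n (fun t : R => sin (y * t)).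
Proof.
have oT := @openT R.
have dy x : is_derive x 1 (fun t => y * t) y.
  by refine (is_derive_val (is_derive_scale y (is_derive_ident x)) _); rewrite mulr1.
elim: n => // n [IHc IHs]; split.
- apply: (@smooth_onS _ setT n _ (fun x => - y * sin (y * x))) => //.
    move=> x _; refine (is_derive_val (is_derive_compose (f := @cos R) (g := fun t => y * t) (is_derive_cos _) (dy x)) _).
    by ring.
  by apply: smooth_on_mul => //; exact: smooth_on_cst.
- apply: (@smooth_onS _ setT n _ (fun x => y * cos (y * x))) => //.
    move=> x _; refine (is_derive_val (is_derive_compose (f := @sin R) (g := fun t => y * t) (is_derive_sin _) (dy x)) _).
    by ring.
  by apply: smooth_on_mul => //; exact: smooth_on_cst.
Qed.

Lemma smooth_real_of f : (forall n, smooth_on setT n f) -> smooth_real f.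
Proof. by move=> sf n x; have [] := smooth_on_derive1n sf n (x := x) I. Qed.

Definition supported eta f := forall t, eta < `|t| -> f t = 0.

Lemma supported_derive1 eta f : supported eta f -> supported eta (derive1 f).
Proof.
move=> sf t et; apply: derive1_val; refine (is_derive_near _ (is_derive_const 0 t)).
have : \forall s \near t, eta < `|s|.
  have c : {for t, continuous (fun s : R => `|s|)} by exact: norm_continuous.
  by have h := cvgr_gt `|t| c; exact: h.
by apply: filterS => s es; rewrite sf.
Qed.

Lemma smooth_continuous f : (forall n, smooth_on setT n f) -> continuous f.
Proof.
move=> sf x; have [h _] := sf 1%N.
exact: is_derive_continuous (derivable_is_derive1 (h x I)).
Qed.

Lemma smooth_derive1 f : (forall n, smooth_on setT n f) -> forall n, smooth_on setT n (derive1 f).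
Proof. by move=> sf n; have [] := sf n.+1. Qed.

Lemma supported_bounded eta f : 0 < eta -> continuous f -> supported eta f ->
  exists2 M, 0 <= M & forall t, `|f t| <= M.
Proof.
move=> e0 cf sf.
have le : - eta <= eta by lra.
have cn : {within `[- eta, eta], continuous (fun t => `|f t|)}.
  apply: continuous_subspaceT => t; apply: continuous_comp; first exact: cf.
  exact: norm_continuous.
have [c _ hc] := EVT_max le cn.
exists `|f c| => // t; have [te|te] := leP `|t| eta.
  by apply: hc; rewrite in_itv/= -ler_norml.
by rewrite sf// normr0.
Qed.

Lemma continuous_measurableT f : continuous f -> measurable_fun [set: T] (f : T -> R).
Proof.
by move=> cf; have : measurable_fun [set: R] f by exact: continuous_measurable_fun.
Qed.

Lemma supported_indicator eta f M : (forall t, `|f t| <= M) -> supported eta f ->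
  forall t, `|f t| <= M * \1_(`[- eta, eta]%classic) t.
Proof.
move=> fM sf t; have [te|te] := leP `|t| eta.
  by rewrite indicE mem_set ?mulr1//= in_itv/= -ler_norml.
by rewrite sf// normr0 mulr_ge0// (le_trans _ (fM t)).
Qed.

Lemma rintegrable_indicator (a b : R) : rintegrable setT (\1_(`[a, b]%classic) : R -> R).
Proof.
exact: (integrable_indic_itv a b true false).
Qed.

Lemma rintegrable_supported eta f : 0 < eta -> continuous f -> supported eta f ->
  rintegrable setT f.
Proof.
move=> e0 cf sf; have [M M0 fM] := supported_bounded e0 cf sf.
apply: (@rintegrable_le _ _ _ (fun t => M * \1_(`[- eta, eta]%classic) t)) => //.
- exact: continuous_measurableT.
- by move=> t _; exact: supported_indicator.
- by apply: rintegrableZ => //; exact: rintegrable_indicator.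
Qed.

(** Near 0 the function exceeds [f 0 / 2], so its integral is at least that of [f 0 / 2] over
    [[0, d / 2]]. *)
Lemma Rint_gt0 f : continuous f -> (forall t, 0 <= f t) -> 0 < f 0 ->
  rintegrable setT f -> 0 < Rintegral mu setT f.
Proof.
move=> cf f0 fp fi.
have : \forall t \near (0 : R), f 0 / 2 < f t.
  have h2 : f 0 / 2 < f 0 by rewrite ltr_pdivrMr// ltr_pMr// ltr1n.
  have h := cvgr_gt (f 0) (cf 0); exact: h.
move=> [d /= d0 hd].
have d2 : 0 < d / 2 by rewrite divr_gt0.
apply: (@lt_le_trans _ _ (Rintegral mu setT (fun t => f 0 / 2 * \1_(`[0, d / 2]%classic) t))).
  rewrite RintegralZl//; last exact: rintegrable_indicator.
  apply: mulr_gt0; first by rewrite divr_gt0.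
  have E : mu (`[0, d / 2]%classic : set T) = (d / 2)%:E.
    have := @lebesgue_measure_itv R `[0, d / 2]%R.
    by rewrite /= lte_fin d2 -EFinB subr0.
  by rewrite /Rintegral integral_indic// setIT; move: E => /= ->.
apply: le_Rint => //.
- by apply: rintegrableZ => //; exact: rintegrable_indicator.
- move=> t _; rewrite indicE; case: (boolP (t \in _)) => /=; last by rewrite mulr0.
  rewrite inE /= in_itv/= mulr1 => /andP[t0 td]; apply/ltW/hd => /=.
  rewrite sub0r normrN ger0_norm//; apply: le_lt_trans td _.
  by rewrite ltr_pdivrMr// ltr_pMr// ltr1n.
Qed.

(** The factors vanish for [t <= -eta] and for [t >= eta]; the coefficients 1 and -1 are displayed
    to fit [smooth_on_affine]. *)
Definition bump_fun eta t : R := flat_exp 0 (eta + 1 * t) * flat_exp 0 (eta + (- 1) * t).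

Lemma smooth_bump_fun eta n : smooth_on setT n (bump_fun eta).
Proof.
by apply: smooth_on_mul; [exact: openT|apply: smooth_on_affine..] => k; exact: smooth_flat_exp.
Qed.

Lemma flat_exp_ge0 m x : 0 <= flat_exp m x.
Proof.
rewrite /flat_exp; case: ifPn => // x0.
by rewrite mulr_ge0 ?expR_ge0// exprn_ge0// invr_ge0 ltW.
Qed.

Lemma bump_fun_ge0 eta t : 0 <= bump_fun eta t.
Proof. by rewrite mulr_ge0// flat_exp_ge0. Qed.

Lemma bump_fun_gt0 eta : 0 < eta -> 0 < bump_fun eta 0.
Proof. by move=> e0; rewrite /bump_fun !mulr0 addr0 /flat_exp e0 expr0 mul1r mulr_gt0// expR_gt0. Qed.

Lemma supported_bump_fun eta : supported eta (bump_fun eta).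
Proof.
move=> t; rewrite /bump_fun /flat_exp; have [t0|t0] := leP 0 t.
  rewrite ger0_norm// => et.
  by rewrite [X in _ * X](_ : _ = 0) ?mulr0//; case: ifPn => //; lra.
rewrite ltr0_norm// => et.
by rewrite [X in X * _](_ : _ = 0) ?mul0r//; case: ifPn => //; lra.
Qed.
End Bump.

(** * Autocorrelation, its Fourier transform and its decay *)

Section Kernel.
Context {R : realType}.
Local Notation mu := (@lebesgue_measure R).
Local Notation T := (measurableTypeR R).
Implicit Types (x t u v eta : R) (f : R -> R) (n : nat).

Definition wave v t : R[i] := cexp (- (ci * cr (v * t))).

Lemma cabs_wave v t : cabs (wave v t) = 1.
Proof. by rewrite /wave cabs_cexp !cE /= mul0r mulr0 subr0 oppr0 expR0. Qed.

Lemma waveE v t : wave v t = Complex (cos (v * t)) (- sin (v * t)).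
Proof.
rewrite /wave (_ : - (ci * cr (v * t)) = Complex 0 (- (v * t))).
  by rewrite /cexp /= expR0 cosN sinN !mul1r.
by apply: complex_ext; rewrite !cE /=; ring.
Qed.

Lemma waveB v t u : wave v (t - u) = wave v t * wave (- v) u.
Proof. by rewrite /wave -cexpD; congr cexp; rewrite mulrBr crD mulNr; ring. Qed.

Lemma waveBl v w t : wave (v - w) t = wave v t * cexp (ci * cr (w * t)).
Proof. by rewrite /wave -cexpD; congr cexp; rewrite mulrBl crD crN; ring. Qed.

Lemma cmeasurable_wave v : cmeasurable [set: T] (fun t : T => wave v t).
Proof.
apply: eq_cmeasurable (cmeasurable_cexp_lin (ci * cr v)) => t _.
by rewrite /wave crM mulrA mulNr.
Qed.

Lemma cderive_wave v t : cderive (wave v) t (- (ci * cr v) * wave v t).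
Proof.
apply: cderive_cexp.
have := cderiveZ (- (ci * cr v)) (cderive_cr (is_derive_ident t)).
rewrite cr1 mulr1; congr cderive; apply/funext => s; rewrite crM; ring.
Qed.

Lemma cintegrable_wave f v : rintegrable setT f -> cintegrable setT (fun t => cr (f t) * wave v t).
Proof.
move=> fi; apply: (@cintegrable_le _ _ _ (fun t => `|f t|)) => //.
- apply: cmeasurableM; last exact: cmeasurable_wave.
  by apply: cmeasurable_cr; exact: rintegrable_meas fi.
- by move=> t _; rewrite cabsM cabs_cr cabs_wave mulr1.
- exact: rintegrable_abs.
Qed.

Section Compact.
Variables (eta : R) (f : R -> R).
Hypotheses (e0 : 0 < eta) (sf : forall n, smooth_on setT n f) (supf : supported eta f).

Let cf : continuous f. Proof. exact: smooth_continuous. Qed.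
Let cf' : continuous (derive1 f). Proof. exact/smooth_continuous/smooth_derive1. Qed.
Let df t : is_derive t 1 f (derive1 f t).
Proof. by apply: derivable_is_derive1; have [h _] := sf 1%N; exact: h. Qed.
Let df' t : is_derive t 1 (derive1 f) (derive1 (derive1 f) t).
Proof. by apply: derivable_is_derive1; have [_ [h _]] := sf 2%N; exact: h. Qed.

(** The derivative of [f] times the wave has integral zero, because compact support kills the
    boundary terms on large intervals. *)
Lemma fourier_derive1 v : cintegral setT (fun t => cr (derive1 f t) * wave v t) =
  ci * cr v * cintegral setT (fun t => cr (f t) * wave v t).
Proof.
have if_ := rintegrable_supported e0 cf supf.
have if' := rintegrable_supported e0 cf' (supported_derive1 supf).
have i1 := cintegrable_wave v if_.
have i2 := cintegrable_wave v if'.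
have big : \forall n \near \oo, eta < n.+1%:R.
  exists (Num.bound `|eta|) => // n /= hn.
  apply: (le_lt_trans (ler_norm _)); apply: (lt_le_trans (archi_boundP (normr_ge0 eta))).
  by rewrite ler_nat ltnW.
have dG t : cderive (fun s => cr (f s) * wave v s) t
    (cr (derive1 f t) * wave v t - (ci * cr v) * (cr (f t) * wave v t)).
  apply: cderive_eq; first exact: (cderiveM (cderive_cr (df t)) (cderive_wave v t)).
  by rewrite /=; ring.
have : cintegral setT (fun t => cr (derive1 f t) * wave v t - (ci * cr v) * (cr (f t) * wave v t)) = 0.
  apply: (@cintegral_improper_FTC0 _ (fun n => - n.+1%:R) (fun n => n.+1%:R) _
    (fun s => cr (f s) * wave v s) setT) => //.
  - by move=> n; apply: (@lt_trans _ _ 0); rewrite ?oppr_lt0 ltr0n.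
  - move=> x _; exists (Num.bound `|x|) => // n /= hn; rewrite -ler_norml.
    by apply/ltW; apply: (lt_le_trans (archi_boundP (normr_ge0 x))); rewrite ler_nat ltnW.
  - move=> t _; eexists; apply: cderiveB.
      exact: (cderiveM (cderive_cr (df' t)) (cderive_wave v t)).
    by apply: cderiveZ; exact: dG.
  - by move=> x /(_ Logic.I).
  - by apply: cintegrableB => //; exact: cintegrableZ.
  - apply: cvg_near_cst; apply: filterS big => n en; apply/eqP.
    by rewrite supf ?cr0 ?mul0r ?cabs0// normrN ger0_norm.
  - apply: cvg_near_cst; apply: filterS big => n en; apply/eqP.
    by rewrite supf ?cr0 ?mul0r ?cabs0// ger0_norm.
rewrite (cintegralB measurableT i2 (cintegrableZ (ci * cr v) measurableT i1)).
by rewrite (cintegralZ (ci * cr v) measurableT i1) => /eqP; rewrite subr_eq0 => /eqP.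
Qed.
End Compact.

Section Autocorrelation.
Variables (eta : R).
Hypothesis (e0 : 0 < eta).
Let psi := bump_fun eta.

Let spsi n : smooth_on setT n psi. Proof. exact: smooth_bump_fun. Qed.
Let cpsi : continuous psi. Proof. exact: smooth_continuous. Qed.
Let suppsi : supported eta psi. Proof. exact: supported_bump_fun. Qed.
Let ipsi : rintegrable setT psi. Proof. exact: rintegrable_supported suppsi. Qed.

(** The second factor is left free because differentiation in [t] falls on it alone; smoothness then
    follows by induction over [f]. *)
Definition autocorr_with f t : R := Rintegral mu setT (fun u => psi u * f (u + t)).

Lemma continuous_translate f t : continuous f -> continuous (fun u => f (u + t)).
Proof.
move=> cf u; apply: (@continuous_comp _ _ _ (fun u => u + t) f); last exact: cf.
by apply: continuousD; [exact: cvg_id | exact: cvg_cst].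
Qed.

Lemma rintegrable_autocorr f t : continuous f -> supported eta f ->
  rintegrable setT (fun u => psi u * f (u + t)).
Proof.
move=> cf supf; have [M M0 fM] := supported_bounded e0 cf supf.
apply: (@rintegrable_mul_bounded _ _ _ _ M) => //.
by apply: continuous_measurableT; exact: continuous_translate.
Qed.

Lemma is_derive_autocorr f t : (forall n, smooth_on setT n f) -> supported eta f ->
  is_derive t 1 (autocorr_with f) (autocorr_with (derive1 f) t).
Proof.
move=> sf supf; have cf := smooth_continuous sf.
have cf' := smooth_continuous (smooth_derive1 sf).
have [M M0 fM] := supported_bounded e0 cf' (supported_derive1 supf).
suff H : cderive (fun s => cintegral setT (fun u => cr (psi u * f (u + s)))) t
    (cintegral setT (fun u => cr (psi u * derive1 f (u + t)))) by have [] := H.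
apply: (@cderive_under_integral R setT (fun t u => cr (psi u * f (u + t)))
  (fun t u => cr (psi u * derive1 f (u + t))) t (t - 1) (t + 1) (fun u => M * psi u)) => //.
- by lra.
- move=> x _; split; first exact: rintegrable_autocorr.
  exact: integrable0.
- move=> x u _ _; apply: cderive_cr; apply: is_derive_scale.
  have h : is_derive x 1 (fun s => u + s) 1.
    by refine (is_derive_val (is_derive_add (is_derive_const u x) (is_derive_ident x)) _); rewrite add0r.
  refine (is_derive_val (is_derive_compose (f := f) (g := fun s => u + s) _ h) _); last by rewrite mulr1.
  by apply: derivable_is_derive1; have [k _] := sf 1%N; exact: k.
- move=> x u _ _; rewrite cabs_cr normrM mulrC [`|psi u|]ger0_norm ?bump_fun_ge0//.
  by rewrite ler_wpM2r// bump_fun_ge0.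
- by move=> u; rewrite mulr_ge0// bump_fun_ge0.
- exact: rintegrableZ.
Qed.

Lemma smooth_autocorr_with n f : (forall n, smooth_on setT n f) -> supported eta f ->
  smooth_on setT n (autocorr_with f).
Proof.
elim: n f => // n IH f sf supf.
apply: (@smooth_onS _ setT n _ (autocorr_with (derive1 f))); first exact: openT.
  by move=> t _; exact: is_derive_autocorr.
by apply: IH; [exact: smooth_derive1 | exact: supported_derive1].
Qed.

Definition autocorr t : R := autocorr_with psi t.

Lemma smooth_autocorr n : smooth_on setT n autocorr.
Proof. exact: smooth_autocorr_with. Qed.

Lemma bump_product0 u t : eta + eta < `|t| -> psi u * psi (u + t) = 0.
Proof.
move=> ht; have [ue|ue] := leP `|u| eta; last by rewrite suppsi// mul0r.
rewrite [psi (u + t)]suppsi ?mulr0//.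
have h : `|t| <= `|u + t| + `|u|.
  by have := ler_normB (u + t) u; rewrite addrAC subrr add0r.
lra.
Qed.

Lemma supported_autocorr : supported (eta + eta) autocorr.
Proof.
move=> t ht; rewrite /autocorr /autocorr_with.
rewrite (_ : (fun u => _) = (fun=> 0)); first by rewrite /Rintegral /= integral0.
by apply/funext => u; rewrite bump_product0.
Qed.

Definition bump_hat v : R[i] := cintegral setT (fun t => cr (psi t) * wave v t).
Definition pd_kernel v : R := cRe (bump_hat v) ^+ 2 + cIm (bump_hat v) ^+ 2.

Lemma pd_kernel_ge0 v : 0 <= pd_kernel v.
Proof. by rewrite addr_ge0// sqr_ge0. Qed.

(** Since [psi] is real, its transform at [-v] is the conjugate of its transform at [v]. *)
Lemma pd_kernelE v : cr (pd_kernel v) = bump_hat v * bump_hat (- v).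
Proof.
have : bump_hat (- v) = Complex (cRe (bump_hat v)) (- cIm (bump_hat v)).
  have wN t : wave (- v) t = Complex (cRe (wave v t)) (- cIm (wave v t)).
    by rewrite !waveE mulNr cosN sinN.
  have [_ i2] := cintegrable_wave v ipsi.
  apply: complex_ext.
    change (cRe (bump_hat (- v)) = cRe (bump_hat v)).
    by apply: eq_Rint => t _; rewrite /comp wN !cE /= !mul0r.
  change (cIm (bump_hat (- v)) = - cIm (bump_hat v)).
  transitivity (Rintegral mu setT (fun t => -1 * cIm (cr (psi t) * wave v t))).
    by apply: eq_Rint => t _; rewrite /comp wN !cE /= !mul0r; ring.
  by rewrite RintegralZl// mulN1r.
by move=> ->; rewrite /pd_kernel; case: (bump_hat v) => a b; apply: complex_ext; rewrite !cE /=; ring.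
Qed.

(** Fubini, then a translation of [t] by [u], under which the wave splits into [wave v t] and
    [wave (- v) u]. *)
Lemma fourier_autocorr v : cintegral setT (fun t => cr (autocorr t) * wave v t) = cr (pd_kernel v).
Proof.
have [M M0 pM] := supported_bounded e0 cpsi suppsi.
have mpsi : measurable_fun [set: T] (psi : T -> R) by exact: continuous_measurableT.
pose F u t := cr (psi u * psi (u + t)) * wave v t.
have ind := @rintegrable_indicator R (- (eta + eta)) (eta + eta).
have mF : cmeasurable setT (fun p : T * T => F p.1 p.2).
  apply: cmeasurableM.
    apply: cmeasurable_cr; apply: measurable_funM; first exact: (measurableT_comp mpsi measurable_fst).
    apply: (measurableT_comp mpsi).
    have : measurable_fun setT (fun p : T * T => (p.1 : R) + (p.2 : R)).
      by apply: measurable_funD; [exact: (measurableT_comp measurable_ident measurable_fst) | exact: (measurableT_comp measurable_ident measurable_snd)].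
    by [].
  have [w1 w2] := cmeasurable_wave v.
  by split; [exact: (measurableT_comp w1 measurable_snd) | exact: (measurableT_comp w2 measurable_snd)].
(* Both [u] and [u + t] must lie in the support, which confines [t] to [[-2 eta, 2 eta]] and yields
   a bound of product form. *)
have dom u t : cabs (F u t) <= psi u * (M * \1_(`[- (eta + eta), eta + eta]%classic) t).
  rewrite cabsM cabs_wave mulr1 cabs_cr.
  have [te|te] := leP `|t| (eta + eta); last first.
    rewrite bump_product0// normr0; apply: mulr_ge0; first exact: bump_fun_ge0.
    by apply: mulr_ge0 => //; rewrite indicE ler0n.
  rewrite normrM ger0_norm ?bump_fun_ge0//.
  by rewrite ler_wpM2l ?bump_fun_ge0// indicE mem_set ?mulr1//= in_itv/= -ler_norml.
have [_ _ Fub] := cFubini mF ipsi (rintegrableZ M measurableT ind) dom.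
transitivity (cintegral setT (fun t => cintegral setT (F ^~ t))).
  apply: eq_cintegral => t _.
  transitivity (cintegral setT (fun u => wave v t * cr (psi u * psi (u + t)))); last first.
    by apply: eq_cintegral => u _; rewrite mulrC.
  have hfu : cintegrable setT (fun u => cr (psi u * psi (u + t))).
    by split; [exact: rintegrable_autocorr | exact: integrable0].
  rewrite (cintegralZ (wave v t) measurableT hfu) mulrC; congr (_ * _).
  apply: complex_ext; first by [].
  by change (0 = Rintegral mu setT (fun=> 0)); rewrite /Rintegral integral0.
rewrite -Fub.
transitivity (cintegral setT (fun u => bump_hat v * (cr (psi u) * wave (- v) u))).
  apply: eq_cintegral => u _.
  pose h t := cr (psi t) * wave v (t - u).
  have hE : h = fun t => wave (- v) u * (cr (psi t) * wave v t).
    by apply/funext => t; rewrite /h waveB; ring.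
  have iw := cintegrable_wave v ipsi.
  have ih : cintegrable setT h.
    by rewrite hE; exact: cintegrableZ.
  have E1 : wave (- v) u * bump_hat v = cintegral setT (fun t => h (t + u)).
    by rewrite (cintegral_shift u ih) hE (cintegralZ _ measurableT iw).
  rewrite (_ : bump_hat v * _ = cr (psi u) * (wave (- v) u * bump_hat v)); last by ring.
  rewrite E1 -(cintegralZ _ measurableT (cintegrable_shift u ih)).
  by apply: eq_cintegral => t _; rewrite /F /h addrK crM [t + u]addrC mulrA.
rewrite (cintegralZ (bump_hat v) measurableT (cintegrable_wave (- v) ipsi)).
by rewrite pd_kernelE.
Qed.

End Autocorrelation.
End Kernel.

Section KernelPackage.
Context {R : realType}.
Local Notation mu := (@lebesgue_measure R).
Local Notation T := (measurableTypeR R).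
Implicit Types (x t u v y eta : R) (f : R -> R) (n : nat).

Lemma waveC v t : wave v t = wave t v.
Proof. by rewrite !waveE [t * v]mulrC. Qed.

Lemma rintegrable_cauchy : rintegrable setT (fun u : R => (1 + u ^+ 2)^-1).
Proof.
apply: (@rintegrable_antiderivative R (fun n => - n.+1%:R) (fun n => n.+1%:R) _ atan (pi / 2)).
- by move=> n; apply: (@lt_trans _ _ 0); rewrite ?oppr_lt0 ltr0n.
- by move=> m n mn; rewrite lerN2 !ler_nat.
- apply/seteqP; split => x // _; exists (Num.bound `|x|) => //=.
  rewrite in_itv/= -ler_norml; apply/ltW.
  by apply: (lt_le_trans (archi_boundP (normr_ge0 x))); rewrite ler_nat.
- move=> x _; apply: continuousV.
    by rewrite gt_eqF// ltr_pwDl// sqr_ge0.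
  apply: continuousD; first exact: cvg_cst.
  exact: exprn_continuous.
- by move=> x _; rewrite invr_ge0 addr_ge0// sqr_ge0.
- by move=> x _; rewrite ltW// ltr_norml atan_gtNpi2 atan_ltpi2.
Qed.

Lemma rintegrable_decay (K : R -> R) (A : R) : continuous K -> (forall v, 0 <= K v) ->
  (forall v, K v * (1 + v ^+ 2) ^+ 2 <= A) -> rintegrable setT K.
Proof.
move=> cK K0 KA; apply: (@rintegrable_le _ _ _ (fun v => A * (1 + v ^+ 2)^-1)) => //.
- exact: continuous_measurableT.
- move=> v _; rewrite ger0_norm//; have q0 : 0 < 1 + v ^+ 2 by rewrite ltr_pwDl// sqr_ge0.
  rewrite ler_pdivlMr//; apply: le_trans (KA v); rewrite ler_wpM2l//.
  by rewrite expr2 ler_peMr ?(ltW q0)// lerDl sqr_ge0.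
- by apply: rintegrableZ => //; exact: rintegrable_cauchy.
Qed.

Section Bump.
Variable eta : R.
Hypothesis e0 : 0 < eta.
Let psi := bump_fun eta.

Let spsi n : smooth_on setT n psi. Proof. exact: smooth_bump_fun. Qed.
Let cpsi : continuous psi. Proof. exact: smooth_continuous. Qed.
Let suppsi : supported eta psi. Proof. exact: supported_bump_fun. Qed.
Let ipsi : rintegrable setT psi. Proof. exact: rintegrable_supported suppsi. Qed.

(** Two integrations by parts bound [v^2] times the transform. After squaring, the kernel is O((1 +
    v^2)^(-2)) and can be integrated against [1 + v^2]. *)
Lemma bump_hat_decay : exists2 A, 0 <= A & forall v, cabs (bump_hat eta v) * (1 + v ^+ 2) <= A.
Proof.
have s1 := smooth_derive1 spsi; have s2 := smooth_derive1 s1.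
have p1 := supported_derive1 suppsi; have p2 := supported_derive1 p1.
have i2 := rintegrable_supported e0 (smooth_continuous s2) p2.
have a0 := rintegrable_abs measurableT ipsi; have a2 := rintegrable_abs measurableT i2.
exists (Rintegral mu setT (fun t => `|psi t|) + Rintegral mu setT (fun t => `|derive1 (derive1 psi) t|)).
  by rewrite addr_ge0//; apply: Rintegral_ge0.
move=> v; rewrite mulrDr mulr1; apply: lerD.
  apply: cabs_cintegral_le => //; first exact: cintegrable_wave.
  by move=> t _; rewrite cabsM cabs_cr cabs_wave mulr1.
have E : cintegral setT (fun t => cr (derive1 (derive1 psi) t) * wave v t) =
    (ci * cr v) * ((ci * cr v) * bump_hat eta v).
  by rewrite (fourier_derive1 e0 s1 p1) (fourier_derive1 e0 spsi suppsi).
have cci : cabs (ci : R[i]) = 1 by rewrite /cabs /= expr0n expr1n add0r sqrtr1.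
have -> : cabs (bump_hat eta v) * v ^+ 2 = cabs (cintegral setT (fun t => cr (derive1 (derive1 psi) t) * wave v t)).
  rewrite E !cabsM cci !cabs_cr !mul1r mulrA -expr2 mulrC.
  by rewrite -normrX ger0_norm ?sqr_ge0.
apply: cabs_cintegral_le => //; first exact: cintegrable_wave.
by move=> t _; rewrite cabsM cabs_cr cabs_wave mulr1.
Qed.

(** On the support [|t| <= eta], so [eta psi] dominates the differentiated integrand. The purpose is
    continuity of the kernel. *)
Lemma cderive_bump_hat v : exists l, cderive (bump_hat eta) v l.
Proof.
exists (cintegral setT (fun t => - (ci * cr t) * (cr (psi t) * wave v t))).
apply: (@cderive_under_integral R setT (fun v t => cr (psi t) * wave v t)
  (fun v t => - (ci * cr t) * (cr (psi t) * wave v t)) v (v - 1) (v + 1) (fun t => eta * psi t)) => //.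
- by lra.
- by move=> x _; exact: cintegrable_wave.
- move=> x t _ _; apply: cderive_eq.
    apply: cderiveZ; have := cderive_wave t x.
    rewrite (_ : wave t = fun s => wave s t); first by move=> h; exact: h.
    by apply/funext => s; exact: waveC.
  by rewrite mulrCA.
- move=> x t _ _; rewrite !cabsM cabsN cabsM !cabs_cr cabs_wave mulr1.
  rewrite (_ : cabs ci = 1) ?mul1r; last by rewrite /cabs /= expr0n expr1n add0r sqrtr1.
  rewrite [`|psi t|]ger0_norm ?bump_fun_ge0//.
  have [te|te] := leP `|t| eta; first by rewrite ler_wpM2r// bump_fun_ge0.
  by rewrite suppsi// !mulr0.
- by move=> t; rewrite mulr_ge0 ?bump_fun_ge0// ltW.
- exact: rintegrableZ.
Qed.

Lemma continuous_pd_kernel : continuous (pd_kernel eta).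
Proof.
move=> v; have [l [h1 h2]] := cderive_bump_hat v.
have h := is_derive_add (is_derive_mul h1 h1) (is_derive_mul h2 h2).
exact: (is_derive_continuous (f := pd_kernel eta) h).
Qed.

Lemma pd_kernel_gt0 : 0 < pd_kernel eta 0.
Proof.
rewrite /pd_kernel ltr_pwDl ?sqr_ge0// exprn_gt0//.
rewrite (_ : cRe _ = Rintegral mu setT psi).
  by apply: Rint_gt0 => //; [move=> t; exact: bump_fun_ge0 | exact: bump_fun_gt0].
apply: eq_Rint => t _; rewrite /comp waveE mul0r cos0 sin0 oppr0 !cE.
by rewrite /= mul0r subr0 mulr1.
Qed.
End Bump.

Definition modulate (phi : R -> R) y t : R[i] := cr (phi t) * cexp (ci * cr (y * t)).

Lemma modulateE phi y t : modulate phi y t = Complex (phi t * cos (y * t)) (phi t * sin (y * t)).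
Proof.
rewrite /modulate (_ : ci * cr (y * t) = Complex 0 (y * t)).
  by apply: complex_ext; rewrite !cE /= expR0 !mul1r mul0r ?subr0 ?addr0.
by apply: complex_ext; rewrite !cE /=; ring.
Qed.

Lemma positive_definite_test_functions (e : R) : 0 < e ->
  exists (phi K : R -> R) (A : R),
  [/\ continuous phi, supported (e / 2) phi,
      forall y, test_fun (- e) e (modulate phi y),
      forall v, cintegral setT (fun t => cr (phi t) * wave v t) = cr (K v) &
      [/\ continuous K, forall v, 0 <= K v, forall v, K v * (1 + v ^+ 2) ^+ 2 <= A & 0 < Rintegral mu setT K]].
Proof.
(* Autocorrelation doubles the support: with [eta = e / 4] it lies in [[-e/2, e/2]], strictly inside
   [(-e, e)]. *)
move=> e0; pose eta := e / 4; have eta0 : 0 < eta by rewrite divr_gt0.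
have e2 : eta + eta = e / 2 by rewrite /eta; field.
have [A A0 hA] := bump_hat_decay eta0.
have sphi n : smooth_on setT n (autocorr eta) by exact: smooth_autocorr.
have suphi : supported (e / 2) (autocorr eta) by rewrite -e2; exact: supported_autocorr.
have KA v : pd_kernel eta v * (1 + v ^+ 2) ^+ 2 <= A ^+ 2.
  have -> : pd_kernel eta v = cabs (bump_hat eta v) ^+ 2 by rewrite cabs_sqr.
  rewrite -exprMn lerXn2r ?nnegrE// mulr_ge0 ?cabs_ge0//.
  by rewrite addr_ge0// sqr_ge0.
exists (autocorr eta), (pd_kernel eta), (A ^+ 2); split => //.
- exact: smooth_continuous.
- move=> y; have sm n := smooth_on_cos_sin y n.
  split; [|split].
  + apply: smooth_real_of => n; apply: (@smooth_on_ext _ setT n (fun t => autocorr eta t * cos (y * t))).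
    * exact: openT.
    * by move=> t _; rewrite /comp modulateE.
    * by apply: smooth_on_mul; [exact: openT | exact: sphi | case: (sm n)].
  + apply: smooth_real_of => n; apply: (@smooth_on_ext _ setT n (fun t => autocorr eta t * sin (y * t))).
    * exact: openT.
    * by move=> t _; rewrite /comp modulateE.
    * by apply: smooth_on_mul; [exact: openT | exact: sphi | case: (sm n)].
  + exists (- (e / 2)), (e / 2); split; first by lra.
    split; first by lra.
    move=> t ht; rewrite /modulate suphi ?cr0 ?mul0r//.
    case: ht => ht; first by rewrite ltr0_norm; lra.
    by rewrite ger0_norm; lra.
- by move=> v; exact: fourier_autocorr.
- split => //.
  + exact: continuous_pd_kernel.
  + by move=> v; exact: pd_kernel_ge0.
  + apply: Rint_gt0; [exact: continuous_pd_kernel|move=> v; exact: pd_kernel_ge0|exact: pd_kernel_gt0|].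
    apply: (@rintegrable_decay (pd_kernel eta) (A ^+ 2)) => //; first exact: continuous_pd_kernel.
    by move=> v; exact: pd_kernel_ge0.
Qed.

Lemma fourier_modulate (phi K : R -> R) y xi :
  (forall v, cintegral setT (fun t => cr (phi t) * wave v t) = cr (K v)) ->
  fourier (modulate phi y) xi = cr (K (xi - y)).
Proof.
move=> h; rewrite -h; apply: eq_cintegral => t _.
by rewrite waveBl /modulate mulrCA.
Qed.
End KernelPackage.

(** * The Tauberian argument on the real line *)
Section BoundedDecrease.
Context {R : realType}.
Implicit Types (f : R -> R).

(** Each step of length at most [d] loses at most [M]. The number of steps from [x] to [y] is at
    most [1 + (y - x) / d], hence at most [(1 + 1/d) (1 + (y - x))]. *)
Lemma boundedly_decreasing_linear f : boundedly_decreasing_real f ->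
  exists M X, [/\ 0 <= M, 0 <= X & forall x y, X <= x -> x <= y -> f x - M * (1 + (y - x)) <= f y].
Proof.
move=> [d [d0 [M0 [X0 H]]]].
pose M := Num.max M0 0; pose X := Num.max X0 0.
have M_ge0 : 0 <= M by rewrite le_max lexx orbT.
have M_geM0 : M0 <= M by rewrite le_max lexx.
have X_ge0 : 0 <= X by rewrite le_max lexx orbT.
have X_geX0 : X0 <= X by rewrite le_max lexx.
have step n x y : X <= x -> x <= y -> y - x <= n.+1%:R * d -> f x - n.+1%:R * M <= f y.
  elim: n x => [|n IH] x Xx xy yx.
    have hd : 0 <= y - x <= d by rewrite subr_ge0 xy -[leRHS]mul1r.
    by have := H x (y - x) (le_trans X_geX0 Xx) hd; rewrite subrKC mul1r; lra.
  have [yxd|yxd] := leP (y - x) d.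
    have hd : 0 <= y - x <= d by rewrite subr_ge0 xy.
    have := H x (y - x) (le_trans X_geX0 Xx) hd; rewrite subrKC => h.
    have : M <= n.+2%:R * M by rewrite ler_peMl// ler1n.
    lra.
  have hd : 0 <= d <= d by rewrite lexx ltW.
  have h1 := H x d (le_trans X_geX0 Xx) hd.
  have xdy : x + d <= y by lra.
  have Xxd : X <= x + d by lra.
  have := IH (x + d) Xxd xdy.
  rewrite -[n.+2%:R]natr1 in yx *; rewrite !mulrDl !mul1r in yx *.
  have yxd2 : y - (x + d) <= n.+1%:R * d by lra.
  move=> /(_ yxd2); lra.
exists (M * (1 + d^-1)), X; split => //.
  by rewrite mulr_ge0// addr_ge0// invr_ge0 ltW.
move=> x y Xx xy; pose n := Num.truncn ((y - x) / d).
have yx0 : 0 <= y - x by rewrite subr_ge0.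
have q0 : 0 <= (y - x) / d by rewrite divr_ge0// ltW.
have /andP[n1 n2] := truncn_itv q0.
have h1 : y - x <= n.+1%:R * d by rewrite -ler_pdivrMr// ltW.
apply: le_trans (step n x y Xx xy h1); rewrite lerD2l lerN2.
rewrite -mulrA [leRHS]mulrC ler_wpM2r//.
apply: (@le_trans _ _ (1 + (y - x) / d)); first by rewrite -natr1 addrC lerD2l.
have r0 : 0 <= d^-1 by rewrite invr_ge0 ltW.
move: (d^-1) r0 (y - x) yx0 => r r0 h h0.
by rewrite -subr_ge0 (_ : _ - _ = r + h) ?addr_ge0//; ring.
Qed.
End BoundedDecrease.

Section Tauberian.
(** Linear growth measured from the origin is absorbed by the quadratic weight centred at [y],
    against which [K (x - y)] is integrable. *)
Lemma linear_growth_shift (R : realType) (x y : R) :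
  1 + x <= 2 * (1 + `|y|) * (1 + (x - y) ^+ 2).
Proof.
have h1 := ler_norm y; have a0 := normr_ge0 y.
have h2 : x - y <= 1 + (x - y) ^+ 2.
  have := sqr_ge0 (x - y - 2^-1); rewrite sqrrB; move: (x - y) => u; lra.
have h3 : 0 <= `|y| * (x - y) ^+ 2 by rewrite mulr_ge0// sqr_ge0.
have h4 := sqr_ge0 (x - y).
move: `|y| ((x - y) ^+ 2) h1 a0 h2 h3 h4 => a w h1 a0 h2 h3 h4.
rewrite mulrDr mulr1 mulrDr mulr1 mulrDl -[2 * a * w]mulrA; lra.
Qed.

Context {R : realType}.
Local Notation mu := (@lebesgue_measure R).
Local Notation T := (measurableTypeR R).
Variables (f K : R -> R) (A M X M' : R).
Hypotheses (cK : continuous K) (K0 : forall v, 0 <= K v)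
  (KA : forall v, K v * (1 + v ^+ 2) ^+ 2 <= A) (Kpos : 0 < Rintegral mu setT K).
Hypotheses (mf : measurable_fun [set: T] (f : T -> R)) (f0 : forall x, x < 0 -> f x = 0)
  (if_ : forall sg, 0 < sg -> rintegrable setT (fun x => f x * expR (- sg * x))).
Hypotheses (M0 : 0 <= M) (X0 : 0 <= X)
  (fM : forall x y, X <= x -> x <= y -> f x - M * (1 + (y - x)) <= f y).
Hypothesis (fK : forall y, \forall sg \near (0 : R)^'+,
  `|Rintegral mu setT (fun x => f x * expR (- sg * x) * K (x - y))| <= M').
Implicit Types (x y z u v sg : R).

Let q1 v : 1 <= 1 + v ^+ 2. Proof. by rewrite lerDl sqr_ge0. Qed.
Let q0 v : 0 < 1 + v ^+ 2. Proof. exact: lt_le_trans (q1 v). Qed.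

Let A0 : 0 <= A.
Proof. by apply: le_trans (KA 0); rewrite mulr_ge0// exprn_ge0// ltW. Qed.

Let K_le_A v : K v <= A.
Proof.
apply: le_trans (KA v); rewrite ler_peMr// -[leLHS](expr1n _ 2) lerXn2r ?nnegrE//.
exact: ltW.
Qed.

Let K2_bound v : (1 + v ^+ 2) * K v <= A * (1 + v ^+ 2)^-1.
Proof. by rewrite ler_pdivlMr// mulrAC mulrC -expr2. Qed.

Let mK : measurable_fun [set: T] (K : T -> R).
Proof. exact: continuous_measurableT. Qed.

Let msq : measurable_fun [set: T] (fun v : T => 1 + v ^+ 2 : R).
Proof.
have : continuous (fun v : R => 1 + v ^+ 2).
  by move=> v; apply: cvgD; [exact: cvg_cst | exact: exprn_continuous].
exact: continuous_measurableT.
Qed.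

Let iK2 : rintegrable setT (fun v => (1 + v ^+ 2) * K v).
Proof.
apply: (@rintegrable_le _ _ _ (fun v => A * (1 + v ^+ 2)^-1)) => //.
- exact: measurable_funM.
- by move=> v _; rewrite ger0_norm ?K2_bound// mulr_ge0// ltW.
- by apply: rintegrableZ => //; exact: rintegrable_cauchy.
Qed.

Let iK : rintegrable setT K.
Proof. exact: rintegrable_decay KA. Qed.

Let k0 := Rintegral mu setT K.
Let k2 := Rintegral mu setT (fun v => (1 + v ^+ 2) * K v).
Let k2_ge0 : 0 <= k2.
Proof. by apply: Rintegral_ge0 => v _; rewrite mulr_ge0// ltW. Qed.

Let iKz z : rintegrable setT (fun x => K (x - z)) /\ Rintegral mu setT (fun x => K (x - z)) = k0.
Proof. exact: (rintegrable_shift (- z) iK). Qed.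

Let iK2z z : rintegrable setT (fun x => (1 + (x - z) ^+ 2) * K (x - z)) /\
  Rintegral mu setT (fun x => (1 + (x - z) ^+ 2) * K (x - z)) = k2.
Proof. exact: (rintegrable_shift (- z) iK2). Qed.

Let mKz z : measurable_fun [set: T] (fun x : T => K (x - z)).
Proof. by have [h _] := iKz z; exact: rintegrable_meas h. Qed.

(** Bounded decrease is effective from [X] on, so [f] is cut there. The piece [f2], living on
    [[0, X)], is integrable and changes the pairing by at most [A L], the difference between [M1]
    and [M']. *)
Let f1 x := if X <= x then f x else 0.
Let f2 x := if X <= x then 0 else f x.

Let mX : measurable_fun [set: T] (fun x : T => X <= x).
Proof.
have : measurable_fun setT (fun x : R => X <= x) by exact: measurable_fun_ler.
by [].
Qed.
Let mf1 : measurable_fun [set: T] (f1 : T -> R).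
Proof. exact: measurable_fun_ifT. Qed.
Let mf2 : measurable_fun [set: T] (f2 : T -> R).
Proof. exact: measurable_fun_ifT. Qed.

Let if2 : rintegrable setT f2.
Proof.
(* Before [X] the factor [e^(X - x)] is at least 1, so [f e^(-x)], integrable by [if_] at [sg = 1],
   provides the majorant. *)
apply: (@rintegrable_le _ _ _ (fun x => expR X * `|f x * expR (- 1 * x)|)) => //.
- move=> x _; rewrite normrM mulrCA [`|expR _|]ger0_norm ?expR_ge0// -expRD.
  rewrite /f2; case: ifPn => [_|]; first by rewrite normr0 mulr_ge0 ?expR_ge0.
  rewrite -ltNge => xX; rewrite ler_peMr//.
  apply: (@le_trans _ _ (expR 0)); first by rewrite expR0.
  by rewrite ler_expR; lra.
- by apply: rintegrableZ => //; apply: rintegrable_abs => //; exact: if_.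
Qed.

Let L := Rintegral mu setT (fun x => `|f2 x|).
Let M1 := M' + A * L.
Let C := `|f X| + M.
Let C0 : 0 <= C. Proof. by rewrite addr_ge0. Qed.
Let L0 : 0 <= L. Proof. exact: Rintegral_ge0. Qed.
Let M'0 : 0 <= M'.
Proof.
have h := fK 0.
have [sg hsg] := @filter_ex _ _ _ _ h; exact: le_trans hsg.
Qed.
Let M10 : 0 <= M1. Proof. by rewrite addr_ge0// mulr_ge0. Qed.

Let f_lower x : X <= x -> - (C * (1 + x)) <= f x.
Proof.
move=> Xx; have := fM (lexx X) Xx; have := ler_norm (- f X); rewrite normrN => h1 h2.
have h3 : 0 <= `|f X| * x by rewrite mulr_ge0// (le_trans X0).
have h4 : 0 <= M * X by rewrite mulr_ge0.
rewrite /C; lra.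
Qed.

Let exp_le1 sg x : 0 <= sg -> 0 <= x -> expR (- sg * x) <= 1.
Proof. by move=> s0 x0; rewrite -expR0 ler_expR mulNr oppr_le0 mulr_ge0. Qed.

Let mexp sg : measurable_fun [set: T] (fun x : T => expR (- sg * x)).
Proof.
have : continuous (fun x : R => expR (- sg * x)).
  move=> x; have h := is_derive_compose (f := @expR R) (g := fun t => - sg * t)
    (is_derive_expR _) (is_derive_scale (- sg) (is_derive_ident x)).
  exact: (is_derive_continuous h).
exact: continuous_measurableT.
Qed.

(** The correction that makes [f1 + qf] nonnegative, as Fatou's lemma requires. *)
Let qf x := if X <= x then C * (1 + x) else 0.
Let mqf : measurable_fun [set: T] (qf : T -> R).
Proof.
apply: measurable_fun_ifT => //.
have : continuous (fun x : R => C * (1 + x)).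
  move=> x; apply: cvgM; first exact: cvg_cst.
  by apply: cvgD; [exact: cvg_cst | exact: cvg_id].
exact: continuous_measurableT.
Qed.
Let qf0 x : 0 <= qf x.
Proof. by rewrite /qf; case: ifPn => // Xx; rewrite mulr_ge0// addr_ge0// (le_trans X0). Qed.
Let f1qf x : 0 <= f1 x + qf x.
Proof.
rewrite /f1 /qf; case: ifPn => [Xx|]; last by rewrite addr0.
by have := f_lower Xx; lra.
Qed.

Let iqK y : rintegrable setT (fun x => qf x * K (x - y)).
Proof.
have [h _] := iK2z y.
apply: (@rintegrable_le _ _ _ (fun x => C * (2 * (1 + `|y|)) * ((1 + (x - y) ^+ 2) * K (x - y)))) => //.
- exact: measurable_funM.
- move=> x _; rewrite ger0_norm ?mulr_ge0// [leRHS]mulrA ler_wpM2r//.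
  rewrite /qf; case: ifPn => [Xx|_]; last by rewrite !mulr_ge0// addr_ge0// sqr_ge0.
  rewrite -[leRHS]mulrA ler_wpM2l//; exact: linear_growth_shift.
- exact: rintegrableZ.
Qed.

(** Fatou's lemma supplies the integrability of [f1 K]; the bound with both signs then follows by
    dominated convergence, with [|f1 K|] as the majorant that has just become available. *)
Lemma truncated_pairing y : rintegrable setT (fun x => f1 x * K (x - y)) /\
  `|Rintegral mu setT (fun x => f1 x * K (x - y))| <= M1.
Proof.
have [N _ hN] : \forall n \near \oo, `|Rintegral mu setT (fun x => f x * expR (- (n.+1%:R)^-1 * x) * K (x - y))| <= M'.
  have [e /= e0 he] := fK y.
  have /cvgr0Pnorm_lt /(_ _ e0) := @cvg_invn R; apply: filterS => n hn.
  by apply: he; rewrite /= ?sub0r ?normrN// invr_gt0 ltr0n.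
(* The offset [N] makes the bound of [fK] for this [y] hold at every index. *)
pose s n : R := ((n + N).+1%:R)^-1.
have s0 n : 0 < s n by rewrite invr_gt0 ltr0n.
have sM n : `|Rintegral mu setT (fun x => f x * expR (- s n * x) * K (x - y))| <= M'.
  by apply: hN => /=; exact: leq_addl.
have s_cvg : s n @[n --> \oo] --> (0 : R).
  have := @cvg_invn R; rewrite -(cvg_shiftn N (fun n => (n.+1%:R : R)^-1)).
  by apply.
have e_cvg x : expR (- s n * x) @[n --> \oo] --> (1 : R).
  have -> : (1 : R) = expR (- 0 * x) by rewrite oppr0 mul0r expR0.
  have h : - s n * x @[n --> \oo] --> - 0 * x.
    by apply: cvgM; [exact: cvgN | exact: cvg_cst].
  have := continuous_cvg _ (@continuous_expR R (- 0 * x)) h.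
  by move=> k; exact: k.
have iexp n (g : R -> R) : measurable_fun [set: T] (g : T -> R) -> rintegrable setT g ->
    (forall x, x < 0 -> g x = 0) -> rintegrable setT (fun x => g x * expR (- s n * x)).
  move=> mg ig g0; apply: (@rintegrable_le _ _ _ (fun x => `|g x|)) => //.
  - exact: measurable_funM.
  - move=> x _; have [x0|x0] := leP 0 x; last by rewrite g0// mul0r normr0.
    by rewrite normrM ler_piMr// ger0_norm ?expR_ge0// exp_le1// ltW.
  - exact: rintegrable_abs.
have f10 x : x < 0 -> f1 x = 0.
  by move=> x0; rewrite /f1; case: ifPn => // _; exact: f0.
have f20 x : x < 0 -> f2 x = 0.
  by move=> x0; rewrite /f2; case: ifPn => // _; exact: f0.
have KB x : `|K (x - y)| <= A by rewrite ger0_norm.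
have i2 n : rintegrable setT (fun x => f2 x * expR (- s n * x) * K (x - y)).
  by apply: (rintegrable_mul_bounded _ (iexp n _ mf2 if2 f20) (mKz y)).
have b2 n : `|Rintegral mu setT (fun x => f2 x * expR (- s n * x) * K (x - y))| <= A * L.
  rewrite /L -RintegralZl//; last exact: rintegrable_abs.
  apply: abs_Rint_le => //; first by apply: rintegrableZ => //; exact: rintegrable_abs.
  move=> x _; have [x0|x0] := leP 0 x; last by rewrite f20// !mul0r !normr0 mulr0.
  rewrite 2!normrM [leLHS]mulrC; apply: ler_pM => //; try exact: mulr_ge0.
  by rewrite ler_piMr// ger0_norm ?expR_ge0// exp_le1// ltW.
have iF n : rintegrable setT (fun x => f x * expR (- s n * x) * K (x - y)).
  by apply: (rintegrable_mul_bounded _ (if_ (s0 n)) (mKz y)).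
have fE x : f x = f1 x + f2 x.
  by rewrite /f1 /f2; case: ifPn; rewrite ?addr0 ?add0r.
have i1 n : rintegrable setT (fun x => f1 x * expR (- s n * x) * K (x - y)).
  have := rintegrableB measurableT (iF n) (i2 n).
  by apply: eq_rintegrable => // x _; rewrite fE; ring.
have b1 n : `|Rintegral mu setT (fun x => f1 x * expR (- s n * x) * K (x - y))| <= M1.
  have E : Rintegral mu setT (fun x => f1 x * expR (- s n * x) * K (x - y)) =
    Rintegral mu setT (fun x => f x * expR (- s n * x) * K (x - y)) -
    Rintegral mu setT (fun x => f2 x * expR (- s n * x) * K (x - y)).
    rewrite -(RintegralB measurableT (iF n) (i2 n)).
    by apply: eq_Rint => x _; rewrite fE; ring.
  by rewrite E; apply: (le_trans (ler_normB _ _)); apply: lerD.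
pose g n x := (f1 x + qf x) * expR (- s n * x) * K (x - y).
have iq n : rintegrable setT (fun x => qf x * K (x - y) * expR (- s n * x)).
  apply: iexp; [exact: measurable_funM | exact: iqK |].
  by move=> x x0; rewrite /qf leNgt (lt_le_trans x0)// mul0r.
have gE n x : g n x = f1 x * expR (- s n * x) * K (x - y) + qf x * K (x - y) * expR (- s n * x).
  by rewrite /g; ring.
have ig n : rintegrable setT (g n).
  have := rintegrableD measurableT (i1 n) (iq n).
  by apply: eq_rintegrable => // x _; rewrite gE.
have gcv x : setT x -> g n x @[n --> \oo] --> (f1 x + qf x) * K (x - y).
  move=> _; have -> : (f1 x + qf x) * K (x - y) = (f1 x + qf x) * 1 * K (x - y) by rewrite mulr1.
  apply: cvgM; last exact: cvg_cst.
  by apply: cvgM; [exact: cvg_cst | exact: e_cvg].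
have gB n : Rintegral mu setT (g n) <= M1 + Rintegral mu setT (fun x => qf x * K (x - y)).
  have -> : Rintegral mu setT (g n) = Rintegral mu setT (fun x => f1 x * expR (- s n * x) * K (x - y)) +
      Rintegral mu setT (fun x => qf x * K (x - y) * expR (- s n * x)).
    by rewrite -(RintegralD measurableT (i1 n) (iq n)); apply: eq_Rint => x _; exact: gE.
  apply: lerD; first by apply: le_trans (b1 n); exact: ler_norm.
  apply: (le_Rint measurableT (iq n) (iqK y)) => x _.
  have [x0|x0] := leP 0 x; last by rewrite (_ : qf x = 0) ?mul0r// /qf (lt_geF (lt_le_trans x0 X0)).
  by rewrite ler_piMr ?mulr_ge0// exp_le1// ltW.
have g0 n x : setT x -> 0 <= g n x by move=> _; rewrite !mulr_ge0// expR_ge0.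
have mlim : measurable_fun [set: T] (fun x : T => (f1 x + qf x) * K (x - y)).
  by apply: measurable_funM => //; exact: measurable_funD.
have [ifq _] := rintegrable_fatou measurableT ig mlim g0 gcv gB.
have if1K : rintegrable setT (fun x => f1 x * K (x - y)).
  have := rintegrableB measurableT ifq (iqK y).
  by apply: eq_rintegrable => // x _; ring.
split => //.
have [_ lim1] : rintegrable setT (fun x => f1 x * K (x - y)) /\
   Rintegral mu setT (fun x => f1 x * expR (- s n * x) * K (x - y)) @[n --> \oo]
   --> Rintegral mu setT (fun x => f1 x * K (x - y)).
  apply: (@rintegrable_dominated _ (fun n x => f1 x * expR (- s n * x) * K (x - y))
    (fun x => f1 x * K (x - y)) (fun x => `|f1 x * K (x - y)|) setT) => //.
  - by move=> n; exact: rintegrable_meas (i1 n).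
  - exact: measurable_funM.
  - move=> x _; have -> : f1 x * K (x - y) = f1 x * 1 * K (x - y) by rewrite mulr1.
    apply: cvgM; last exact: cvg_cst.
    by apply: cvgM; [exact: cvg_cst | exact: e_cvg].
  - move=> n x _; have [x0|x0] := leP 0 x; last by rewrite f10// !mul0r.
    by rewrite !normrM mulrAC ler_piMr ?mulr_ge0// ger0_norm ?expR_ge0// exp_le1// ltW.
  - exact: rintegrable_abs.
rewrite ler_norml; apply/andP; split.
- apply: (cvgr_to_ge lim1); apply: nearW => n.
  by have := b1 n; rewrite ler_norml => /andP[].
- apply: (cvgr_to_le lim1); apply: nearW => n.
  by have := b1 n; rewrite ler_norml => /andP[].
Qed.

(** Comparison with a constant minus a multiple of the quadratic weight turns the pairing bound into
    an inequality between numbers, since [K] and the weighted [K] integrate to [k0] and [k2] around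
    any centre. *)
Lemma pairing_lower (a b z : R) : (forall x, a - b * (1 + (x - z) ^+ 2) <= f1 x) ->
  a * k0 - b * k2 <= M1.
Proof.
move=> h; have [if1 b1] := truncated_pairing z.
have [i0 e0] := iKz z; have [i2 e2] := iK2z z.
have -> : a * k0 - b * k2 = Rintegral mu setT (fun x => a * K (x - z) - b * ((1 + (x - z) ^+ 2) * K (x - z))).
  rewrite (RintegralB measurableT (rintegrableZ a measurableT i0) (rintegrableZ b measurableT i2)).
  by rewrite (RintegralZl a measurableT i0) (RintegralZl b measurableT i2) e0 e2.
apply: le_trans (le_trans (ler_norm _) b1).
apply: (le_Rint measurableT _ if1).
  by apply: rintegrableB => //; exact: rintegrableZ.
by move=> x _; rewrite mulrA -mulrBl ler_wpM2r.
Qed.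

Lemma pairing_upper (a b z : R) : (forall x, f1 x <= a + b * (1 + (x - z) ^+ 2)) ->
  - M1 <= a * k0 + b * k2.
Proof.
move=> h; have [if1 b1] := truncated_pairing z.
have [i0 e0] := iKz z; have [i2 e2] := iK2z z.
have -> : a * k0 + b * k2 = Rintegral mu setT (fun x => a * K (x - z) + b * ((1 + (x - z) ^+ 2) * K (x - z))).
  rewrite (RintegralD measurableT (rintegrableZ a measurableT i0) (rintegrableZ b measurableT i2)).
  by rewrite (RintegralZl a measurableT i0) (RintegralZl b measurableT i2) e0 e2.
have : - M1 <= Rintegral mu setT (fun x => f1 x * K (x - z)).
  by move: b1; rewrite ler_norml => /andP[].
move=> /le_trans; apply; apply: (le_Rint measurableT if1).
  by apply: rintegrableD => //; exact: rintegrableZ.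
by move=> x _; rewrite mulrA -mulrDl ler_wpM2r.
Qed.

(* [B] is so large that [K] carries little mass beyond distance [B]: [12 k2 / B <= k0]. *)
Let B := 1 + 12 * k2 / k0.
Let k0_gt0 : 0 < k0. Proof. exact: Kpos. Qed.
Let B1 : 1 <= B.
Proof. by rewrite lerDl divr_ge0 ?(ltW k0_gt0)// mulr_ge0. Qed.
Let B0 : 0 < B. Proof. exact: lt_le_trans B1. Qed.
Let k2B : 12 * (k2 / B) <= k0.
Proof.
rewrite mulrA ler_pdivrMr// /B mulrDr mulr1 mulrCA divff ?gt_eqF// mulr1.
by rewrite lerDr ltW.
Qed.
Let f1E x : X <= x -> f1 x = f x. Proof. by rewrite /f1 => ->. Qed.
Let f1_out x : x < X -> f1 x = 0. Proof. by rewrite /f1 leNgt => ->. Qed.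

Let square_ge u : B <= `|u| -> B * `|u| <= u ^+ 2.
Proof. by move=> Bu; rewrite -[u ^+ 2]ger0_norm ?sqr_ge0// normrX expr2 ler_wpM2r. Qed.

(** The loss that bounded decrease permits over a distance [d <= B + |u|], absorbed by the quadratic
    weight. *)
Let drift u (d : R) : d <= B + `|u| -> M * (1 + d) <= 2 * M * (1 + B) * (1 + u ^+ 2).
Proof.
move=> dB.
rewrite (_ : 2 * M * (1 + B) * (1 + u ^+ 2) = M * (2 + 2 * u ^+ 2 + 2 * B + 2 * (B * u ^+ 2))); last by ring.
rewrite ler_wpM2l//.
have h1 : `|u| <= 1 + u ^+ 2.
  have := sqr_ge0 (`|u| - 2^-1); rewrite sqrrB -normrX ger0_norm ?sqr_ge0//; lra.
have h2 : 0 <= B * u ^+ 2 by rewrite mulr_ge0 ?(ltW B0)// sqr_ge0.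
have h3 := sqr_ge0 u; have := B0; lra.
Qed.

Let B1_ge0 : 0 <= 1 + B. Proof. by rewrite addr_ge0// ltW. Qed.
Let drift_ge0 u : 0 <= 2 * M * (1 + B) * (1 + u ^+ 2).
Proof. have hu := ltW (q0 u); by rewrite !mulr_ge0. Qed.
Let MB_ge0 : 0 <= 2 * M * (1 + B) * k2.
Proof. by rewrite !mulr_ge0. Qed.
Let k0_ge0 : 0 <= k0. Proof. exact: ltW. Qed.
Let B_ge0 : 0 <= B. Proof. exact: ltW. Qed.

Let growth_const := 2 / k0 * (M1 + 2 * M * (1 + B) * k2 + C * k2).

Let gc0 : 0 <= growth_const.
Proof. by apply: mulr_ge0; [exact: divr_ge0 | rewrite !addr_ge0// mulr_ge0]. Qed.

(** A crude first use of the pairing, which will make the weighted supremum in [tauberian_bound]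
    finite. With [K] centred at [y + B], points left of [y] are farther than [B] from the centre,
    and [f_lower] is enough there. *)
Lemma tauberian_growth y : X <= y -> f y <= growth_const * (1 + y).
Proof.
move=> Xy; have y0 : 0 <= y by exact: le_trans Xy.
have Bp := B_ge0.
have [fy0|fy0] := leP (f y) 0.
  by apply: (le_trans fy0); rewrite mulr_ge0// addr_ge0.
(* The summands pay, in turn, for the missing [f y] left of [y], for the drift right of [y], and for
   the lower bound [- C (1 + y)] left of [y]. *)
pose b := f y / B + 2 * M * (1 + B) + C * (1 + y).
have H x : f y - b * (1 + (x - (y + B)) ^+ 2) <= f1 x.
  set u := x - (y + B); have uE : x = u + y + B by rewrite /u; ring.
  have D0 := drift_ge0 u.
  have Cy1 : 0 <= C * (1 + y) by rewrite mulr_ge0// addr_ge0.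
  have Cy0 : 0 <= C * (1 + y) * (u ^+ 2) by rewrite mulr_ge0// sqr_ge0.
  have fB0 : 0 <= f y / B * (1 + u ^+ 2).
    by apply: mulr_ge0; [apply: divr_ge0 => //; exact: ltW | exact: ltW].
  have bE : b * (1 + u ^+ 2) = f y / B * (1 + u ^+ 2) + 2 * M * (1 + B) * (1 + u ^+ 2) + C * (1 + y) + C * (1 + y) * u ^+ 2.
    by rewrite /b; ring.
  have [xy|xy] := leP y x.
    have Xx : X <= x by exact: le_trans Xy xy.
    rewrite (f1E Xx) bE; have := fM Xy xy.
    have : x - y <= B + `|u| by have := ler_norm u; lra.
    by move=> /drift; lra.
  have uB : B <= `|u| by rewrite ler0_norm; lra.
  have fyu : f y <= f y / B * (1 + u ^+ 2).
    rewrite mulrAC -mulrA ler_peMr ?(ltW fy0)// ler_pdivlMr// mul1r.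
    apply: (@le_trans _ _ (B * `|u|)); first by rewrite ler_peMr ?(ltW B0)// (le_trans B1).
    by apply: (le_trans (square_ge uB)); rewrite lerDr.
  rewrite bE; have [Xx|xX] := leP X x; last by rewrite (f1_out xX); lra.
  rewrite (f1E Xx); have := f_lower Xx.
  have : C * (1 + x) <= C * (1 + y) by rewrite ler_wpM2l// lerD2l ltW.
  lra.
have := pairing_lower H.
have E : f y * k0 - b * k2 = f y * (k0 - k2 / B) - (2 * M * (1 + B) * k2 + C * (1 + y) * k2).
  by rewrite /b; ring.
rewrite E => h.
have kk : k0 / 2 <= k0 - k2 / B by have := k2B; have := k0_gt0; lra.
have h2 : f y * (k0 / 2) <= f y * (k0 - k2 / B) by rewrite ler_wpM2l// ltW.
have h3 : f y * (k0 / 2) <= (M1 + 2 * M * (1 + B) * k2 + C * k2) * (1 + y).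
  have p1 : 0 <= M1 * y by rewrite mulr_ge0.
  have p2 : 0 <= 2 * M * (1 + B) * k2 * y by exact: mulr_ge0.
  rewrite (_ : _ * (1 + y) = M1 + M1 * y + 2 * M * (1 + B) * k2 + 2 * M * (1 + B) * k2 * y + C * (1 + y) * k2); last by ring.
  lra.
rewrite /growth_const -mulrA -(ler_pM2l k0_gt0).
rewrite (_ : k0 * (2 / k0 * _) = 2 * ((M1 + 2 * M * (1 + B) * k2 + C * k2) * (1 + y))); last first.
  by field; rewrite gt_eqF.
lra.
Qed.

(** The first summand comes from the pairing. The second covers negative values at [y < X + 2 B],
    where the centre [y - B] would be too close to the cut at [X]. *)
Let bound_const := 4 / k0 * (M1 + 2 * M * (1 + B) * k2) + 2 * (C * (1 + X + 2 * B)).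

Let bc1 : 0 <= 4 / k0 * (M1 + 2 * M * (1 + B) * k2).
Proof. by apply: mulr_ge0; [exact: divr_ge0 | exact: addr_ge0]. Qed.
Let bc2 : 0 <= 2 * (C * (1 + X + 2 * B)).
Proof. by rewrite !mulr_ge0// !addr_ge0// mulr_ge0. Qed.

(* Centring [K] at [y + B] if [f y > 0] and at [y - B] if [f y < 0], bounded decrease keeps [f]
   away from 0 where [K] has most of its mass, and the weighted bound controls the other side. *)
Let main_bound S eps y : 0 < eps <= 1 -> 0 < S -> X <= y ->
  (forall x, X <= x -> `|f x| <= S * (1 + eps * x)) ->
  S / 2 * (1 + eps * y) <= `|f y| -> S <= bound_const.
Proof.
have Bp := B_ge0; have B1' := B1.
move=> /andP[e0 e1] S0 Xy Sx Sy; have y0 : 0 <= y by exact: le_trans Xy.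
have ey0 : 0 <= eps * y by rewrite mulr_ge0// ltW.
set W := S * (1 + eps * y).
have SW : S <= W by rewrite ler_peMr ?(ltW S0)// lerDl.
have W0 : 0 < W by exact: lt_le_trans SW.
have Wy : W / 2 <= `|f y| by move: Sy; rewrite mulrAC.
have WB0 : 0 <= W / B by rewrite divr_ge0// ltW.
have t1 := bc1; have t2 := bc2.
(* The target value contributes [W k0 / 2], and the far mass costs [3 W k2 / B <= W k0 / 4]; a
   quarter of [W k0] remains. *)
have fin : W / 4 * k0 <= M1 + 2 * M * (1 + B) * k2 -> S <= bound_const.
  move=> h; apply: (le_trans SW); rewrite /bound_const.
  have : W <= 4 / k0 * (M1 + 2 * M * (1 + B) * k2).
    rewrite -(ler_pM2l k0_gt0) (_ : k0 * (4 / k0 * _) = 4 * (M1 + 2 * M * (1 + B) * k2)); last first.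
      by field; rewrite gt_eqF.
    lra.
  lra.
have D0 := drift_ge0.
have Wk : W * (12 * (k2 / B)) <= W * k0 by rewrite ler_wpM2l// ltW.
have W_ge u : B <= `|u| -> W * `|u| <= W / B * (1 + u ^+ 2).
  move=> uB; rewrite (_ : W / B * (1 + u ^+ 2) = W * ((1 + u ^+ 2) / B)); last by ring.
  rewrite ler_wpM2l ?(ltW W0)// ler_pdivlMr// mulrC.
  by apply: (le_trans (square_ge uB)); rewrite lerDr.
have W_ge1 u : B <= `|u| -> W <= W / B * (1 + u ^+ 2).
  move=> uB; apply: le_trans (W_ge u uB); rewrite ler_peMr ?(ltW W0)//.
  exact: le_trans uB.
have [fy0|fy0] := leP 0 (f y).
  rewrite ger0_norm// in Wy.
  (* Left of [y] the weighted bound gives [f1 >= -W], so a drop of [3 W / 2] has to be covered; the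
     coefficient 3 is shared with the negative case. *)
  pose b := 3 * (W / B) + 2 * M * (1 + B).
  have H x : W / 2 - b * (1 + (x - (y + B)) ^+ 2) <= f1 x.
    set u := x - (y + B); have uE : x = u + y + B by rewrite /u; ring.
    have Du := D0 u.
    have WBu : 0 <= W / B * (1 + u ^+ 2) by rewrite mulr_ge0// addr_ge0// sqr_ge0.
    rewrite /b [(_ + _) * (1 + _)]mulrDl -[3 * _ * _]mulrA.
    have [xy|xy] := leP y x.
      have Xx : X <= x by exact: le_trans Xy xy.
      rewrite (f1E Xx); have := fM Xy xy.
      have : x - y <= B + `|u| by have := ler_norm u; lra.
      by move=> /drift; lra.
    have uB : B <= `|u| by rewrite ler0_norm; lra.
    have := W_ge1 u uB; have [Xx|xX] := leP X x; last by rewrite (f1_out xX); lra.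
    rewrite (f1E Xx); have := Sx x Xx; rewrite ler_norml => /andP[h _].
    have : S * (1 + eps * x) <= W.
      by rewrite ler_wpM2l ?(ltW S0)// lerD2l ler_wpM2l ?(ltW e0)// ltW.
    lra.
  have := pairing_lower H.
  rewrite (_ : W / 2 * k0 - b * k2 = W * k0 / 2 - 3 * W * (k2 / B) - 2 * M * (1 + B) * k2); last by rewrite /b; ring.
  by move=> h; apply: fin; rewrite (_ : 3 * W * (k2 / B) = W * (12 * (k2 / B)) / 4) in h; [lra | field; rewrite gt_eqF].
(* Once [y >= X + 2 B], every point below [X] is at distance at least [B] from the centre [y - B];
   otherwise [f_lower] bounds [|f y|] directly. *)
have [yX|yX] := ltP y (X + 2 * B).
  have := f_lower Xy; rewrite ltr0_norm// in Wy.
  have : C * (1 + y) <= C * (1 + X + 2 * B) by rewrite ler_wpM2l//; lra.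
  by rewrite /bound_const; lra.
rewrite ltr0_norm// in Wy.
(* Right of [y] the weighted bound allows [W + W u]. With the target [-W / 2] this takes [5/2]
   copies of [W (1 + u^2) / B], within the 3 provided. *)
pose b := 3 * (W / B) + 2 * M * (1 + B).
have H x : f1 x <= - (W / 2) + b * (1 + (x - (y - B)) ^+ 2).
  set u := x - (y - B); have uE : x = u + y - B by rewrite /u; ring.
  have Du := D0 u.
  have WBu : 0 <= W / B * (1 + u ^+ 2) by rewrite mulr_ge0// addr_ge0// sqr_ge0.
  rewrite /b [(_ + _) * (1 + _)]mulrDl -[3 * _ * _]mulrA.
  have [xy|xy] := leP x y.
    have [Xx|xX] := leP X x; last first.
      have uB : B <= `|u| by rewrite ler0_norm; lra.
      by have := W_ge1 u uB; rewrite (f1_out xX); lra.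
    rewrite (f1E Xx); have := fM Xx xy.
    have : y - x <= B + `|u| by have := ler_norm (- u); rewrite normrN; lra.
    by move=> /drift; lra.
  have Xx : X <= x by rewrite (le_trans Xy)// ltW.
  have u0 : 0 < u by have := B0; lra.
  have uB : B <= `|u| by rewrite ger0_norm; lra.
  have := W_ge u uB; have := W_ge1 u uB; rewrite ger0_norm ?(ltW u0)// => h1 h2.
  rewrite (f1E Xx); have := Sx x Xx; rewrite ler_norml => /andP[_ h].
  have : S * (1 + eps * x) <= W + W * u.
    rewrite /W -mulrA -mulrDr ler_wpM2l ?(ltW S0)//.
    have q1' : 0 <= eps * y * u by rewrite mulr_ge0// ltW.
    (* Here [eps <= 1] keeps the estimate free of [eps]. *)
    have q2 : eps * (u - B) <= u.
      apply: (@le_trans _ _ (eps * u)); first by apply: ler_wpM2l; [exact: ltW | rewrite lerBlDr lerDl].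
      by rewrite ler_piMl// ltW.
    have -> : 1 + eps * x = 1 + eps * y + eps * (u - B) by rewrite uE; ring.
    have -> : 1 + eps * y + (1 + eps * y) * u = 1 + eps * y + u + eps * y * u by ring.
    lra.
  lra.
have := pairing_upper H.
rewrite (_ : - (W / 2) * k0 + b * k2 = - (W * k0 / 2) + 3 * W * (k2 / B) + 2 * M * (1 + B) * k2); last by rewrite /b; ring.
by move=> h; apply: fin; rewrite (_ : 3 * W * (k2 / B) = W * (12 * (k2 / B)) / 4) in h; [lra | field; rewrite gt_eqF].
Qed.

Lemma tauberian_bound : exists S, forall x, X <= x -> `|f x| <= S.
Proof.
have bc0 : 0 <= bound_const by exact: addr_ge0.
exists bound_const => y Xy; have y0 : 0 <= y by exact: le_trans Xy.
pose G := C + growth_const.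
have G0 : 0 <= G by rewrite addr_ge0.
have fG x : X <= x -> `|f x| <= G * (1 + x).
  move=> Xx; have x0 : 0 <= x by exact: le_trans Xx.
  have := f_lower Xx; have := tauberian_growth Xx.
  have p1 : 0 <= C * (1 + x) by rewrite mulr_ge0// addr_ge0.
  have p2 : 0 <= growth_const * (1 + x) by rewrite mulr_ge0// addr_ge0.
  rewrite ler_norml (_ : G * (1 + x) = C * (1 + x) + growth_const * (1 + x)); last by rewrite -mulrDl.
  move=> h1 h2; apply/andP; split; first by apply: le_trans h2; rewrite lerN2 lerDl.
  by apply: (le_trans h1); rewrite lerDr.
have weighted eps : 0 < eps <= 1 -> `|f y| <= bound_const * (1 + eps * y).
  move=> eb; have /andP[e0 e1] := eb.
  have w0 x : X <= x -> 0 < 1 + eps * x.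
    by move=> Xx; rewrite ltr_pwDl// mulr_ge0 ?(ltW e0)// (le_trans X0).
  pose E := [set `|f x| / (1 + eps * x) | x in [set x | X <= x]].
  have supE : has_sup E.
    split; first by exists (`|f y| / (1 + eps * y)), y.
    (* Finite because [1 + x <= (1 + eps x) / eps] when [eps <= 1]. *)
    exists (G / eps) => _ [x /= Xx <-]; have x0 : 0 <= x by exact: le_trans Xx.
    rewrite ler_pdivrMr ?w0//; apply: (le_trans (fG x Xx)).
    rewrite [leRHS]mulrDr mulr1 [X in _ <= _ + X]mulrA divfK ?gt_eqF//.
    rewrite mulrDr mulr1 lerD2r.
    by rewrite ler_pdivlMr// ler_piMr.
  have Sx x : X <= x -> `|f x| <= sup E * (1 + eps * x).
    move=> Xx; rewrite -ler_pdivrMr ?w0//; apply: sup_upper_bound => //.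
    by exists x.
  have [S0|S0] := leP (sup E) 0.
    apply: (le_trans (Sx y Xy)); apply: (@le_trans _ _ 0).
      by rewrite mulr_le0_ge0// ltW// w0.
    by rewrite mulr_ge0// ltW// w0.
  have S2 : 0 < sup E / 2 by rewrite divr_gt0.
  have [_ [z /= Xz <-] hz] := sup_adherent S2 supE.
  apply: (le_trans (Sx y Xy)); rewrite ler_wpM2r ?(ltW (w0 y Xy))//.
  apply: (@main_bound (sup E) eps z) => //.
  rewrite -ler_pdivlMr ?w0//; apply/ltW; apply: le_lt_trans hz; lra.
apply/ler_addgt0Pr => d d0.
have p0 : 0 < bound_const * y + 1 by rewrite ltr_wpDl// mulr_ge0.
pose eps := Num.min 1 (d / (bound_const * y + 1)).
have eb : 0 < eps <= 1 by rewrite lt_min ltr01 divr_gt0//= ge_min lexx.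
apply: (le_trans (weighted eps eb)); rewrite mulrDr mulr1 lerD2l mulrCA.
apply: (@le_trans _ _ (d / (bound_const * y + 1) * (bound_const * y + 1))).
  apply: ler_pM; rewrite ?mulr_ge0//.
  - by case/andP: eb => /ltW.
  - by rewrite /eps ge_min lexx orbT.
  - by rewrite lerDl.
by rewrite divfK// gt_eqF.
Qed.
End Tauberian.

(** * Main terms and boundary behavior *)
Section PowlogGrowth.
Context {R : realType}.
Local Notation mu := (@lebesgue_measure R).
Local Notation T := (measurableTypeR R).
Implicit Types (x y u d : R) (h : R -> R[i]) (s z : R[i]) (m : nat).

Lemma powlog_bounded y m : y < 1 \/ (y = 1 /\ m = 0%N) ->
  exists2 B, 0 <= B & forall x, 1 <= x -> `|powlog y m x| <= B.
Proof.
case=> [y1|[-> ->]]; last first.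
  exists 1 => // x x1; rewrite /powlog (lt_le_trans ltr01 x1) subrr mul0r expR0 expr0 mulr1.
  by rewrite normr1.
have c0 : 0 < 1 - y by rewrite subr_gt0.
have [C C0 H] := expr_le_expR m c0; exists C; first exact: ltW.
move=> x x1; have x0 : 0 < x by exact: lt_le_trans x1.
rewrite /powlog x0 normrM normrX ger0_norm ?expR_ge0// ger0_norm ?ln_ge0//.
have u0 : 0 <= ln x by exact: ln_ge0.
apply: (@le_trans _ _ (expR ((y - 1) * ln x) * (C * expR ((1 - y) * ln x)))).
  by rewrite ler_wpM2l ?expR_ge0// H.
rewrite mulrCA -expRD -mulrDl (_ : y - 1 + (1 - y) = 0); last by ring.
by rewrite mul0r expR0 mulr1.
Qed.

(** At [m = 0] the truncated predecessor [m.-1] is harmless, its term having coefficient 0. *)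
Lemma is_derive_powlog_arg y m x : 0 < x ->
  is_derive x 1 (powlog (y + 1) m) (y * powlog y m x + m%:R * powlog y m.-1 x).
Proof.
move=> x0.
have xE : expR ((y - 1) * ln x) = expR (y * ln x) / x.
  by rewrite mulrBl mul1r expRD expRN lnK.
apply: (@is_derive_near _ (fun t => expR (y * ln t) * ln t ^+ m)).
  by apply: filterS (lt_nbhsr x0) => t t0; rewrite /powlog t0 addrK.
have dl := is_derive1_ln x0.
have dX : is_derive x 1 (fun t => ln t ^+ m) (m%:R * ln x ^+ m.-1 * x^-1).
  apply: (is_derive_compose (f := fun v => v ^+ m) (g := @ln R)) dl.
  have h := @is_deriveX R R (fun t => t) m (ln x) 1 1 (is_derive_ident _).
  apply: (@is_derive_ext _ ((fun t : R => t) ^+ m)); first by move=> t; rewrite exprfctE.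
  by refine (is_derive_val h _); rewrite /GRing.scale /= mulr1.
refine (is_derive_val (is_derive_mul (is_derive_compose (f := @expR R) (g := fun t => y * ln t) (is_derive_expR _) (is_derive_scale y dl)) dX) _).
by rewrite /powlog x0 xE; ring.
Qed.

(** Mean value theorem: differentiation lowers the exponent of [x] to [y - 2], which is negative, or
    zero without logarithm, so [powlog_bounded] applies. *)
Lemma powlog_increment y m : 1 <= y < 2 \/ (y = 2 /\ m = 0%N) ->
  exists2 B, 0 <= B & forall x d, 1 <= x -> 0 <= d <= 1 ->
    `|powlog y m (x + d) - powlog y m x| <= B.
Proof.
move=> hy; pose w := y - 1.
have yE : y = w + 1 by rewrite /w subrK.
have [B1 B10 H1] : exists2 B, 0 <= B & forall x, 1 <= x -> `|powlog w m x| <= B.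
  by apply: powlog_bounded; case: hy => [/andP[_ h]|[hy1 hm]]; [left; rewrite /w; lra|right; rewrite /w hy1 ?hm; split => //; ring].
have [B2 B20 H2] : exists2 B, 0 <= B & forall x, 1 <= x -> `|powlog w m.-1 x| <= B.
  by apply: powlog_bounded; case: hy => [/andP[_ h]|[hy1 hm]]; [left; rewrite /w; lra|right; rewrite /w hy1 ?hm; split => //; ring].
have cst0 : 0 <= `|w| * B1 + m%:R * B2 by apply: addr_ge0; apply: mulr_ge0.
exists (`|w| * B1 + m%:R * B2) => //.
move=> x d x1 /andP[d0 d1].
have bound t : 1 <= t -> `|w * powlog w m t + m%:R * powlog w m.-1 t| <= `|w| * B1 + m%:R * B2.
  move=> t1; apply: (le_trans (ler_normD _ _)); rewrite !normrM normr_nat.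
  by apply: lerD; rewrite ler_wpM2l// ?H1// H2.
move: d0; rewrite le_eqVlt => /orP[/eqP <-|d0].
  by rewrite addr0 subrr normr0.
have dp (t : R) : 0 < t -> is_derive t 1 (powlog y m) (w * powlog w m t + m%:R * powlog w m.-1 t).
  by move=> t0; rewrite {1}yE; exact: is_derive_powlog_arg.
have xd : x < x + d by rewrite ltrDl.
have [||c cin ->] := @MVT _ (powlog y m) (fun t => w * powlog w m t + m%:R * powlog w m.-1 t) x (x + d) xd.
- move=> t; rewrite in_itv/= => /andP[xt _]; apply: dp.
  by apply: lt_trans xt; exact: lt_le_trans x1.
- apply: derivable_within_continuous => t; rewrite in_itv/= => /andP[xt _].
  by have [] := dp t (lt_le_trans ltr01 (le_trans x1 xt)).
rewrite [x + d]addrC addrK normrM [`|d|]ger0_norm ?(ltW d0)//.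
move: cin; rewrite in_itv/= => /andP[xc _].
apply: (le_trans _ (bound c (le_trans x1 (ltW xc)))).
by rewrite ler_piMr.
Qed.

(** What allows a function to be subtracted from [tau] without harm: absolutely convergent
    transforms and bounded increments over steps of length at most 1. The class is closed under
    linear combinations. *)
Definition admissible h := [/\ cmeasurable [set: T] (h : T -> R[i]), forall x, x < 0 -> h x = 0,
  forall s, 0 < cRe s -> cintegrable setT (fun x => h x * cexp (- s * cr x)) &
  exists2 B, 0 <= B & forall x d, 1 <= x -> 0 <= d <= 1 -> cabs (h (x + d) - h x) <= B].

Lemma admissible_powlog y m : 1 <= y < 2 \/ (y = 2 /\ m = 0%N) ->
  admissible (fun x => cr (powlog y m x)).
Proof.
move=> hy; have y0 : 0 < y.
  by case: hy => [/andP[h _]|[-> _]] //; exact: lt_le_trans h.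
split.
- by apply: cmeasurable_cr; exact: measurable_powlog.
- by move=> x x0; rewrite /powlog ltNge (ltW x0).
- by move=> s s0; exact: cintegrable_powlog.
- have [B B0 H] := powlog_increment hy; exists B => // x d x1 hd.
  by rewrite -crN -crD cabs_cr H.
Qed.

Lemma admissibleD h1 h2 : admissible h1 -> admissible h2 -> admissible (fun x => h1 x + h2 x).
Proof.
move=> [m1 z1 i1 [B1 B10 H1]] [m2 z2 i2 [B2 B20 H2]]; split.
- exact: cmeasurableD.
- by move=> x x0; rewrite z1// z2// addr0.
- move=> s s0; apply: eq_cintegrable (cintegrableD measurableT (i1 s s0) (i2 s s0)) => // x _.
  by rewrite mulrDl.
- exists (B1 + B2); first exact: addr_ge0.
  move=> x d x1 hd; rewrite opprD addrACA; apply: (le_trans (cabsD _ _)).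
  by apply: lerD; [exact: H1 | exact: H2].
Qed.

Lemma admissibleZ z h : admissible h -> admissible (fun x => z * h x).
Proof.
move=> [m1 z1 i1 [B1 B10 H1]]; split.
- by apply: cmeasurableM => //; exact: cmeasurable_cst.
- by move=> x x0; rewrite z1// mulr0.
- move=> s s0; apply: eq_cintegrable (cintegrableZ z measurableT (i1 s s0)) => // x _.
  by rewrite mulrA.
- exists (cabs z * B1); first by rewrite mulr_ge0// cabs_ge0.
  by move=> x d x1 hd; rewrite -mulrBr cabsM ler_wpM2l ?cabs_ge0// H1.
Qed.

Lemma admissible0 : admissible (fun=> 0).
Proof.
split => //.
- by move=> s _; apply: eq_cintegrable (cintegrable0 _) => // x _; rewrite mul0r.
- by exists 0 => // x d _ _; rewrite subrr cabs0.
Qed.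

Lemma admissible_sum n (F : 'I_n -> R -> R[i]) : (forall i, admissible (F i)) ->
  admissible (fun x => \sum_i F i x).
Proof.
elim: n F => [|n IH] F h.
  rewrite (_ : (fun x => _) = (fun=> 0)); first exact: admissible0.
  by apply/funext => x; rewrite big_ord0.
rewrite (_ : (fun x => _) = (fun x => F ord0 x + \sum_(i < n) F (lift ord0 i) x)).
  by apply: admissibleD => //; exact: IH.
by apply/funext => x; rewrite big_ord_recl.
Qed.

(** Lebesgue counterpart of [laplace], which is a limit of truncated integrals; linearity and Fubini
    are directly available for it. *)
Definition claplace h s := cintegral setT (fun x => h x * cexp (- s * cr x)).

Lemma claplaceD h1 h2 s : cintegrable setT (fun x => h1 x * cexp (- s * cr x)) ->
  cintegrable setT (fun x => h2 x * cexp (- s * cr x)) ->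
  claplace (fun x => h1 x + h2 x) s = claplace h1 s + claplace h2 s.
Proof.
move=> i1 i2; rewrite -(cintegralD measurableT i1 i2).
by apply: eq_cintegral => x _; rewrite mulrDl.
Qed.

Lemma claplaceZ z h s : cintegrable setT (fun x => h x * cexp (- s * cr x)) ->
  claplace (fun x => z * h x) s = z * claplace h s.
Proof.
move=> i1; rewrite -(cintegralZ z measurableT i1).
by apply: eq_cintegral => x _; rewrite mulrA.
Qed.

Lemma claplace_sum n (F : 'I_n -> R -> R[i]) s :
  (forall i, cintegrable setT (fun x => F i x * cexp (- s * cr x))) ->
  claplace (fun x => \sum_i F i x) s = \sum_i claplace (F i) s.
Proof.
move=> h; have [_ <-] := cintegrable_sum measurableT h.
by apply: eq_cintegral => x _; rewrite mulr_suml.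
Qed.
End PowlogGrowth.

(** * From conditional to absolute convergence of the Laplace transform *)

Section LaplaceConvergence.
Context {R : realType}.
Local Notation mu := (@lebesgue_measure R).
Local Notation T := (measurableTypeR R).
Implicit Types (x y sg M X : R) (g : R -> R) (tau : R -> R[i]) (s : R[i]).

Lemma rintegrable_laplace_linear sg : 0 < sg ->
  rintegrable setT (fun x => (powlog 1 0 x + powlog 2 0 x) * expR (- sg * x)).
Proof.
move=> s0.
have h (z : R) : 0 < z -> rintegrable setT (fun x => powlog z 0 x * expR (- sg * x)).
  move=> z0; have [i1 _] := @cintegrable_powlog R z 0 (cr sg) z0 s0.
  apply: eq_rintegrable i1 => // x _.
  by rewrite /comp -crN -crM cexp_cr -crM.
apply: eq_rintegrable (rintegrableD measurableT (h 1 ltr01) (h 2 (ltr0Sn R 1))) => // x _.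
by rewrite mulrDl.
Qed.

Lemma powlog_linear x : 0 < x -> powlog 1 0 x + powlog 2 0 x = 1 + x.
Proof.
move=> x0; rewrite /powlog x0 !expr0 !mulr1 subrr mul0r expR0.
by rewrite (_ : 2 - 1 = 1) ?mul1r ?lnK//; ring.
Qed.

(* A lower bound [- C (1 + x)] lets Fatou's lemma turn conditional convergence into absolute convergence. *)
Lemma rintegrable_laplace g M X sg : 0 < sg -> (forall a b, rintegrable `[a, b] g) ->
  measurable_fun [set: T] (g : T -> R) -> (forall x, x < 0 -> g x = 0) ->
  0 <= M -> 0 <= X -> (forall x y, X <= x -> x <= y -> g x - M * (1 + (y - x)) <= g y) ->
  cvg (Rintegral mu `[0, t] (fun x => g x * expR (- sg * x)) @[t --> +oo]) ->
  rintegrable setT (fun x => g x * expR (- sg * x)).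
Proof.
move=> s0 ig mg g0 M0 X0 gM /cvg_ex[L cL].
pose E x := expR (- sg * x).
have mE : measurable_fun [set: T] (E : T -> R).
  by apply: continuous_measurableT => x; apply: continuous_cvg; [exact: continuous_expR | exact: mulrl_continuous].
have E_ge0 x : 0 <= E x by exact: expR_ge0.
have E_le1 x : 0 <= x -> E x <= 1.
  by move=> x0; rewrite -expR0 ler_expR mulNr oppr_le0 mulr_ge0// ltW.
have mI t : measurable (`[0, t]%classic : set T) by exact: measurable_itv.
have igE t : rintegrable `[0, t] (fun x => g x * E x).
  apply: (@rintegrable_mul_bounded _ _ _ _ 1) => //; first exact: measurable_funTS.
  by move=> x /=; rewrite in_itv/= => /andP[x0 _]; rewrite ger0_norm// E_le1.
pose C := `|g X| + M.
have C0 : 0 <= C by exact: addr_ge0.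
pose q x := C * ((powlog 1 0 x + powlog 2 0 x) * E x).
have iq : rintegrable setT q by apply: rintegrableZ => //; exact: rintegrable_laplace_linear.
have q_ge0 x : 0 <= q x.
  rewrite /q mulr_ge0// mulr_ge0//.
  by rewrite addr_ge0// /powlog; case: ifPn => // _; rewrite expr0 mulr1 expR_ge0.
(* [q] compensates the negative part beyond [X]; [p] does so on [[0, X]], where no lower bound on
   [g] is at hand. *)
pose p := (fun x => `|g x * E x|) \_ (`[0, X]%classic : set T).
have ip : rintegrable setT p.
  exact: (rintegrable_mkcond (fun x => `|g x * E x|) (mI X)).1 (rintegrable_abs (mI X) (igE X)).
have p_ge0 x : 0 <= p x by rewrite /p patchE; case: ifPn.
pose r x := q x + p x.
have ir : rintegrable setT r by exact: rintegrableD.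
have r_ge0 x : 0 <= r x by exact: addr_ge0.
have h_ge0 x : 0 <= x -> 0 <= g x * E x + r x.
  move=> x0; have [xX|Xx] := leP x X.
    rewrite /r /p patchE ifT; last by rewrite inE /= in_itv/= x0.
    have := ler_norm (- (g x * E x)); rewrite normrN; have := q_ge0 x; lra.
  have x1 : 0 < x by exact: le_lt_trans Xx.
  rewrite /r addrA addr_ge0// /q powlog_linear// mulrA -mulrDl mulr_ge0//.
  have := gM X x (lexx X) (ltW Xx); have := ler_norm (- g X); rewrite normrN /C.
  have a0 := normr_ge0 (g X).
  have : 0 <= `|g X| * x by rewrite mulr_ge0.
  have : 0 <= M * X by rewrite mulr_ge0.
  rewrite !mulrDl !mulrDr !mulr1; lra.
have mgE : measurable_fun [set: T] (fun x => g x * E x) by exact: measurable_funM.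
have mr := rintegrable_meas ir.
have [t0 [_ ht]] : \forall t \near +oo, Rintegral mu `[0, t] (fun x => g x * E x) <= L + 1.
  have h := cvgr_le L cL; by apply: h; rewrite ltrDl.
(* Truncation points beyond [t0], so that the partial integrals are at most [L + 1], and at least
   [n], so that the intervals exhaust the half-line. *)
pose t n : R := Num.max t0 0 + n.+1%:R.
have tt n : t0 < t n.
  have h : t0 <= Num.max t0 0 by rewrite le_max lexx.
  by rewrite (le_lt_trans h)// ltrDl ltr0n.
have tn n : n%:R <= t n.
  by apply: (@le_trans _ _ n.+1%:R); [rewrite ler_nat | rewrite lerDr le_max lexx orbT].
pose h x := g x * E x + r x.
have [ih _] : rintegrable setT h /\ Rintegral mu setT h <= L + 1 + Rintegral mu setT r.
  apply: (@rintegrable_fatou _ (fun n => h \_ (`[0, t n]%classic : set T)) h (L + 1 + Rintegral mu setT r) setT) => //.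
  - move=> n; apply: ((rintegrable_mkcond h (mI (t n))).1 _).
    by apply: rintegrableD => //; exact: (rintegrable_sub measurableT (mI _) (@subsetT _ _) ir).
  - exact: measurable_funD.
  - move=> n x _; rewrite patchE; case: ifPn => //; rewrite inE /= in_itv/= => /andP[x0 _].
    exact: h_ge0.
  - move=> x _; have [x0|x0] := ltP x 0.
      rewrite (_ : (fun n => _) = fun=> h x); first exact: cvg_cst.
      apply/funext => n; rewrite patchE ifF.
        rewrite /h g0// mul0r add0r /r /q /p patchE ifF ?addr0; last first.
          by apply/negP; rewrite inE /= in_itv/= leNgt x0.
        by rewrite /powlog ltNge (ltW x0)/= addr0 mul0r mulr0.
      by apply/negP; rewrite inE /= in_itv/= leNgt x0.
    apply: cvg_near_cst; exists (Num.bound `|x|) => // n /= xn.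
    rewrite patchE ifT// inE /= in_itv/= x0/=; apply: le_trans (tn n).
    apply: (le_trans (ler_norm _)); apply/ltW; apply: (lt_le_trans (archi_boundP (normr_ge0 x))).
    by rewrite ler_nat.
  - move=> n; rewrite -Rintegral_mkcond RintegralD//; [|exact: igE|exact: (rintegrable_sub measurableT (mI _) (@subsetT _ _) ir)].
    apply: lerD; first exact: ht.
    rewrite Rintegral_mkcond; apply: le_Rint => //.
      exact: (rintegrable_mkcond r (mI (t n))).1 (rintegrable_sub measurableT (mI _) (@subsetT _ _) ir).
    by move=> x _; rewrite patchE; case: ifPn.
by apply: eq_rintegrable (rintegrableB measurableT ih ir) => // x _; rewrite /h addrK.
Qed.

Lemma measurable_L1loc (g : R -> R) : (forall a b, rintegrable `[a, b] g) ->
  measurable_fun [set: T] (g : T -> R).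
Proof.
move=> ig; have -> : [set: T] = \bigcup_n (`[- n%:R, n%:R]%classic : set T).
  apply/seteqP; split => x // _; exists (Num.bound `|x|) => //=.
  by rewrite in_itv/= -ler_norml; apply/ltW/archi_boundP.
apply/measurable_fun_bigcup => [n|n]; first exact: measurable_itv.
exact: rintegrable_meas (ig _ _).
Qed.

Lemma laplace_integrable tau : L1loc tau -> boundedly_decreasing tau ->
  (forall x, x < 0 -> tau x = 0) -> (forall s, 0 < cRe s -> laplace_converges tau s) ->
  forall s, 0 < cRe s -> cintegrable setT (fun x => tau x * cexp (- s * cr x)).
Proof.
move=> l1 [bd1 bd2] tau0 lc s s0.
have i1 a b : rintegrable `[a, b] (fun x => cRe (tau x)) by have [] := l1 a b.
have i2 a b : rintegrable `[a, b] (fun x => cIm (tau x)) by have [] := l1 a b.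
have m1 := measurable_L1loc i1; have m2 := measurable_L1loc i2.
(* At the real point [Re s] the kernel is real, so convergence splits into two real problems.
   Absolute integrability carries over to [s], the two kernels having equal modulus. *)
have [L [c1 c2]] := lc (cr (cRe s)) s0.
have kE x : laplace_integrand tau (cr (cRe s)) x = tau x * cr (expR (- cRe s * x)).
  by rewrite /laplace_integrand -crN -crM cexp_cr.
have [M1 [X1 [M10 X10 H1]]] := boundedly_decreasing_linear bd1.
have [M2 [X2 [M20 X20 H2]]] := boundedly_decreasing_linear bd2.
have j1 : rintegrable setT (fun x => cRe (tau x) * expR (- cRe s * x)).
  apply: (@rintegrable_laplace _ M1 X1) => //; first by move=> x /tau0 ->.
  apply/cvg_ex; exists (cRe L); apply: cvg_trans c1; apply: near_eq_cvg; apply: nearW => t.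
  by apply: eq_Rint => x _; rewrite /comp kE !cE mulr0 subr0.
have j2 : rintegrable setT (fun x => cIm (tau x) * expR (- cRe s * x)).
  apply: (@rintegrable_laplace _ M2 X2) => //; first by move=> x /tau0 ->.
  apply/cvg_ex; exists (cIm L); apply: cvg_trans c2; apply: near_eq_cvg; apply: nearW => t.
  by apply: eq_Rint => x _; rewrite /comp kE !cE mulr0 add0r.
apply: (@cintegrable_le _ _ _ (fun x => `|cRe (tau x) * expR (- cRe s * x)| + `|cIm (tau x) * expR (- cRe s * x)|)) => //.
- by apply: cmeasurableM; [split | exact: cmeasurable_cexp_lin].
- move=> x _; rewrite cabsM cabs_laplace_kernel !normrM [`|expR _|]ger0_norm ?expR_ge0//.
  by rewrite -mulrDl ler_wpM2r ?expR_ge0// cabs_le_ReIm.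
- by apply: rintegrableD => //; exact: rintegrable_abs.
Qed.

Lemma laplace_claplace tau s : (forall x, x < 0 -> tau x = 0) ->
  cintegrable setT (fun x => tau x * cexp (- s * cr x)) -> laplace tau s = claplace tau s.
Proof.
move=> tau0 it; have [] := cintegral_pinfty it; first by move=> x /tau0 ->; rewrite mul0r.
by move=> c1 c2; apply: complex_ext; apply/cvg_lim.
Qed.
End LaplaceConvergence.

(** * Pairing the boundary values with test functions *)

Section Pairing.
Context {R : realType}.
Local Notation mu := (@lebesgue_measure R).
Local Notation T := (measurableTypeR R).
Implicit Types (x y t v sg : R) (rho : R -> R[i]).

Section TestFunction.
Variables (phi K : R -> R) (eta : R).
Hypotheses (eta0 : 0 < eta) (cphi : continuous phi) (suphi : supported eta phi).
Hypothesis hK : forall v, cintegral setT (fun t => cr (phi t) * wave v t) = cr (K v).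

Lemma cmeasurable_modulate y : cmeasurable [set: T] (modulate phi y : T -> R[i]).
Proof.
apply: eq_cmeasurable (cmeasurableM (cmeasurable_cr (continuous_measurableT cphi)) (cmeasurable_wave (- y))) => t _.
by rewrite /modulate /wave mulNr crN mulrN opprK.
Qed.

Lemma cabs_modulate y t : cabs (modulate phi y t) = `|phi t|.
Proof.
by rewrite /modulate cabsM cabs_cr cabs_cexp !cE /= mul0r mulr0 subr0 expR0 mulr1.
Qed.

(** Fubini with the product bound [|phi t| |w x|]: integrating in [t] first turns the modulated test
    function into the translate [K (x - y)]. *)
Lemma pairing_claplace rho sg y : cmeasurable [set: T] (rho : T -> R[i]) ->
  cintegrable setT (fun x => rho x * cexp (- cr sg * cr x)) ->
  [/\ cintegrable setT (fun t => claplace rho (Complex sg t) * modulate phi y t),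
      cintegrable setT (fun x => cr (K (x - y)) * (rho x * cexp (- cr sg * cr x))) &
      cintegral setT (fun t => claplace rho (Complex sg t) * modulate phi y t) =
      cintegral setT (fun x => cr (K (x - y)) * (rho x * cexp (- cr sg * cr x)))].
Proof.
move=> mrho ir; set w := fun x => rho x * cexp (- cr sg * cr x).
pose F t x := cr (phi t) * wave (x - y) t * w x.
have iphi := rintegrable_supported eta0 cphi suphi.
have mphi : measurable_fun [set: T] (phi : T -> R) by exact: continuous_measurableT.
have [w1 w2] : cmeasurable [set: T] w by exact: cintegrable_meas.
have mF : cmeasurable setT (fun p : T * T => F p.1 p.2).
  apply: cmeasurableM; last first.
    by split; [exact: (measurableT_comp w1 measurable_snd) | exact: (measurableT_comp w2 measurable_snd)].
  apply: cmeasurableM; first by apply: cmeasurable_cr; exact: (measurableT_comp mphi measurable_fst).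
  apply: cmeasurable_cexp.
  apply: (@eq_cmeasurable _ _ _ _ (fun p : T * T => - ci * cr (((p.2 : R) - y) * (p.1 : R)))).
    by move=> p _; rewrite mulNr.
  apply: cmeasurableM; first exact: cmeasurable_cst.
  apply: cmeasurable_cr; apply: measurable_funM; last exact: (measurableT_comp measurable_ident measurable_fst).
  by apply: measurable_funB; [exact: (measurableT_comp measurable_ident measurable_snd) | exact: measurable_cst].
have dom t x : cabs (F t x) <= `|phi t| * cabs (w x).
  by rewrite /F !cabsM cabs_cr cabs_wave mulr1.
have [f1 f2 f3] := cFubini mF (rintegrable_abs measurableT iphi) (cintegrable_cabs measurableT ir) dom.
have E1 t : cintegral setT (F t) = claplace rho (Complex sg t) * modulate phi y t.
  have kE x : rho x * cexp (- Complex sg t * cr x) = wave x t * w x.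
    rewrite /w mulrCA -cexpD; congr (_ * cexp _).
    by apply: complex_ext; rewrite !cE /=; ring.
  have it : cintegrable setT (fun x => rho x * cexp (- Complex sg t * cr x)).
    apply: (cintegrable_le (g := fun x => cabs (w x)) measurableT).
    - exact: (cmeasurableM mrho (cmeasurable_cexp_lin _)).
    - by move=> x _; rewrite kE cabsM cabs_wave mul1r.
    - exact: (cintegrable_cabs measurableT ir).
  rewrite /claplace mulrC -(cintegralZ _ measurableT it); apply: eq_cintegral => x _.
  by rewrite kE /F waveBl /modulate; ring.
have E2 x : cintegral setT (F ^~ x) = cr (K (x - y)) * w x.
  rewrite -hK mulrC -(cintegralZ _ measurableT (cintegrable_wave (x - y) iphi)).
  by apply: eq_cintegral => t _; rewrite /F mulrC.
split.
- by apply: eq_cintegrable f1 => // t _; rewrite E1.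
- by apply: eq_cintegrable f2 => // t _; rewrite E2.
- rewrite -(eq_cintegral (f := fun t => cintegral setT (F t))); last by move=> t _; rewrite E1.
  by rewrite f3; apply: eq_cintegral => x _; rewrite E2.
Qed.
End TestFunction.

Lemma test_funW (a b a' b' : R) (phi : R -> R[i]) : a <= a' -> b' <= b ->
  test_fun a' b' phi -> test_fun a b phi.
Proof.
move=> aa bb [s1 [s2 [c [d [ac [db h]]]]]]; split=> //; split=> //; exists c, d.
by split; [exact: le_lt_trans ac | split; [exact: lt_le_trans bb|]].
Qed.

(** Uniformity in [y] holds because the Fourier transform of the modulated function is a translate
    of [K >= 0]: its L^1 norm is the integral of [K], whatever [y], and it is paired with the
    bounded [h]. *)
Lemma boundary_pairing_bounded (F : R[i] -> R[i]) : pseudomeasure_boundary_at0 F ->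
  exists2 e, 0 < e & forall (phi K : R -> R), (forall v, 0 <= K v) -> rintegrable setT K ->
    (forall v, cintegral setT (fun t => cr (phi t) * wave v t) = cr (K v)) ->
    (forall y, test_fun (- e) e (modulate phi y)) ->
    exists B, forall y, \forall sg \near (0 : R)^'+,
      cabs (cintegral setT (fun t => F (Complex sg t) * modulate phi y t)) <= B.
Proof.
move=> [a [b [ab [g [gF gP]]]]]; have [e [e0 [ae [be]]]] := gP 0 ab.
rewrite sub0r add0r in ae be *; move=> [h [mh1 [mh2 [[M hM] gh]]]].
exists e => // phi K K0 iK hK tphi.
have M0 : 0 <= M by exact: le_trans (cabs_ge0 (h 0)) (hM 0).
pose B := (2 * pi)^-1 * (M * Rintegral mu setT K).
have pi2 : 0 <= (2 * pi : R)^-1 by rewrite invr_ge0 mulr_ge0// pi_ge0.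
have gB y : cabs (g (modulate phi y)) <= B.
  have [iK' EK'] := rintegrable_shift (- y) iK.
  have [iK2 EK2] := rintegrable_reflect iK'.
  rewrite gh// cabsM cabs_cr ger0_norm// ler_wpM2l//.
  have fE x : fourier (modulate phi y) (- x) = cr (K (- x - y)) by exact: fourier_modulate.
  have <- : Rintegral mu setT (fun x => M * K (- x - y)) = M * Rintegral mu setT K.
    by rewrite -EK' -EK2 -RintegralZl.
  have bd x : cabs (h x * fourier (modulate phi y) (- x)) <= M * K (- x - y).
    by rewrite fE cabsM cabs_cr ger0_norm// ler_wpM2r.
  have iMK : rintegrable setT (fun x => M * K (- x - y)) by exact: rintegrableZ.
  apply: cabs_cintegral_le => //; apply: cintegrable_le iMK => //.
  apply: cmeasurableM; first by split.
  apply: (@eq_cmeasurable _ _ _ _ (fun x : T => cr (K (- x - y)))); first by move=> x _; rewrite fE.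
  by apply: cmeasurable_cr; exact: rintegrable_meas iK2.
(* Real and imaginary parts converge separately, each having modulus eventually below [B + 1]. *)
exists (B + 1 + (B + 1)) => y.
have [c1 c2] := gF _ (test_funW ae be (tphi y)).
have h1 : `|cRe (g (modulate phi y))| < B + 1.
  by apply: (le_lt_trans (normRe_cabs _)); apply: (le_lt_trans (gB y)); rewrite ltrDl.
have h2 : `|cIm (g (modulate phi y))| < B + 1.
  by apply: (le_lt_trans (normIm_cabs _)); apply: (le_lt_trans (gB y)); rewrite ltrDl.
have n1 : \forall sg \near (0 : R)^'+,
    `|cRe (cintegral setT (fun t => F (Complex sg t) * modulate phi y t))| < B + 1.
  by have q := cvgr_norm_lt _ c1 (B + 1) h1; exact: q.
have n2 : \forall sg \near (0 : R)^'+,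
    `|cIm (cintegral setT (fun t => F (Complex sg t) * modulate phi y t))| < B + 1.
  by have q := cvgr_norm_lt _ c2 (B + 1) h2; exact: q.
near=> sg; apply: (le_trans (cabs_le_ReIm _)); apply: lerD; apply: ltW.
- by near: sg; exact: n1.
- by near: sg; exact: n2.
Unshelve. all: end_near. Qed.
End Pairing.

(** * Uniform bounds for singular terms with negative exponent *)

Section IntegrableSingularity.
Context {R : realType}.
Local Notation mu := (@lebesgue_measure R).
Local Notation T := (measurableTypeR R).
Implicit Types (x y t sg w : R) (s b c : R[i]).

Lemma clog_right_half sg t : 0 < sg ->
  clog (Complex sg t) = Complex (ln (cabs (Complex sg t))) (atan (t / sg)).
Proof. by move=> s0; rewrite /clog /carg /= s0. Qed.

Lemma cmeasurable_clog_line sg : 0 < sg -> cmeasurable [set: T] (fun t : T => clog (Complex sg t)).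
Proof.
move=> s0; apply: (@eq_cmeasurable _ _ _ _ (fun t : T => Complex (ln (cabs (Complex sg t))) (atan (t / sg)))).
  by move=> t _; rewrite clog_right_half.
split.
- apply: (measurableT_comp (@measurable_ln R)); apply: measurable_cabs.
  by split; [exact: measurable_cst | exact: measurable_ident].
- apply: continuous_measurableT => t; apply: continuous_comp; first exact: mulrr_continuous.
  exact: continuous_atan.
Qed.

Definition singular_term b c (k : nat) y s := (b + c * clog s^-1 ^+ k) / cpow s (cr y).

Lemma singular_termE b c k y s : 0 < cRe s ->
  singular_term b c k y s = (b + c * (- clog s) ^+ k) * cexp (- (cr y * clog s)).
Proof. by move=> s0; rewrite /singular_term clog_inv// /cpow cexp_inv. Qed.

(** For [g] strictly between [y] and 1 the gap [g - y] absorbs the power of the logarithm and leaves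
    a multiple of [|s|^(-g)]; then [|s| >= |t|] removes [sg]. *)
Lemma singular_term_bound b c k y m : y < 1 -> 0 <= m ->
  exists g C, [/\ 0 < g < 1, 0 <= C & forall sg t, 0 < sg < 1 -> 0 < `|t| <= m ->
    cabs (singular_term b c k y (Complex sg t)) <= C * expR (- g * ln `|t|)].
Proof.
(* [g] is the midpoint of [max y 0] and 1; its positivity allows [|s|] to be replaced by [|t|]. *)
move=> y1 m0; pose y' := Num.max y 0; pose g := (y' + 1) / 2.
have y'1 : y' < 1 by rewrite gt_max y1 ltr01.
have y'0 : 0 <= y' by rewrite le_max lexx orbT.
have yy' : y <= y' by rewrite le_max lexx.
have g01 : 0 < g < 1 by rewrite /g; apply/andP; split; lra.
have d0 : 0 < g - y by rewrite /g; lra.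
have [C1 C10 H1] := expr_le_expR k d0.
exists g, ((cabs b + cabs c * C1) * expR ((g - y) * (pi + 2 * m))); split => //.
  by rewrite mulr_ge0 ?expR_ge0// addr_ge0 ?cabs_ge0// mulr_ge0 ?cabs_ge0// ltW.
move=> sg t /andP[s0 s1] /andP[t0 tm].
set s := Complex sg t; have cRes : 0 < cRe s by [].
rewrite (singular_termE _ _ _ _ cRes); set L := ln (cabs s).
have cs0 : 0 < cabs s by exact: cabs_gt0.
have ts : `|t| <= cabs s by exact: (normIm_cabs s).
have Lt : ln `|t| <= L by rewrite ler_ln.
have sm : cabs s <= expR m.
  apply: (le_trans (cabs_le_ReIm s)); rewrite /= ger0_norm ?(ltW s0)//.
  by apply: le_trans (expR_ge1Dx m); apply: lerD => //; exact: ltW.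
have Lm : L <= m by rewrite -[leRHS]expRK /L ler_ln ?posrE ?expR_gt0.
have al : `|atan (t / sg)| <= pi.
  have := atan_ltpi2 (t / sg); have := atan_gtNpi2 (t / sg); have := pi_gt0 R.
  by rewrite ler_norml; lra.
(* From [L <= m] follows [|L| <= 2 m - L]. Thus [v] bounds [|clog s|] while being affine in [L], and
   [e^((g - y) v)] is a multiple of [|s|^(y - g)]. *)
pose v := pi + 2 * m - L.
have cl : cabs (clog s) <= v.
  apply: (le_trans (cabs_le_ReIm _)); rewrite clog_right_half//= -/s -/L.
  have : `|L| <= 2 * m - L by rewrite ler_norml; lra.
  rewrite /v; lra.
have v0 : 0 <= v by exact: le_trans (cabs_ge0 _) cl.
rewrite cabsM cabs_cexp (_ : cRe _ = - (y * L)); last by rewrite !cE /= mul0r subr0.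
have e1 : 1 <= expR ((g - y) * v) by rewrite -expR0 ler_expR mulr_ge0// ltW.
have h1 : cabs (b + c * (- clog s) ^+ k) <= (cabs b + cabs c * C1) * expR ((g - y) * v).
  apply: (le_trans (cabsD _ _)); rewrite mulrDl cabsM cabsX cabsN.
  apply: lerD; first by rewrite ler_peMr ?cabs_ge0.
  rewrite -mulrA ler_wpM2l ?cabs_ge0//; apply: le_trans (H1 v v0).
  by apply: lerXn2r; rewrite ?nnegrE ?cabs_ge0.
apply: (le_trans (ler_wpM2r (expR_ge0 _) h1)).
rewrite -!mulrA; apply: ler_wpM2l.
  by rewrite addr_ge0 ?cabs_ge0// mulr_ge0 ?cabs_ge0// ltW.
rewrite -!expRD ler_expR /v; case/andP: g01 => g0 _.
have : g * ln `|t| <= g * L by rewrite ler_wpM2l// ltW.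
lra.
Qed.

(** The bound on singular terms excludes [t = 0]. The value there is carried by this indicator,
    which makes the domination valid everywhere without changing its integral. *)
Lemma Rint_indicator_point z : rintegrable setT (\1_(`[z, z]%classic) : R -> R) /\
  Rintegral mu setT (\1_(`[z, z]%classic) : R -> R) = 0.
Proof.
split; first exact: rintegrable_indicator.
rewrite /Rintegral integral_indic//= setIT lebesgue_measure_itv /= lte_fin ltxx.
by [].
Qed.

Variables (phi : R -> R) (eta : R).
Hypotheses (eta0 : 0 < eta) (cphi : continuous phi) (suphi : supported eta phi).

Lemma pairing_singular_term b c k y : y < 1 -> exists B, forall sg, 0 < sg < 1 -> forall w,
  cintegrable setT (fun t => singular_term b c k y (Complex sg t) * modulate phi w t) /\
  cabs (cintegral setT (fun t => singular_term b c k y (Complex sg t) * modulate phi w t)) <= B.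
Proof.
move=> y1; have [g [C [/andP[g0 g1] C0 H]]] := singular_term_bound b c k y1 (ltW eta0).
have [M M0 phiM] := supported_bounded eta0 cphi suphi.
have d0 : 0 < 1 - g by rewrite subr_gt0.
pose P t := powlog (1 - g) 0 t * expR (- t).
have iP : rintegrable setT P by exact: rintegrable_gamma.
have [iP' _] := rintegrable_reflect iP.
have P0 t : 0 <= P t.
  by rewrite /P mulr_ge0 ?expR_ge0// /powlog; case: ifPn => // _; rewrite expr0 mulr1 expR_ge0.
(* For [t] nonzero, [P t + P (- t)] is [|t|^(-g) e^(-|t|)], a Gamma integrand with parameter
   [1 - g > 0]; [e^eta] undoes its decay on the support of [phi]. *)
pose D t := C * M * expR eta * (P t + P (- t)).
have iD : rintegrable setT D by apply: rintegrableZ => //; exact: rintegrableD.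
have D0 t : 0 <= D t by rewrite /D !mulr_ge0 ?expR_ge0// addr_ge0.
exists (Rintegral mu setT D) => sg hsg w; have /andP[s0 _] := hsg.
pose f t := singular_term b c k y (Complex sg t) * modulate phi w t.
pose q t := cabs (f 0) * \1_(`[0, 0]%classic) t.
have [i0 I0] := Rint_indicator_point 0.
have iq : rintegrable setT q by exact: rintegrableZ.
have q0 t : 0 <= q t by rewrite /q mulr_ge0 ?cabs_ge0// indicE ler0n.
have fD t : cabs (f t) <= D t + q t.
  have [->|tn0] := eqVneq t 0.
    have -> : q 0 = cabs (f 0) by rewrite /q indicE mem_set ?mulr1//= in_itv/= lexx.
    by rewrite lerDr.
  apply: (@le_trans _ _ (D t)); last by rewrite lerDl.
  rewrite /f cabsM cabs_modulate.
  have [te|te] := leP `|t| eta; last by rewrite suphi// normr0 mulr0.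
  have t0 : 0 < `|t| by rewrite normr_gt0.
  have PE : P t + P (- t) = expR (- g * ln `|t|) * expR (- `|t|).
    have [tp|tp] := ltP 0 t.
      rewrite ger0_norm ?(ltW tp)// /P /powlog tp oppr_gt0 ltNge (ltW tp)/= mul0r addr0 expr0 mulr1.
      by congr (expR _ * _); ring.
    have tn : t < 0 by rewrite lt_neqAle tn0.
    rewrite ler0_norm// /P /powlog oppr_gt0 tn ltNge tp/= mul0r add0r expr0 mulr1.
    by congr (expR _ * _); ring.
  have h1 : cabs (singular_term b c k y (Complex sg t)) <= C * expR (- g * ln `|t|).
    by apply: H => //; rewrite t0.
  apply: (@le_trans _ _ (C * expR (- g * ln `|t|) * M)).
    by apply: ler_pM => //; exact: cabs_ge0.
  rewrite /D PE; set E := expR (- g * ln `|t|).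
  have E0 : 0 <= E by exact: expR_ge0.
  have -> : C * M * expR eta * (E * expR (- `|t|)) = C * E * M * (expR eta * expR (- `|t|)) by ring.
  rewrite ler_peMr ?mulr_ge0// -expRD -expR0 ler_expR; lra.
have iDq : rintegrable setT (fun t => D t + q t) by exact: rintegrableD.
have mf : cmeasurable [set: T] f.
  apply: cmeasurableM; last exact: cmeasurable_modulate.
  apply: (@eq_cmeasurable _ _ _ _ (fun t : T => (b + c * ((-1) * clog (Complex sg t)) ^+ k) * cexp ((- cr y) * clog (Complex sg t)))).
    by move=> t _; rewrite singular_termE// mulN1r mulNr.
  have ml := cmeasurable_clog_line s0.
  apply: cmeasurableM.
    apply: cmeasurableD; first exact: cmeasurable_cst.
    apply: cmeasurableM; first exact: cmeasurable_cst.
    by apply: cmeasurableX; apply: cmeasurableM => //; exact: cmeasurable_cst.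
  by apply: cmeasurable_cexp; apply: cmeasurableM => //; exact: cmeasurable_cst.
have if_ : cintegrable setT f by apply: (cintegrable_le measurableT mf _ iDq) => t _.
split => //.
have := cabs_cintegral_le measurableT if_ iDq (fun t _ => fD t).
by rewrite RintegralD// /q RintegralZl// I0 mulr0 addr0.
Qed.
End IntegrableSingularity.

(** * Transforms of the main terms and conclusion *)

Section MainTerms.
Context {R : realType}.
Local Notation mu := (@lebesgue_measure R).
Local Notation T := (measurableTypeR R).
Implicit Types (x y t sg : R) (s a b c : R[i]) (k : nat).

Definition log_term b c k y x : R[i] := b * cr (rgamma y) * cr (powlog y 0 x) +
  c * \sum_(j < k.+1) cr ('C(k, j)%:R * Dgam j y) * cr (powlog y (k - j) x).

Lemma powR_log_term b c k (e : R) x : 0 < x ->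
  cr (x `^ e) * (b * cr (rgamma (e + 1)) +
    c * \sum_(j < k.+1) cr ('C(k, j)%:R * Dgam j (e + 1) * ln x ^+ (k - j))) =
  log_term b c k (e + 1) x.
Proof.
move=> x0; have pE m : powlog (e + 1) m x = x `^ e * ln x ^+ m.
  by rewrite /powlog x0 addrK /powR gt_eqF.
rewrite /log_term mulrDr pE expr0 mulr1; congr (_ + _); first by rewrite mulrC.
rewrite mulrCA mulr_sumr; congr (_ * _); apply: eq_bigr => j _.
by rewrite pE -!crM; congr cr; ring.
Qed.

(** The values [rgamma y] and [Dgam j y] enter only as constants here, so any real [y < 1] is
    allowed. *)
Lemma log_term_bounded b c k y : y < 1 -> exists B, forall x, 1 <= x -> cabs (log_term b c k y x) <= B.
Proof.
move=> y1.
have H m : exists B, forall x, 1 <= x -> `|powlog y m x| <= B.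
  by have [B _ h] := @powlog_bounded R y m (or_introl y1); exists B.
have [f hf] := choice H.
exists (cabs (b * cr (rgamma y)) * f 0%N +
  cabs c * \sum_(j < k.+1) cabs (cr ('C(k, j)%:R * Dgam j y)) * f (k - j)%N) => x x1.
apply: (le_trans (cabsD _ _)); apply: lerD; rewrite cabsM; apply: ler_wpM2l; rewrite ?cabs_ge0//.
  by rewrite cabs_cr hf.
apply: (le_trans (cabs_sum _)); apply: ler_sum => j _.
by rewrite cabsM ler_wpM2l ?cabs_ge0// cabs_cr hf.
Qed.

Lemma admissible_log_term b c k y : 1 <= y < 2 -> admissible (log_term b c k y).
Proof.
move=> hy; have hp m : admissible (fun x => cr (powlog y m x)) by apply: admissible_powlog; left.
apply: admissibleD; first exact: admissibleZ.
by apply: admissibleZ; apply: admissible_sum => j; exact: admissibleZ.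
Qed.

Lemma claplace_log_term b c k y s : 1 <= y < 2 -> 0 < cRe s ->
  claplace (log_term b c k y) s = singular_term b c k y s.
Proof.
move=> /andP[y1 y2] s0; have y0 : 0 < y by exact: lt_le_trans y1.
have y02 : 0 < y < 2 by rewrite y0.
have ip m : cintegrable setT (fun x => cr (powlog y m x) * cexp (- s * cr x)) by exact: cintegrable_powlog.
have iZ z m : cintegrable setT (fun x => z * cr (powlog y m x) * cexp (- s * cr x)).
  by apply: eq_cintegrable (cintegrableZ z measurableT (ip m)) => // x _; rewrite mulrA.
have iS : cintegrable setT (fun x => (\sum_(j < k.+1) cr ('C(k, j)%:R * Dgam j y) * cr (powlog y (k - j) x)) * cexp (- s * cr x)).
  have [h _] := cintegrable_sum measurableT (fun j : 'I_k.+1 => iZ (cr ('C(k, j)%:R * Dgam j y)) (k - j)%N).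
  by apply: eq_cintegrable h => // x _; rewrite mulr_suml.
have icS : cintegrable setT (fun x => (c * \sum_(j < k.+1) cr ('C(k, j)%:R * Dgam j y) * cr (powlog y (k - j) x)) * cexp (- s * cr x)).
  by apply: eq_cintegrable (cintegrableZ c measurableT iS) => // x _; rewrite mulrA.
rewrite (claplaceD (iZ _ _) icS) (claplaceZ _ (ip 0%N)) (claplaceZ _ iS).
rewrite (claplace_sum (fun j : 'I_k.+1 => iZ (cr ('C(k, j)%:R * Dgam j y)) (k - j)%N)).
(* The [b] part is [powlog_laplace] of order 0, the [c] part that of order [k]. *)
have h0 := powlog_laplace 0 y02 s0; rewrite big_ord_recl big_ord0 addr0 bin0 mul1r expr0 subn0 in h0.
rewrite /singular_term mulrDl -mulrA; congr (_ + _).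
  by rewrite -[b / _]mulr1 -mulrA [_^-1 * 1]mulrC -h0.
rewrite -mulrA -(powlog_laplace k y02 s0); congr (_ * _).
by apply: eq_bigr => j _; rewrite (claplaceZ _ (ip _)).
Qed.

(** [y = 2] lies outside the open range of [powlog_laplace], hence the direct appeal to
    [plaplace_gamma] and Gamma(2) = 1. *)
Lemma claplace_linear a s : 0 < cRe s ->
  claplace (fun x => a * cr (powlog 2 0 x)) s = a / s ^+ 2.
Proof.
move=> s0; have h2 : 0 < 2 :> R by [].
rewrite (claplaceZ _ (cintegrable_powlog 0 h2 s0)); congr (_ * _).
rewrite -[claplace _ _]/(plaplace 2 0 s) plaplace_gamma// (gamma_fact 1) cr1 mul1r -cexp_inv.
congr (_^-1); rewrite expr2 -[in RHS](cexp_clog s0) -cexpD; congr cexp.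
have -> : 2 = 1 + 1 :> R by ring.
by rewrite crD cr1 mulrDl mul1r.
Qed.

(** The step is shortened to at most 1, the range in which increments of an admissible function are
    bounded. *)
Lemma boundedly_decreasingB (tau h : R -> R[i]) : boundedly_decreasing tau -> admissible h ->
  boundedly_decreasing (fun x => tau x - h x).
Proof.
move=> [b1 b2] [_ _ _ [B B0 HB]].
have H (p : R[i] -> R) : (forall z w, p (z - w) = p z - p w) -> (forall z, `|p z| <= cabs z) ->
    boundedly_decreasing_real (p \o tau) -> boundedly_decreasing_real (p \o (fun x => tau x - h x)).
  move=> pB pc [d [d0 [M [X HM]]]].
  exists (Num.min d 1); split; first by rewrite lt_min d0 ltr01.
  exists (M + B), (Num.max X 1) => x u; rewrite ge_max => /andP[Xx x1].
  rewrite le_min => /andP[u0 /andP[ud u1]].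
  have h1 : - M <= p (tau (x + u)) - p (tau x) by apply: HM => //; rewrite u0.
  have h2 : `|p (h (x + u)) - p (h x)| <= B.
    by rewrite -pB; apply: (le_trans (pc _)); apply: HB => //; rewrite u0.
  move: h2; rewrite /comp !pB ler_norml => /andP[h2 h3]; lra.
split.
- by apply: H b1; [exact: cReB | exact: normRe_cabs].
- by apply: H b2; [exact: cImB | exact: normIm_cabs].
Qed.

Lemma complex_tauberian (rho : R -> R[i]) (phi K : R -> R) (eta A M' : R) :
  0 < eta -> continuous phi -> supported eta phi ->
  (forall v, cintegral setT (fun t => cr (phi t) * wave v t) = cr (K v)) ->
  continuous K -> (forall v, 0 <= K v) -> (forall v, K v * (1 + v ^+ 2) ^+ 2 <= A) ->
  0 < Rintegral mu setT K ->
  cmeasurable [set: T] (rho : T -> R[i]) -> (forall x, x < 0 -> rho x = 0) ->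
  (forall s, 0 < cRe s -> cintegrable setT (fun x => rho x * cexp (- s * cr x))) ->
  boundedly_decreasing rho ->
  (forall y, \forall sg \near (0 : R)^'+,
    cabs (cintegral setT (fun t => claplace rho (Complex sg t) * modulate phi y t)) <= M') ->
  exists B X, forall x, X <= x -> cabs (rho x) <= B.
Proof.
move=> eta0 cphi suphi hK cK K0 KA Kp [m1 m2] rho0 irho [b1 b2] hM'.
(* Multiplication by the real [K] and [e^(-sg x)] commutes with real and imaginary parts, so each
   component of [rho] meets the hypotheses of [tauberian_bound]. *)
have H (p : R[i] -> R) : (forall z, `|p z| <= cabs z) -> (forall x z, p (z * cr x) = p z * x) -> p 0 = 0 ->
    measurable_fun [set: T] (fun x => p (rho x)) -> boundedly_decreasing_real (p \o rho) ->
    (forall f, p (cintegral setT f) = Rintegral mu setT (p \o f)) ->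
    (forall f, cintegrable setT f -> rintegrable setT (p \o f)) ->
    exists S X, forall x, X <= x -> `|p (rho x)| <= S.
  move=> pc pM p0 mp bp pI pi.
  have [M [X [M0 X0 HM]]] := boundedly_decreasing_linear bp.
  have kE sg x : cexp (- cr sg * cr x) = cr (expR (- sg * x)) :> R[i] by rewrite -crN -crM cexp_cr.
  have [S HS] : exists S, forall x, X <= x -> `|p (rho x)| <= S; last by exists S, X.
  apply: (@tauberian_bound R (p \o rho) K A M X M') => //.
  - by move=> x x0; rewrite /comp rho0.
  - move=> sg sg0; apply: eq_rintegrable (pi _ (irho (cr sg) sg0)) => // x _.
    by rewrite /comp kE pM.
  move=> y.
  near=> sg.
  have sg0 : 0 < sg by near: sg; exact: nbhs_right_gt.
  have [_ _ E] := pairing_claplace eta0 cphi suphi hK y (conj m1 m2) (irho (cr sg) sg0).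
  have -> : Rintegral mu setT (fun x => (p \o rho) x * expR (- sg * x) * K (x - y)) =
      p (cintegral setT (fun t => claplace rho (Complex sg t) * modulate phi y t)).
    rewrite E pI; apply: eq_Rint => x _.
    by rewrite /comp kE [cr (K _) * _]mulrC !pM.
  by apply: (le_trans (pc _)); near: sg; exact: hM'.
have [S1 [X1 H1]] : exists S X, forall x, X <= x -> `|cRe (rho x)| <= S.
  apply: H => //; first exact: normRe_cabs.
  - by move=> x z; rewrite cE mulr0 subr0.
  - by move=> f [].
have [S2 [X2 H2]] : exists S X, forall x, X <= x -> `|cIm (rho x)| <= S.
  apply: H => //; first exact: normIm_cabs.
  - by move=> x z; rewrite cE mulr0 add0r.
  - by move=> f [].
exists (S1 + S2), (Num.max X1 X2) => x; rewrite ge_max => /andP[Xx1 Xx2].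
by apply: (le_trans (cabs_le_ReIm _)); apply: lerD; [exact: H1 | exact: H2].
Unshelve. all: end_near. Qed.
End MainTerms.

Theorem theorem3p7 (R : realType) (tau : R -> R[i]) (a : R[i]) (N : nat)
  (b c : nat -> R[i]) (beta : nat -> R) (k : nat -> nat) :
  L1loc tau ->
  boundedly_decreasing tau ->
  (forall x : R, x < 0 -> tau x = 0) ->
  (forall s : R[i], 0 < cRe s -> laplace_converges tau s) ->
  (forall n : nat, (n <= N)%N -> beta n < 1) ->
  pseudomeasure_boundary_at0
    (fun s : R[i] => laplace tau s - a / s ^+ 2
       - \sum_(n < N.+1)
           (b n + c n * clog s^-1 ^+ k n) / cpow s (cr (beta n + 1))) ->
  exists M X : R, forall x : R, X <= x ->
    cabs (tau x -
      (a * cr x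
       + \sum_(n < N.+1) cr (x `^ beta n) *
           (b n * cr (rgamma (beta n + 1))
            + c n * \sum_(j < (k n).+1)
                cr ('C(k n, j)%:R * Dgam j (beta n + 1) * ln x ^+ (k n - j))))) <= M.
Proof.
move=> l1 bd tau0 lc beta1 bnd.
have b1 (n : 'I_N.+1) : beta n < 1 by apply: beta1; rewrite -ltnS.
have y12 (n : 'I_N.+1) : 0 <= beta n -> 1 <= beta n + 1 < 2.
  by move=> h; have := b1 n => h'; apply/andP; split; lra.
pose h (n : 'I_N.+1) x :=
  if 0 <= beta n then log_term (b n) (c n) (k n) (beta n + 1) x else 0.
(* Terms with [beta < 0] stay on the transform side: for [beta <= -1] the function [x^beta] is not
   integrable at 0 and has no transform to subtract. *)
pose r (n : 'I_N.+1) s :=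
  if 0 <= beta n then 0 else singular_term (b n) (c n) (k n) (beta n + 1) s.
pose main x := a * cr (powlog 2 0 x) + \sum_n h n x.
pose rho x := tau x - main x.
have ah n : admissible (h n).
  rewrite /h; case: (boolP (0 <= beta n)) => [b0|_]; last exact: admissible0.
  by apply: admissible_log_term; exact: y12.
have alin : admissible (fun x => a * cr (powlog 2 0 x)).
  by apply: admissibleZ; apply: admissible_powlog; right.
have asum := admissible_sum ah.
have amain : admissible main by exact: admissibleD.
have itau := laplace_integrable l1 bd tau0 lc.
have [mmain main0 imain _] := amain; have [_ _ ilin _] := alin.
have [_ _ isum _] := asum.
have ih n s : 0 < cRe s -> cintegrable setT (fun x => h n x * cexp (- s * cr x)).
  by have [_ _ + _] := ah n; apply.
have irho s : 0 < cRe s -> cintegrable setT (fun x => rho x * cexp (- s * cr x)).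
  move=> s0; apply: eq_cintegrable (cintegrableB measurableT (itau s s0) (imain s s0)) => // x _.
  by rewrite mulrBl.
have mrho : cmeasurable [set: measurableTypeR R] (rho : measurableTypeR R -> R[i]).
  apply: (@eq_cmeasurable _ _ _ _ (fun x => tau x + (- 1) * main x)).
    by move=> x _; rewrite mulN1r.
  apply: cmeasurableD; last by apply: cmeasurableM => //; exact: cmeasurable_cst.
  by split; apply: measurable_L1loc => u v; have [] := l1 u v.
have claplace_rho s : 0 < cRe s -> claplace rho s =
    laplace tau s - a / s ^+ 2 - \sum_(n < N.+1)
      (b n + c n * clog s^-1 ^+ k n) / cpow s (cr (beta n + 1)) + \sum_n r n s.
  move=> s0; rewrite (laplace_claplace tau0 (itau s s0)).
  have -> : claplace rho s = claplace tau s - claplace main s.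
    rewrite /claplace -(cintegralB measurableT (itau s s0) (imain s s0)).
    by apply: eq_cintegral => x _; rewrite mulrBl.
  rewrite (claplaceD (ilin s s0) (isum s s0)) (claplace_linear a s0).
  rewrite (claplace_sum (fun n => ih n s s0)) opprD addrA -[RHS]addrA; congr (_ + _).
  rewrite -!sumrN -big_split; apply: eq_bigr => n _; rewrite /h /r /=.
  case: (boolP (0 <= beta n)) => b0; first by rewrite (claplace_log_term _ _ _ (y12 n b0) s0) addr0.
  rewrite /singular_term addNr (_ : claplace _ _ = 0) ?oppr0//.
  rewrite /claplace -[RHS](cintegral0 setT).
  by apply: eq_cintegral => x _; rewrite mul0r.
have [e e0 He] := boundary_pairing_bounded bnd.
have [phi [K [A [cphi suphi tphi hK [cK K0 KA Kp]]]]] := positive_definite_test_functions e0.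
have iK := rintegrable_decay cK K0 KA.
have [B HB] := He phi K K0 iK hK tphi.
have e20 : 0 < e / 2 by rewrite divr_gt0.
have rB (n : 'I_N.+1) : exists C, forall sg, 0 < sg < 1 -> forall w,
    cintegrable setT (fun t => r n (Complex sg t) * modulate phi w t) /\
    cabs (cintegral setT (fun t => r n (Complex sg t) * modulate phi w t)) <= C.
  rewrite /r; case: (boolP (0 <= beta n)) => [_|bn0].
    exists 0 => sg _ w; rewrite (_ : (fun t => _) = (fun=> 0)).
      by rewrite cintegral0 cabs0; split => //; exact: cintegrable0.
    by apply/funext => t; rewrite mul0r.
  apply: (pairing_singular_term e20 cphi suphi).
  by move: bn0; rewrite -ltNge; lra.
have [C HC] := choice rB.
have [M [X HM]] : exists B X, forall x, X <= x -> cabs (rho x) <= B.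
  (* [B] bounds the pairing with the function of the hypothesis, [C n] that with the [n]-th
     remaining singular term, all uniformly in the centre. *)
  apply: (complex_tauberian (M' := B + \sum_n C n) e20 cphi suphi hK cK K0 KA Kp) => //.
  - by move=> x x0; rewrite /rho tau0// main0// subrr.
  - exact: boundedly_decreasingB.
  move=> w; near=> sg.
  have sg0 : 0 < sg by near: sg; exact: nbhs_right_gt.
  have sg1 : sg < 1 by near: sg; exact: nbhs_right_lt.
  have sg01 : 0 < sg < 1 by rewrite sg0.
  have [ir _ _] := pairing_claplace e20 cphi suphi hK w mrho (irho (cr sg) sg0).
  have [irs Ers] := cintegrable_sum measurableT (fun n => (HC n sg sg01 w).1).
  have iF := cintegrableB measurableT ir irs.
  have -> : cintegral setT (fun t => claplace rho (Complex sg t) * modulate phi w t) =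
      cintegral setT (fun t => claplace rho (Complex sg t) * modulate phi w t -
        \sum_n r n (Complex sg t) * modulate phi w t) +
      \sum_n cintegral setT (fun t => r n (Complex sg t) * modulate phi w t).
    by rewrite (cintegralB measurableT ir irs) Ers subrK.
  apply: (le_trans (cabsD _ _)); apply: lerD; last first.
    apply: (le_trans (cabs_sum _)); apply: ler_sum => n _.
    by have [_ +] := HC n sg sg01 w; apply.
  have FE t : claplace rho (Complex sg t) * modulate phi w t -
      \sum_n r n (Complex sg t) * modulate phi w t =
      (laplace tau (Complex sg t) - a / Complex sg t ^+ 2 - \sum_(n < N.+1)
        (b n + c n * clog (Complex sg t)^-1 ^+ k n) / cpow (Complex sg t) (cr (beta n + 1)))
      * modulate phi w t.
    by rewrite (claplace_rho (Complex sg t) sg0) -mulr_suml -mulrBl addrK.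
  rewrite (eq_cintegral (fun t _ => FE t)).
  by near: sg; exact: HB.
(* Terms with [beta < 0] occur in the statement but not in [main]; being bounded, they go into the
   final constant. *)
have rest (n : 'I_N.+1) : exists D, forall x, 1 <= x ->
    cabs (log_term (b n) (c n) (k n) (beta n + 1) x - h n x) <= D.
  rewrite /h; case: (boolP (0 <= beta n)) => b0.
    by exists 0 => x _; rewrite subrr cabs0.
  have y1 : beta n + 1 < 1 by move: b0; rewrite -ltNge; lra.
  have [D HD] := log_term_bounded (b n) (c n) (k n) y1.
  by exists D => x x1; rewrite subr0 HD.
have [D HD] := choice rest.
exists (M + \sum_n D n), (Num.max X 1) => x; rewrite ge_max => /andP[Xx x1].
have x0 : 0 < x by exact: lt_le_trans x1.
have lin : powlog 2 0 x = x.
  by rewrite /powlog x0 expr0 mulr1 (_ : 2 - 1 = 1) ?mul1r ?lnK//; ring.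
under eq_bigr do rewrite (powR_log_term _ _ _ _ x0).
have -> : tau x - (a * cr x + \sum_(n < N.+1) log_term (b n) (c n) (k n) (beta n + 1) x) =
    rho x - \sum_(n < N.+1) (log_term (b n) (c n) (k n) (beta n + 1) x - h n x).
  by rewrite /rho /main lin sumrB; ring.
apply: (le_trans (cabsD _ _)); rewrite cabsN; apply: lerD; first exact: HM.
by apply: (le_trans (cabs_sum _)); apply: ler_sum => n _; exact: HD.
Unshelve. all: end_near. Qed.
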